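(* Let $T>0$ and $d\ge1$. Suppose $H:\mathbb{R}^d\times\mathbb{R}^d\times\mathcal{P}_2(\mathbb{R}^d)\to\mathbb{R}$ and $\mathcal{G}:\mathcal{P}_2(\mathbb{R}^d)\to\mathbb{R}$ satisfy the Data Assumptions of the context. For $\varepsilon>0$ let $U^\varepsilon:[0,T]\times\mathcal{P}_2(\mathbb{R}^d)\to\mathbb{R}$ be a bounded viscosity solution of $$-\partial_t U^\varepsilon+\int_{\mathbb{R}^d}H(x,\partial_\mu U^\varepsilon(t,\mu,x),\mu)\,d\mu(x)-\varepsilon\int_{\mathbb{R}^d}\mathrm{tr}\big[\nabla\partial_\mu U^\varepsilon(t,\mu,x)\big]\,d\mu(x)=0\qquad(\mathrm{HJ}_\varepsilon)$$ and $U:[0,T]\times\mathcal{P}_2(\mathbb{R}^d)\to\mathbb{R}$ a bounded viscosity solution of $$-\partial_t U+\int_{\mathbb{R}^d}H(x,\partial_\mu U(t,\mu,x),\mu)\,d\mu(x)=0,\qquad(\mathrm{HJ}_0)$$ with $U^\varepsilon(T,\mu)=U(T,\mu)=\mathcal{G}(\mu)$ for all $\mu$. Suppose that, for each $\varepsilon$, $U^\varepsilon$ is $W_1$-Lipschitz in $\mu$ uniformly in time, that $U$ is $W_2$-Lipschitz in $\mu$ uniformly in time, and that $U$ is jointly continuous for the product topology of $[0,T]\times\mathcal{P}_2(\mathbb{R}^d)$, with $\mathcal{P}_2(\mathbb{R}^d)$ endowed with the weak convergence described in the context. If $U^\varepsilon$ is a classical subsolution of $(\mathrm{HJ}_\varepsilon)$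 such that $\Delta_x\mathcal{D}_\mu U^\varepsilon(t,\mu,x)\le C$ for some $C$ independent of $(t,\mu,x)\in[0,T]\times\mathcal{P}_2(\mathbb{R}^d)\times\mathbb{R}^d$, then $$U^\varepsilon(t,\mu)-U(t,\mu)\le C(T-t)\varepsilon\qquad\forall(t,\mu)\in[0,T]\times\mathcal{P}_2(\mathbb{R}^d).$$ In particular, if $d\ge2$ and $\mu\mapsto U^\varepsilon(t,\mu)$ is $\Lambda$-geodesically concave, the result holds with $C=d\Lambda$.
   Context: **Wasserstein space.** $\mathcal{P}_2(\mathbb{R}^d)$ is the set of Borel probability measures on $\mathbb{R}^d$ with finite second moment $\mathcal{M}_2(\mu)=\int|x|^2d\mu$; $W_1,W_2$ are the $L^1$- and $L^2$-Wasserstein distances. A plan on $\mathbb{R}^{2d}$ is optimal if it is an optimal coupling of its marginals for the cost $|x-y|^2$. $\pi_i$ are coordinate projections. Weak convergence $\mu_n\to\mu$ in $\mathcal{P}_2(\mathbb{R}^d)$ means narrow convergence together with $\sup_n\mathcal{M}_2(\mu_n)<\infty$. **Data Assumptions.** (a) $H$ is continuous; (b) there is $C>0$ such that for all $p,q,x,y\in\mathbb{R}^d$, $\mu,\nu\in\mathcal{P}_2(\mathbb{R}^d)$: $|H(x,p,\mu)-H(y,q,\nu)|\le C(1+|p|+|q|)(W_2(\mu,\nu)+|x-y|+|p-q|)$; (c) there is $C>0$ with $|H(x,p,\mu)|\le C(1+|x|^2+|p|^2+\mathcal{M}_2(\mu))$ for all $(x,p,\mu)$; $\mathcal{G}$ is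 bounded and $W_1$-Lipschitz. **Flat derivative and classical subsolutions.** $F:\mathcal{P}_2(\mathbb{R}^d)\to\mathbb{R}$ is flat differentiable at $\mu$ if there is a Borel map $\mathcal{D}_\mu F(\mu,\cdot)$ of at most quadratic growth with $\lim_{h\to0^+}\frac{F((1-h)\mu+h\nu)-F(\mu)}{h}=\int\mathcal{D}_\mu F(\mu,x)(\nu-\mu)(dx)$ for all $\nu\in\mathcal{P}_2(\mathbb{R}^d)$, normalized by $\int\mathcal{D}_\mu F(\mu,x)d\mu(x)=0$. $F$ is fully $C^1$ if $\mathcal{D}_\mu F$ is jointly continuous in $(\mu,x)$ with uniform quadratic growth and $\nabla\mathcal{D}_\mu F$ (gradient in $x$) exists, is jointly continuous and has uniform linear growth; then $\partial_\mu F=\nabla\mathcal{D}_\mu F$. $F$ is partially $C^2$ if it is fully $C^1$ and $\nabla^2\mathcal{D}_\mu F$ exists, is jointly continuous and uniformly bounded. $U^\varepsilon$ is a classical subsolution of $(\mathrm{HJ}_\varepsilon)$ if it is partially $C^2$ (with $\partial_tU^\varepsilon$ existing) and satisfies $(\mathrm{HJ}_\varepsilon)$ with $\le0$ in place of $=0$ at every $(t,\mu)\in[0,T)\times\mathcal{P}_2(\mathbb{R}^d)$. **Geodesic concavity.** $F$ is $\Lambda$-geodesically concave ($\Lambda\in\mathbb{R}$) if along every constant-speed $W_2$-geodesic $(\mu_t)_{t\in[0,1]}$, $F(\mu_t)\ge(1-t)F(\mu_0)+tF(\mu_1)-\frac{\Lambda}{2}t(1-t)W_2^2(\mu_0,\mu_1)$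 for all $t\in[0,1]$. **Plans as velocities.** For $\mu\in\mathcal{P}_2(\mathbb{R}^d)$ let $\mathcal{P}_{2,\mu}(\mathbb{R}^{2d})=\{\gamma\in\mathcal{P}_2(\mathbb{R}^{2d}):(\pi_1)_\#\gamma=\mu\}$, $\exp_\mu(\gamma)=(\pi_1+\pi_2)_\#\gamma$, $\|\gamma\|_\mu=(\int|y|^2d\gamma(x,y))^{1/2}$, $\lambda\cdot\gamma=(\pi_1,\lambda\pi_2)_\#\gamma$. $\Gamma_\mu(\gamma,\xi)$ is the set of $\theta\in\mathcal{P}(\mathbb{R}^{3d})$ with $(\pi_1,\pi_2)_\#\theta=\gamma$, $(\pi_1,\pi_3)_\#\theta=\xi$; $\langle\gamma,\xi\rangle_{\theta,\mu}=\int\langle y,z\rangle d\theta(x,y,z)$; $W_\mu^2(\gamma,\xi)=\min_{\theta\in\Gamma_\mu(\gamma,\xi)}\int|y-z|^2d\theta$. $\mathrm{Tan}^K_\mu\mathcal{P}_2(\mathbb{R}^d)$ is the $W_\mu$-closure of the set of $\gamma\in\mathcal{P}_{2,\mu}(\mathbb{R}^{2d})$ such that $(\pi_1,\pi_1+\eta\pi_2)_\#\gamma$ is optimal for some $\eta>0$. **Sub/superdifferential.** $(r,\gamma)\in\partial^-\phi(t,\mu)$ means $\gamma\in\mathrm{Tan}^K_\mu\mathcal{P}_2(\mathbb{R}^d)$ and $\phi(s,\exp_\mu(\xi))-\phi(t,\mu)\ge r(s-t)+\langle\xi,\gamma\rangle_{\theta,\mu}+o(|s-t|+\|\xi\|_\mu)$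 for all $s\in[0,T]$, $\xi\in\mathcal{P}_{2,\mu}(\mathbb{R}^{2d})$, $\theta\in\Gamma_\mu(\gamma,\xi)$; $\partial^+$ is defined by the reversed inequality. If $\mu$ is absolutely continuous, elements of $\mathrm{Tan}^K_\mu$ are of the form $(\mathrm{Id}\times p)_\#\mu$ with $p\in L^2_\mu(\mathbb{R}^d;\mathbb{R}^d)$, and one writes $p$ for the plan. **Viscosity solution of $(\mathrm{HJ}_0)$.** With $\mathcal{H}(\gamma)=\int H(x,z,(\pi_1)_\#\gamma)d\gamma(x,z)$: subsolution (supersolution) if for all $t\in[0,T)$, $\mu$, and $(r,\gamma)\in\partial^+U(t,\mu)$ (resp. $\partial^-U(t,\mu)$), $-r+\mathcal{H}(\gamma)\le0$ (resp. $\ge0$); solution if both. **Viscosity solution of $(\mathrm{HJ}_\varepsilon)$.** $\mathcal{E}(\mu)=\int\log\mu\,d\mu$ if $\mu$ is absolutely continuous (density also denoted $\mu$), $+\infty$ otherwise; $\mathcal{I}(\mu)=\int|\nabla\log\mu|^2d\mu$ if $\mu$ is absolutely continuous and this is finite, $+\infty$ otherwise. $V$ is a subsolution if there is $K>0$, depending only on $V,H,\varepsilon$, such that for every $\delta>0$, whenever $t\in[0,T)$, $\mathcal{I}(\mu)<\infty$, $(r,p)\in\partial^+(V-\delta\mathcal{E})(t,\mu)$: $-r+\varepsilon\int\langle\nabla\log\mu,p\rangle d\mu+\int H(x,p(x),\mu)d\mu(x)\le K\delta$; a supersolution if similarly for $(r,p)\in\partial^-(V+\delta\mathcal{E})(t,\mu)$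 the left-hand side is $\ge-K\delta$; a solution if both. *)

(* Defs.v *)
From HB Require Import structures.
From mathcomp Require Import all_boot all_order all_algebra.
From mathcomp Require Import all_classical all_reals all_analysis.
From mathcomp Require Import measurable_realfun.
Set Implicit Arguments. Unset Strict Implicit. Unset Printing Implicit Defensive.
Import Order.TTheory GRing.Theory Num.Theory.
Import numFieldNormedType.Exports.
Local Open Scope classical_set_scope.
Local Open Scope ring_scope.

(* 'M[R]_(m, n) carries the Borel sigma-algebra of its topology; the library's
   norm on it is the sup norm, hence `enorm` below for the Euclidean one. *)
Definition borel_mx_display : measure_display.
Proof. exact. Qed.

HB.instance Definition _ (R : realType) (m n : nat) :=
  @isMeasurable.Build borel_mx_display 'M[R]_(m, n)
    <<s (@open 'M[R]_(m, n)) >> (@sigma_algebra0 _ setT _)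
    (@sigma_algebraC 'M[R]_(m, n) _) (@sigma_algebra_bigcup _ setT _).

Lemma measurable_coord (R : realType) n (j : 'I_n) :
  measurable_fun setT (fun v : 'rV[R]_n => v 0 j).
Proof.
apply: (@measurability _ _ _ _ _ _ (@RGenOInfty.G R)).
  exact: RGenOInfty.measurableE.
move=> _ [_ [a ->] <-]; rewrite setTI; apply: sub_sigma_algebra.
apply: open_comp; last exact: interval_open.
by move=> v _; exact: coord_continuous.
Qed.

Lemma mx_ballP (R : realType) n (x y : 'rV[R]_n) (e : R) : 0 < e ->
  ball x e y <-> forall j, `|x 0 j - y 0 j| < e.
Proof.
move=> e0; split=> [[_ h] j|h]; first exact: h.
by split=> // i j; rewrite ord1; exact: h.
Qed.

Lemma open_rV_bigcup (R : realType) n (A : set 'rV[R]_n) : open A ->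
  A = \bigcup_(p in [set p : 'rV[rat]_n * nat |
         ball (map_mx ratr p.1 : 'rV[R]_n) p.2.+1%:R^-1 `<=` A])
        ball (map_mx ratr p.1 : 'rV[R]_n) p.2.+1%:R^-1.
Proof.
move=> oA; apply/seteqP; split; last by move=> x [p /= h]; exact: h.
move=> x Ax.
have /nbhs_ballP[e/= e0 xe] : nbhs x A by exact: open_nbhs_nbhs.
have [k ke] : exists k, k.+1%:R^-1 < e / 2.
  have [k _ /(_ k (leqnn _)) h] :=
    near_infty_natSinv_lt (PosNum (divr_gt0 e0 (ltr0Sn R 1))).
  by exists k.
have k0 : 0 < k.+1%:R^-1 :> R by rewrite invr_gt0.
have /choice[q qx] : forall j, exists q : rat, `|ratr q - x 0 j| < k.+1%:R^-1.
  move=> j.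
  have /rat_in_itvoo[q] : x 0 j - k.+1%:R^-1 < x 0 j + k.+1%:R^-1.
    by rewrite ltrD2l gtrN.
  by rewrite in_itv/= => h; exists q; rewrite ltr_distl.
exists (\row_j q j, k) => /=; last first.
  by apply/mx_ballP => // j; rewrite !mxE.
move=> y /mx_ballP h; apply: xe; apply/mx_ballP => // j.
have := h k0 j; rewrite !mxE => hj.
rewrite [ltRHS]splitr -(subrKA (ratr (q j))).
apply: (le_lt_trans (ler_normD _ _)); apply: ltrD.
  by rewrite distrC (lt_trans (qx j)).
exact: lt_trans hj _.
Qed.

Lemma measurable_fun_rV d (T : measurableType d) (R : realType) n
    (f : T -> 'rV[R]_n) :
  (forall j, measurable_fun setT (fun x => f x 0 j)) -> measurable_fun setT f.
Proof.
move=> mf; apply: (@measurability _ _ _ _ _ _ (@open 'rV[R]_n)) => // _ [A oA <-].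
rewrite setTI (open_rV_bigcup oA) bigcup_mkcond preimage_bigcup.
apply: countable_bigcupT_measurable; first exact: countableP.
move=> p; case: ifPn => _; last by rewrite preimage_set0.
set e := _^-1; have e0 : 0 < e by rewrite invr_gt0.
have -> : f @^-1` ball (map_mx ratr p.1 : 'rV[R]_n) e =
    \bigcap_(j in [set: 'I_n])
      ((fun x => f x 0 j) @^-1` ball (ratr (p.1 0 j) : R) e).
  apply/seteqP; split => x.
    by move=> /(mx_ballP _ _ e0) h j _; have := h j; rewrite mxE.
  by move=> h; apply/mx_ballP => // j; have := h j I; rewrite mxE.
apply: fin_bigcap_measurable => // j _.
rewrite -[X in measurable X]setTI; apply: mf => //.
exact: measurable_ball.
Qed.


Definition cons_rV (R : realType) n (p : 'rV[R]_n * R) : 'rV[R]_n.+1 :=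
  row_mx p.2%:M p.1 : 'rV[R]_(1 + n).

Lemma measurable_cons_rV (R : realType) n :
  measurable_fun setT (@cons_rV R n).
Proof.
apply: measurable_fun_rV => j; rewrite /cons_rV.
have [i|i] := split_ordP (j : 'I_(1 + n)) => ->.
  rewrite (_ : (fun _ => _) = snd); first exact: measurable_snd.
  by apply/funext => p; apply: (etrans (row_mxEl _ _ _ _)); rewrite ord1 mxE eqxx.
rewrite (_ : (fun _ => _) = (fun v : 'rV[R]_n => v 0 i) \o fst).
  by apply: measurableT_comp; [exact: measurable_coord|exact: measurable_fst].
by apply/funext => p; exact: (etrans (row_mxEr _ _ _ _)).
Qed.

HB.instance Definition _ (R : realType) n :=
  isMeasurableFun.Build _ _ _ _ (@cons_rV R n) (@measurable_cons_rV R n).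

(* Lebesgue measure on R^n, by iterated products with the measure of R; the
   long identifier is the canonical measure structure of `pushforward`, given
   explicitly since its measurability argument cannot be inferred. *)
Fixpoint lebesgue_rV (R : realType) n : {measure set 'rV[R]_n -> \bar R} :=
  match n with
  | 0 => \d_(0 : 'rV[R]_0)
  | n.+1 => measure_function_pushforward__canonical__measure_function_Measure
      (lebesgue_rV R n \x @lebesgue_measure R)%E (@measurable_cons_rV R n)
  end.

Section euclidean.
Context {R : realType} {d : nat}.
Implicit Types (f : 'rV[R]_d -> R) (x y : 'rV[R]_d).

Definition dot x y : R := \sum_(i < d) x 0 i * y 0 i.
Definition enorm x : R := Num.sqrt (dot x x).

Definition partial (i : 'I_d) f x : R := 'D_(delta_mx 0 i : 'rV[R]_d) f x.
Definition grad f x : 'rV[R]_d := \row_i partial i f x.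
Definition hessian f x : 'M[R]_d := 'J (grad f) x.
Definition laplacian f x : R := \tr (hessian f x).

Fixpoint Ck (k : nat) f : Prop :=
  if k is k'.+1 then
    (forall x, differentiable f x) /\ (forall i, Ck k' (partial i f))
  else continuous f.

Definition test_function f : Prop :=
  (forall k, Ck k f) /\ (exists M : R, forall x, M < enorm x -> f x = 0).

End euclidean.

(* [f_# m = m']. A measure of the library is a function defined on all sets, and
   only its values on measurable sets matter; hence images, marginals and
   mixtures are relations rather than equalities. All maps [f] used below are
   Borel. *)
Definition is_image d1 d2 (T1 : measurableType d1) (T2 : measurableType d2)
    (R : realType) (f : T1 -> T2) (m : set T1 -> \bar R) (m' : set T2 -> \bar R) :=
  forall A, measurable A -> m' A = pushforward m f A.

Record P2 (R : realType) (d : nat) := MkP2 {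
  P2prob :> probability 'rV[R]_d R ;
  P2moment : (\int[P2prob]_x (enorm x ^+ 2)%:E < +oo)%E }.

Section wasserstein.
Context {R : realType} {d : nat}.
Implicit Types (t s e : R) (mu nu : P2 R d) (pi : probability ('rV[R]_d * 'rV[R]_d)%type R).

Definition M2 mu : R := \int[mu]_x (enorm x ^+ 2).

Definition coupling mu nu pi : Prop := is_image fst pi mu /\ is_image snd pi nu.

Definition W1 mu nu : R :=
  fine (ereal_inf [set (\int[pi]_z (enorm (z.1 - z.2))%:E)%E
                  | pi in [set pi | coupling mu nu pi]]).

Definition W2 mu nu : R :=
  Num.sqrt (fine (ereal_inf [set (\int[pi]_z (enorm (z.1 - z.2) ^+ 2)%:E)%E
                            | pi in [set pi | coupling mu nu pi]])).

Definition optimal_plan pi : Prop :=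
  forall pi' : probability ('rV[R]_d * 'rV[R]_d)%type R,
  is_image fst pi (pushforward pi' fst) ->
  is_image snd pi (pushforward pi' snd) ->
  (\int[pi]_z (enorm (z.1 - z.2) ^+ 2)%:E <=
   \int[pi']_z (enorm (z.1 - z.2) ^+ 2)%:E)%E.

Definition weak_cvg (mu_ : nat -> P2 R d) mu : Prop :=
  (forall f : 'rV[R]_d -> R, continuous f ->
     (exists M : R, forall x, `|f x| <= M) ->
     (\int[mu_ n]_x f x) @[n --> \oo] --> \int[mu]_x f x) /\
  (exists M : R, forall n, M2 (mu_ n) <= M).

(* Joint continuity on E x P_2(R^d), for the metric W_2 on P_2(R^d). *)
Definition W2_continuous {E V : normedModType R} (f : E -> P2 R d -> V) : Prop :=
  forall x mu e, 0 < e -> exists2 del : R, 0 < del &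
    forall y nu, `|y - x| < del -> W2 mu nu < del -> `|f y nu - f x mu| < e.

Definition is_geodesic (mu_ : R -> P2 R d) : Prop :=
  forall s t, 0 <= s <= 1 -> 0 <= t <= 1 ->
  W2 (mu_ s) (mu_ t) = `|t - s| * W2 (mu_ 0) (mu_ 1).

Definition geodesically_concave (Lam : R) (F : P2 R d -> R) : Prop :=
  forall mu_ : R -> P2 R d, is_geodesic mu_ -> forall t, 0 <= t <= 1 ->
  F (mu_ t) >= (1 - t) * F (mu_ 0) + t * F (mu_ 1)
               - Lam / 2 * t * (1 - t) * W2 (mu_ 0) (mu_ 1) ^+ 2.

End wasserstein.

Section flat_derivative.
Context {R : realType} {d : nat}.
Implicit Types (e : R) (F : P2 R d -> R) (mu nu : P2 R d) (g : 'rV[R]_d -> R).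

Definition is_mixture (h : R) mu nu (rho : P2 R d) : Prop :=
  forall A, measurable A -> rho A = ((1 - h)%:E * mu A + h%:E * nu A)%E.

Definition is_flat_derivative F mu g : Prop :=
  [/\ measurable_fun setT g,
      exists C, forall x, `|g x| <= C * (1 + enorm x ^+ 2),
      forall nu e, 0 < e -> exists2 del : R, 0 < del &
        forall (h : R) rho, 0 < h -> h <= 1 -> h < del -> is_mixture h mu nu rho ->
        `|(F rho - F mu) / h - (\int[nu]_x g x - \int[mu]_x g x)| < e
    & \int[mu]_x g x = 0].

Definition flat_differentiable F mu : Prop := exists g, is_flat_derivative F mu g.

(* There is at most one flat derivative: evaluate its defining limit at Dirac
   masses and use the normalization. *)
Definition flat_derivative F mu : 'rV[R]_d -> R := get (is_flat_derivative F mu).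

Definition dmu F mu : 'rV[R]_d -> 'rV[R]_d := grad (flat_derivative F mu).

Definition fully_C1 F : Prop :=
  [/\ forall mu, flat_differentiable F mu,
      W2_continuous (fun x mu => flat_derivative F mu x : R^o),
      exists C, forall mu x,
        `|flat_derivative F mu x| <= C * (1 + enorm x ^+ 2)
    & [/\ forall mu x, differentiable (flat_derivative F mu) x,
          W2_continuous (fun x mu => dmu F mu x)
        & exists C, forall mu x, enorm (dmu F mu x) <= C * (1 + enorm x)]].

Definition partially_C2 F : Prop :=
  [/\ fully_C1 F,
      forall mu x, differentiable (dmu F mu) x,
      W2_continuous (fun x mu => hessian (flat_derivative F mu) x)
    & exists C, forall mu x, `|hessian (flat_derivative F mu) x| <= C].

End flat_derivative.

Section plans.
Context {R : realType} {d : nat}.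
Local Notation Rd := 'rV[R]_d.
Implicit Types (t s r e : R) (mu nu : P2 R d) (gamma xi : probability (Rd * Rd)%type R)
  (theta : probability (Rd * Rd * Rd)%type R).

(* gamma belongs to P_{2,mu}(R^{2d}). *)
Definition plan_at mu gamma : Prop :=
  (\int[gamma]_z (enorm z.1 ^+ 2 + enorm z.2 ^+ 2)%:E < +oo)%E /\
  is_image fst gamma mu.

Definition is_exp gamma nu : Prop := is_image (fun z : Rd * Rd => z.1 + z.2) gamma nu.

Definition plan_norm gamma : R := Num.sqrt (\int[gamma]_z (enorm z.2 ^+ 2)).

Definition gluing gamma xi theta : Prop :=
  is_image (fun w : Rd * Rd * Rd => w.1) theta gamma /\
  is_image (fun w : Rd * Rd * Rd => (w.1.1, w.2)) theta xi.

Definition pairing theta : R := \int[theta]_w dot w.1.2 w.2.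

Definition Wmu gamma xi : R :=
  Num.sqrt (fine (ereal_inf
    [set (\int[theta]_w (enorm (w.1.2 - w.2) ^+ 2)%:E)%E
    | theta in [set theta | gluing gamma xi theta]])).

Definition optimal_velocity gamma : Prop :=
  exists2 eta : R, 0 < eta & exists2 pi : probability (Rd * Rd)%type R,
    is_image (fun z : Rd * Rd => (z.1, z.1 + eta *: z.2)) gamma pi & optimal_plan pi.

Definition TanK mu gamma : Prop :=
  plan_at mu gamma /\
  forall e, 0 < e -> exists gamma',
    [/\ plan_at mu gamma', optimal_velocity gamma' & Wmu gamma gamma' < e].

(* The differentials are taken for functions with values in \bar R, so as to
   apply to V - delta E and V + delta E, at points where they are finite. *)
Definition subdiff (T : R) (phi : R -> P2 R d -> \bar R) (t : R) mu (r : R)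
    gamma : Prop :=
  [/\ phi t mu \is a fin_num, TanK mu gamma &
   forall e, 0 < e -> exists2 del : R, 0 < del &
   forall s xi theta nu, 0 <= s <= T -> plan_at mu xi -> gluing gamma xi theta ->
   is_exp xi nu -> `|s - t| + plan_norm xi < del ->
   (phi s nu - phi t mu >=
    (r * (s - t) + pairing theta - e * (`|s - t| + plan_norm xi))%:E)%E].

Definition superdiff (T : R) (phi : R -> P2 R d -> \bar R) (t : R) mu (r : R)
    gamma : Prop :=
  [/\ phi t mu \is a fin_num, TanK mu gamma &
   forall e, 0 < e -> exists2 del : R, 0 < del &
   forall s xi theta nu, 0 <= s <= T -> plan_at mu xi -> gluing gamma xi theta ->
   is_exp xi nu -> `|s - t| + plan_norm xi < del ->
   (phi s nu - phi t mu <=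
    (r * (s - t) + pairing theta + e * (`|s - t| + plan_norm xi))%:E)%E].

End plans.

Section entropy.
Context {R : realType} {d : nat}.
Local Notation Rd := 'rV[R]_d.
Local Notation leb := (lebesgue_rV R d).
Implicit Types (mu : P2 R d) (rho : Rd -> R) (g s : Rd -> Rd).

Definition is_density mu rho : Prop :=
  [/\ measurable_fun setT rho, forall x, 0 <= rho x &
   forall A, measurable A -> mu A = (\int[leb]_(x in A) (rho x)%:E)%E].

Definition density mu : Rd -> R := get (is_density mu).

Definition entropy mu : \bar R :=
  if `[< mu `<< leb >] then (\int[mu]_x (ln (density mu x))%:E)%E else +oo%E.

Definition weak_gradient rho g : Prop :=
  [/\ measurable_fun setT g,
      forall M : R, (\int[leb]_(x in [set x | (enorm x <= M)%R])
                        (enorm (g x))%:E < +oo)%E &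
      forall phi i, test_function phi ->
        \int[leb]_x (rho x * partial i phi x) =
        - \int[leb]_x (g x 0 i * phi x)].

(* s is a version of grad (log mu) := (grad mu) / mu, which is defined
   mu-almost everywhere. *)
Definition is_grad_log mu s : Prop :=
  exists rho g, [/\ is_density mu rho, weak_gradient rho g &
                 s = (fun x => (rho x)^-1 *: g x)].

Definition grad_log mu : Rd -> Rd := get (is_grad_log mu).

Definition fisher mu : \bar R :=
  if `[< exists s, is_grad_log mu s >]
  then (\int[mu]_x (enorm (grad_log mu x) ^+ 2)%:E)%E else +oo%E.

End entropy.

Section hamilton_jacobi.
Context {R : realType} {d : nat}.
Local Notation Rd := 'rV[R]_d.
Local Notation P2 := (P2 R d).
Variables (T eps : R) (H : Rd -> Rd -> P2 -> R) (G : P2 -> R).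
Implicit Types (t s r : R) (U V : R -> P2 -> R) (mu nu : P2)
  (x y : Rd) (p q : Rd -> Rd).

Definition data_assumptions : Prop :=
  [/\ W2_continuous (fun z : Rd * Rd => fun mu => H z.1 z.2 mu : R^o),
      exists2 C : R, 0 < C & forall (p q x y : Rd) mu nu,
        `|H x p mu - H y q nu| <=
        C * (1 + enorm p + enorm q)
          * (W2 mu nu + enorm (x - y) + enorm (p - q)),
      exists2 C : R, 0 < C & forall (x p : Rd) mu,
        `|H x p mu| <= C * (1 + enorm x ^+ 2 + enorm p ^+ 2 + M2 mu),
      exists M : R, forall mu, `|G mu| <= M
    & exists L, forall mu nu, `|G mu - G nu| <= L * W1 mu nu].

Definition bounded_on U : Prop :=
  exists M : R, forall t mu, 0 <= t <= T -> `|U t mu| <= M.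

Definition unif_lipschitz (W : P2 -> P2 -> R) U : Prop :=
  exists L, forall t mu nu, 0 <= t <= T ->
  `|U t mu - U t nu| <= L * W mu nu.

Definition weakly_continuous U : Prop :=
  forall (t_ : nat -> R) (mu_ : nat -> P2) t mu,
  (forall n, 0 <= t_ n <= T) -> 0 <= t <= T ->
  t_ n @[n --> \oo] --> t -> weak_cvg mu_ mu ->
  U (t_ n) (mu_ n) @[n --> \oo] --> U t mu.

(* gamma being a plan at mu, (pi_1)_# gamma = mu in the Hamiltonian term. *)
Definition HJ0_subsolution U : Prop :=
  forall t mu r gamma, 0 <= t < T ->
  superdiff T (fun s nu => (U s nu)%:E) t mu r gamma ->
  - r + \int[gamma]_z H z.1 z.2 mu <= 0.

Definition HJ0_supersolution U : Prop :=
  forall t mu r gamma, 0 <= t < T ->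
  subdiff T (fun s nu => (U s nu)%:E) t mu r gamma ->
  - r + \int[gamma]_z H z.1 z.2 mu >= 0.

Definition HJ0_solution U : Prop := HJ0_subsolution U /\ HJ0_supersolution U.

Definition HJeps_lhs (r : R) mu (p : Rd -> Rd) : R :=
  - r + eps * \int[mu]_x dot (grad_log mu x) (p x) + \int[mu]_x H x (p x) mu.

(* (Id x p)_# mu = gamma. *)
Definition is_graph mu (p : Rd -> Rd)
    (gamma : probability (Rd * Rd)%type R) : Prop :=
  measurable_fun setT p /\ is_image (fun x => (x, p x)) mu gamma.

Definition HJeps_subsolution V : Prop :=
  exists2 K : R, 0 < K & forall del : R, 0 < del ->
  forall t mu r p gamma, 0 <= t < T -> (fisher mu < +oo)%E ->
  is_graph mu p gamma ->
  superdiff T (fun s nu => ((V s nu)%:E - del%:E * entropy nu)%E) t mu r gamma ->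
  HJeps_lhs r mu p <= K * del.

Definition HJeps_supersolution V : Prop :=
  exists2 K : R, 0 < K & forall del : R, 0 < del ->
  forall t mu r p gamma, 0 <= t < T -> (fisher mu < +oo)%E ->
  is_graph mu p gamma ->
  subdiff T (fun s nu => ((V s nu)%:E + del%:E * entropy nu)%E) t mu r gamma ->
  HJeps_lhs r mu p >= - K * del.

Definition HJeps_solution V : Prop :=
  HJeps_subsolution V /\ HJeps_supersolution V.

(* Time derivative relative to [0, T], hence one-sided at t = 0 and t = T. *)
Definition time_quotient U mu (t s : R) : R := (U s mu - U t mu) / (s - t).

Definition time_derivable U t mu : Prop :=
  cvg (time_quotient U mu t s @[s --> within `[0, T] t^']).

Definition time_derivative U t mu : R :=
  lim (time_quotient U mu t s @[s --> within `[0, T] t^']).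

Definition HJeps_classical_subsolution U : Prop :=
  [/\ forall t, 0 <= t <= T -> partially_C2 (U t),
      forall t mu, 0 <= t <= T -> time_derivable U t mu
    & forall t mu, 0 <= t < T ->
      - time_derivative U t mu
      + \int[mu]_x H x (dmu (U t) mu x) mu
      - eps * \int[mu]_x (\tr ('J (dmu (U t) mu) x)) <= 0].

End hamilton_jacobi.

(* Main.v *)
(** Subtracting [(C eps + lam) (T - t)] turns [Ueps] into a strict classical subsolution [V]
    of the first-order equation, so it suffices to compare it with the viscosity supersolution
    [U]. As [V] is differentiable in [t] and in [mu] only separately, the time variable
    alone is doubled: one maximizes [V(t, mu) - U(s, mu) - del M2(mu) - kappa (t - s)^2].
    Bounded sets of second moments are weakly compact (the weak limit is built as the
    Caratheodory measure of an ultralimit) and a function that is [W1]-Lipschitz with a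
    flat derivative is weakly continuous, hence maximizers exist; for large [kappa] both
    times are before [T]. At a maximizer, [V(t0, mu) - del M2(mu) - kappa (t0 - s)^2] is
    a test function touching [U] from below: its gradient plan is tangent because [x + eta q(x)] is the
    gradient of a convex function for small [eta]. The penalty changes the Hamiltonian by
    [O(sqrt del)].

    For the second claim, the mixture of [mu] with a small atom [m] moving on a short
    segment is a geodesic when [mu] has no mass near the segment. Dividing the concavity
    inequality by [m] and letting [m] tend to [0] bounds second differences of the flat
    derivative by [Lam]; an arbitrary [mu] is the [W2]-limit of measures without mass
    near a given point. *)
From HB Require Import structures.
Require Import Defs.
From mathcomp Require Import all_boot all_order all_algebra.
From mathcomp Require Import all_classical all_reals all_analysis.
From mathcomp Require Import measurable_realfun ring lra.
Import Order.TTheory GRing.Theory Num.Theory.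
Import numFieldNormedType.Exports.
Local Open Scope classical_set_scope.
Local Open Scope ring_scope.
Set Implicit Arguments. Unset Strict Implicit. Unset Printing Implicit Defensive.

(** * Euclidean norm and measurability *)

(** The second-order term never reaches [U]: the Laplacian bound replaces it by the constant
    [C eps], which the shift in time absorbs. The [W1]-Lipschitz bound gives [|dmu| <= d L] for all
    measures. With [del = eta^2], boundedness of the values at the maximizer gives [del M2 <= B], so
    the extra velocity [2 del x] has [L^2] size at most [2 eta sqrt B], and the Hamiltonian changes
    by [eta E] with [E] independent of [eta] and [kappa]. Hence the order of choices: the margin
    [lam], then [eta], and [kappa] last and without a bound, since both time slopes contain the same
    number [2 kappa (t0 - s0)], which cancels.

    Flat derivatives see mixtures, whereas plans move mass. The bridge is a mean value formula:
    [F nu - F mu] is the integral against [nu - mu] of the flat derivative at some intermediate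
    mixture [rho]. It yields both the weak continuity and the expansion along plans. As [rho] is
    unknown, each use needs uniformity: over all [L]-Lipschitz integrands in the first case, through
    [L^2] continuity of the gradient in the second. *)

Section euclidean_norm.
Context {R : realType} {d : nat}.
Implicit Types (x y z : 'rV[R]_d) (a : R).

Lemma dotC x y : dot x y = dot y x.
Proof. by apply: eq_bigr => i _; rewrite mulrC. Qed.

Lemma dotDl x y z : dot (x + y) z = dot x z + dot y z.
Proof. by rewrite -big_split; apply: eq_bigr => i _; rewrite mxE mulrDl. Qed.

Lemma dotZl a x y : dot (a *: x) y = a * dot x y.
Proof. by rewrite mulr_sumr; apply: eq_bigr => i _; rewrite mxE mulrA. Qed.

Lemma dotNl x y : dot (- x) y = - dot x y.
Proof. by rewrite -scaleN1r dotZl mulN1r. Qed.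

Lemma dotBl x y z : dot (x - y) z = dot x z - dot y z.
Proof. by rewrite dotDl dotNl. Qed.

Lemma dotDr x y z : dot z (x + y) = dot z x + dot z y.
Proof. by rewrite !(dotC z) dotDl. Qed.

Lemma dotZr a x y : dot x (a *: y) = a * dot x y.
Proof. by rewrite !(dotC x) dotZl. Qed.

Lemma dotNr x y : dot x (- y) = - dot x y.
Proof. by rewrite !(dotC x) dotNl. Qed.

Lemma dotBr x y z : dot z (x - y) = dot z x - dot z y.
Proof. by rewrite dotDr dotNr. Qed.

Lemma dot0r x : dot x 0 = 0.
Proof. by rewrite -(scale0r x) dotZr mul0r. Qed.

Lemma dot_ge0 x : 0 <= dot x x.
Proof. by apply: sumr_ge0 => i _; rewrite -expr2 sqr_ge0. Qed.

Lemma enorm_ge0 x : 0 <= enorm x.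
Proof. exact: sqrtr_ge0. Qed.

Lemma enorm_sqr x : enorm x ^+ 2 = dot x x.
Proof. by rewrite sqr_sqrtr// dot_ge0. Qed.

Lemma enorm0 : enorm (0 : 'rV[R]_d) = 0.
Proof. by rewrite /enorm dot0r sqrtr0. Qed.

Lemma enormN x : enorm (- x) = enorm x.
Proof. by rewrite /enorm dotNl dotNr opprK. Qed.

Lemma enormB x y : enorm (x - y) = enorm (y - x).
Proof. by rewrite -enormN opprB. Qed.

Lemma enormZ a x : enorm (a *: x) = `|a| * enorm x.
Proof.
by rewrite /enorm dotZl dotZr mulrA -expr2 sqrtrM ?sqr_ge0// sqrtr_sqr.
Qed.

Lemma enorm_sqrD x y : enorm (x + y) ^+ 2 = enorm x ^+ 2 + 2 * dot x y + enorm y ^+ 2.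
Proof. by rewrite !enorm_sqr dotDl !dotDr (dotC y x); ring. Qed.

Lemma dot_le_sqr x y : 2 * `|dot x y| <= enorm x ^+ 2 + enorm y ^+ 2.
Proof.
have h1 := sqr_ge0 (enorm (x + y)); have h2 := sqr_ge0 (enorm (x - y)).
move: h1 h2; rewrite !enorm_sqrD dotNr enormN.
by case: (ger0P (dot x y)); lra.
Qed.


(** The quadratic [|x - t y|^2] is nonnegative, and its value at the minimizer [t = b / c] is
    [(a c - b^2) / c]. If [c = 0] and [b] were nonzero, [t = (a + 1) / (2 b)] would give the value
    [-1]. *)
Lemma dot_le_enorm x y : `|dot x y| <= enorm x * enorm y.
Proof.
suff : `|dot x y| ^+ 2 <= (enorm x * enorm y) ^+ 2.
  by rewrite ler_sqr// nnegrE ?mulr_ge0 ?enorm_ge0.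
rewrite exprMn real_normK ?num_real// !enorm_sqr.
set a := dot x x; set b := dot x y; set c := dot y y.
have hc : 0 <= c := dot_ge0 y.
have h t : 0 <= a - 2 * t * b + t ^+ 2 * c.
  have := dot_ge0 (x - t *: y).
  by rewrite dotBl !dotBr !dotZl !dotZr (dotC y x) -/a -/b -/c; lra.
have [c0|c0] := eqVneq c 0.
  have h1 := h (a / b); have h2 := h ((a + 1) / (2 * b)).
  have [->|b0] := eqVneq b 0; first by rewrite c0; nra.
  have := h ((a + 1) / (2 * b)); rewrite c0.
  have -> : a - 2 * ((a + 1) / (2 * b)) * b + ((a + 1) / (2 * b)) ^+ 2 * 0 = -1.
    by field.
  by rewrite ler0N1.
have := h (b / c).
have -> : a - 2 * (b / c) * b + (b / c) ^+ 2 * c = (a * c - b ^+ 2) / c by field.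
by rewrite pmulr_lge0 ?invr_gt0 ?lt_def ?c0// subr_ge0.
Qed.

Lemma ler_enormD x y : enorm (x + y) <= enorm x + enorm y.
Proof.
rewrite -ler_sqr ?nnegrE ?addr_ge0 ?enorm_ge0// enorm_sqrD.
have := dot_le_enorm x y; have := ler_norm (dot x y); lra.
Qed.

Lemma ler_enormB x y : enorm (x - y) <= enorm x + enorm y.
Proof. by rewrite -(enormN y) ler_enormD. Qed.

Lemma ler_enorm_dist x y : `|enorm x - enorm y| <= enorm (x - y).
Proof.
have h1 := ler_enormD (x - y) y; rewrite subrK in h1.
have h2 := ler_enormD (y - x) x; rewrite subrK enormB in h2.
by rewrite ler_norml; apply/andP; split; lra.
Qed.

Lemma enorm_sqrD_le x y : enorm (x + y) ^+ 2 <= 2 * (enorm x ^+ 2 + enorm y ^+ 2).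
Proof. by have := dot_le_sqr x y; have := ler_norm (dot x y); rewrite enorm_sqrD; lra. Qed.

Lemma enorm_sqrB_le x y : enorm (x - y) ^+ 2 <= 2 * (enorm x ^+ 2 + enorm y ^+ 2).
Proof. by have := enorm_sqrD_le x (- y); rewrite enormN. Qed.

Lemma coord_le_enorm x i : `|x 0 i| <= enorm x.
Proof.
rewrite -ler_sqr ?nnegrE ?enorm_ge0// enorm_sqr real_normK ?num_real// /dot.
rewrite (bigD1 i)//= -expr2 lerDl; apply: sumr_ge0 => j _.
by rewrite -expr2 sqr_ge0.
Qed.

Lemma enorm_le_coord x (M : R) : (forall i, `|x 0 i| <= M) -> enorm x <= d%:R * M.
Proof.
move=> h.
(* Nonnegativity of [M] is read off a coordinate, so dimension [0] is treated apart. *)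
have [/eqP d0|d0] := boolP (d == 0%N).
  have -> : x = 0 by apply/rowP => i; exfalso; move: (i); rewrite d0 => -[].
  by rewrite enorm0 d0 mul0r.
have M0 : 0 <= M.
  by rewrite -lt0n in d0; exact: le_trans (normr_ge0 _) (h (Ordinal d0)).
rewrite -ler_sqr ?nnegrE ?enorm_ge0 ?mulr_ge0// enorm_sqr /dot.
apply: (@le_trans _ _ (\sum_(i < d) M ^+ 2)).
  apply: ler_sum => i _; rewrite -expr2 -real_normK ?num_real//.
  by rewrite ler_sqr ?nnegrE.
rewrite sumr_const card_ord exprMn -[leLHS]mulr_natl ler_wpM2r ?sqr_ge0//.
by rewrite -natrX ler_nat -{1}(expn1 d) leq_pexp2l // lt0n.
Qed.

Lemma enorm_delta i : enorm (delta_mx 0 i : 'rV[R]_d) = 1.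
Proof.
rewrite /enorm /dot (bigD1 i)//= big1 => [|j ji].
  by rewrite addr0 !mxE !eqxx mulr1 sqrtr1.
by rewrite !mxE (negbTE ji) andbF mulr0.
Qed.

Lemma mx_entry_le_norm (A : 'M[R]_d) i j : `|A i j| <= `|A|.
Proof.
rewrite [leRHS]/Num.norm/= mx_normrE.
exact: (le_bigmax _ (fun k : 'I_d * 'I_d => `|A k.1 k.2|) (i, j)).
Qed.

Lemma norm_le_enorm x : `|x| <= enorm x.
Proof.
rewrite /Num.norm/= mx_normrE; apply: bigmax_le; first exact: enorm_ge0.
by move=> [i j] _; rewrite ord1 coord_le_enorm.
Qed.

Lemma coord_le_norm x i : `|x 0 i| <= `|x|.
Proof.
rewrite [leRHS]/Num.norm/= mx_normrE.
exact: (le_bigmax _ (fun k : 'I_1 * 'I_d => `|x k.1 k.2|) (0, i)).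
Qed.

Lemma enorm_le_norm x : enorm x <= d%:R * `|x|.
Proof. by apply: enorm_le_coord => i; exact: coord_le_norm. Qed.

Lemma enorm_eq0 x : (enorm x == 0) = (x == 0).
Proof.
apply/eqP/eqP => [x0|->]; last exact: enorm0.
by apply/eqP; rewrite -normr_le0 -x0 norm_le_enorm.
Qed.

Lemma continuous_lipschitz (f : 'rV[R]_d -> R) (L : R) :
  (forall x y, `|f x - f y| <= L * enorm (x - y)) -> continuous f.
Proof.
move=> h x A /nbhs_ballP[e /= e0 eA].
have L0 : 0 < `|L| * d%:R + 1 by rewrite ltr_wpDl// mulr_ge0.
apply/nbhs_ballP; exists ((`|L| * d%:R + 1)^-1 * e) => /=.
  by rewrite /= mulr_gt0 ?invr_gt0.
move=> y; rewrite -ball_normE /= ltr_pdivlMl// => xy.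
apply: eA; rewrite -ball_normE /=.
apply: le_lt_trans (h x y) _; apply: le_lt_trans xy.
apply: (@le_trans _ _ (`|L| * (d%:R * `|x - y|))).
  apply: (@le_trans _ _ (`|L| * enorm (x - y))).
    by rewrite ler_wpM2r ?enorm_ge0// ler_norm.
  by rewrite ler_wpM2l// enorm_le_norm.
by rewrite mulrA ler_wpM2r// lerDl.
Qed.

Lemma continuous_enorm : continuous (@enorm R d).
Proof.
by apply: (@continuous_lipschitz _ 1) => x y; rewrite mul1r ler_enorm_dist.
Qed.

End euclidean_norm.

Section measurability.
Context {R : realType}.

Lemma continuous_measurable_rV n (f : 'rV[R]_n -> R) :
  continuous f -> measurable_fun setT f.
Proof.
move=> cf; apply: (@measurability _ _ _ _ _ _ (@RGenOInfty.G R)).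
  exact: RGenOInfty.measurableE.
move=> _ [_ [a ->] <-]; rewrite setTI; apply: sub_sigma_algebra.
by apply: open_comp; [move=> v _; exact: cf|exact: interval_open].
Qed.

Lemma open_measurable_rV n (A : set 'rV[R]_n) : open A -> measurable A.
Proof. exact: sub_sigma_algebra. Qed.

Lemma closed_measurable_rV n (A : set 'rV[R]_n) : closed A -> measurable A.
Proof.
move=> cA; rewrite -(setCK A); apply: measurableC.
by apply: open_measurable_rV; exact: closed_openC.
Qed.

Context d (T : measurableType d).

Lemma measurable_rVP n (f : T -> 'rV[R]_n) :
  measurable_fun setT f <-> forall j, measurable_fun setT (fun x => f x 0 j).
Proof.
split; last exact: measurable_fun_rV.
by move=> mf j; apply: (measurableT_comp (measurable_coord j)).
Qed.

Lemma measurable_rVD n (f g : T -> 'rV[R]_n) :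
  measurable_fun setT f -> measurable_fun setT g ->
  measurable_fun setT (fun x => f x + g x).
Proof.
move=> /measurable_rVP mf /measurable_rVP mg; apply/measurable_rVP => j.
by under eq_fun do rewrite mxE; apply: measurable_funD.
Qed.

Lemma measurable_rVZ n (a : R) (f : T -> 'rV[R]_n) :
  measurable_fun setT f -> measurable_fun setT (fun x => a *: f x).
Proof.
move=> /measurable_rVP mf; apply/measurable_rVP => j.
by under eq_fun do rewrite mxE; apply: measurable_funM.
Qed.

Lemma measurable_rVB n (f g : T -> 'rV[R]_n) :
  measurable_fun setT f -> measurable_fun setT g ->
  measurable_fun setT (fun x => f x - g x).
Proof.
move=> mf mg; under eq_fun do rewrite -scaleN1r.
exact: measurable_rVD mf (measurable_rVZ _ mg).
Qed.

Lemma measurable_dot n (f g : T -> 'rV[R]_n) :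
  measurable_fun setT f -> measurable_fun setT g ->
  measurable_fun setT (fun x => dot (f x) (g x)).
Proof.
move=> /measurable_rVP mf /measurable_rVP mg.
by apply: measurable_sum => i; apply: measurable_funM.
Qed.

Lemma measurable_enorm n (f : T -> 'rV[R]_n) :
  measurable_fun setT f -> measurable_fun setT (fun x => enorm (f x)).
Proof.
move=> mf; apply: (measurableT_comp _ mf).
by apply: continuous_measurable_rV; exact: continuous_enorm.
Qed.

Lemma measurable_enorm2 n (f : T -> 'rV[R]_n) :
  measurable_fun setT f -> measurable_fun setT (fun x => enorm (f x) ^+ 2).
Proof. by move=> mf; apply: measurable_funX; exact: measurable_enorm. Qed.

(** The product of two vector spaces carries the product sigma-algebra, not a Borel one by
    definition. Concatenation into a single row vector transports [F] to a space where continuity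
    gives measurability. *)
Lemma measurable_continuous2 n m (f : T -> 'rV[R]_n) (g : T -> 'rV[R]_m)
    (F : 'rV[R]_n * 'rV[R]_m -> R) :
  measurable_fun setT f -> measurable_fun setT g -> continuous F ->
  measurable_fun setT (fun x => F (f x, g x)).
Proof.
move=> /measurable_rVP mf /measurable_rVP mg cF.
pose F' (v : 'rV[R]_(n + m)) := F (lsubmx v, rsubmx v).
have -> : (fun x => F (f x, g x)) = F' \o (fun x => row_mx (f x) (g x)).
  by apply/funext => x; rewrite /F' /= row_mxKl row_mxKr.
apply: measurableT_comp.
  apply: continuous_measurable_rV => v.
  apply: (@continuous_comp _ _ _ (fun v : 'rV[R]_(n + m) => (lsubmx v, rsubmx v)) F);
    last exact: cF.
  move=> A /nbhs_ballP[e /= e0 eA]; apply/nbhs_ballP; exists e => // y.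
  move=> /(mx_ballP _ _ e0) h; apply: eA; split; apply/mx_ballP => // j;
  by rewrite !mxE.
apply/measurable_rVP => j; have [i|i] := split_ordP j => ->.
  by under eq_fun do rewrite row_mxEl; exact: mf.
by under eq_fun do rewrite row_mxEr; exact: mg.
Qed.

End measurability.

(** * Images and mixtures of measures *)

Section image_measure.
Context d1 d2 (T1 : measurableType d1) (T2 : measurableType d2) (R : realType).
Variables (f : T1 -> T2) (mf : measurable_fun setT f).

Lemma image_exists (P : probability T1 R) : exists Q : probability T2 R, is_image f P Q.
Proof.
pose X : {mfun T1 >-> T2} := HB.pack f (isMeasurableFun.Build _ _ _ _ f mf).
by exists (distribution P X).
Qed.

Variables (P : {measure set T1 -> \bar R}) (Q : {measure set T2 -> \bar R}).
Hypothesis fPQ : is_image f P Q.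

Lemma integral_image_ge0 (g : T2 -> \bar R) : measurable_fun setT g ->
  (forall x, 0 <= g x)%E -> (\int[Q]_x g x = \int[P]_x g (f x))%E.
Proof.
move=> mg g0; transitivity (\int[pushforward P f]_x g x)%E.
  by apply: eq_measure_integral => A mA _; exact: fPQ.
by rewrite ge0_integral_pushforward.
Qed.

Lemma integrable_image (g : T2 -> R) : measurable_fun setT g ->
  Q.-integrable setT (EFin \o g) <-> P.-integrable setT (EFin \o (g \o f)).
Proof.
move=> mg; have mgf : measurable_fun setT (g \o f) by exact: measurableT_comp.
have e : (\int[Q]_x `|(g x)%:E| = \int[P]_x `|(g (f x))%:E|)%E.
  by apply: (@integral_image_ge0 (fun x => `|(g x)%:E|%E)) => //; do 2 apply: measurableT_comp => //.
by split=> /integrableP[_ h]; apply/integrableP; split;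
  try exact/measurable_EFinP; move: h; rewrite /= e.
Qed.

Lemma Rintegral_image (g : T2 -> R) : measurable_fun setT g ->
  P.-integrable setT (EFin \o (g \o f)) -> \int[Q]_x g x = \int[P]_x g (f x).
Proof.
move=> mg ig; congr fine.
transitivity (\int[pushforward P f]_x (g x)%:E)%E.
  by apply: eq_measure_integral => A mA _; exact: fPQ.
by rewrite integral_pushforward//; apply/measurable_EFinP.
Qed.

End image_measure.

Section probability_of_measure.
Context d (T : measurableType d) (R : realType) (m : {measure set T -> \bar R}).
Hypothesis m1 : m setT = 1%E.

(** The proof that the mass is [1] is an argument, so that the probability structure can be attached
    to the term itself. *)
Definition probability_of_measure of m setT = 1%E : set T -> \bar R := m.

HB.instance Definition _ := isMeasure.Build _ _ _ (probability_of_measure m1)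
  (@measure0 _ _ _ m) (@measure_ge0 _ _ _ m) (@measure_semi_sigma_additive _ _ _ m).

HB.instance Definition _ :=
  Measure_isProbability.Build _ _ _ (probability_of_measure m1) m1.

End probability_of_measure.

Section mixture_measure.
Context d (T : measurableType d) (R : realType).

Lemma mixture_exists (P Q : probability T R) (h : R) : 0 <= h <= 1 ->
  exists S : probability T R,
    forall A, measurable A -> S A = ((1 - h)%:E * P A + h%:E * Q A)%E.
Proof.
move=> /andP[h0 h1]; have h1' : 0 <= 1 - h by rewrite subr_ge0.
pose m : {measure set T -> \bar R} := measure_add (mscale (NngNum h1') P) (mscale (NngNum h0) Q).
have m1 : m setT = 1%E.
  transitivity ((1 - h)%:E * P setT + h%:E * Q setT)%E.
    exact: measure_addE.
  by rewrite !probability_setT !mule1 -EFinD subrK.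
by exists (probability_of_measure m1) => A mA; exact: measure_addE.
Qed.

Variables (P Q S : {measure set T -> \bar R}) (h : R).
Hypothesis h01 : 0 <= h <= 1.
Hypothesis PQS : forall A, measurable A -> S A = ((1 - h)%:E * P A + h%:E * Q A)%E.

Lemma integral_mixture_ge0 (g : T -> \bar R) : measurable_fun setT g ->
  (forall x, 0 <= g x)%E ->
  (\int[S]_x g x = (1 - h)%:E * \int[P]_x g x + h%:E * \int[Q]_x g x)%E.
Proof.
move=> mg g0; have /andP[h0 h1] := h01.
have h1' : 0 <= 1 - h by rewrite subr_ge0.
transitivity (\int[measure_add (mscale (NngNum h1') P) (mscale (NngNum h0) Q)]_x g x)%E.
  by apply: eq_measure_integral => A mA _; rewrite PQS//; apply/esym; exact: measure_addE.
by rewrite ge0_integral_measure_add// !ge0_integral_mscale.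
Qed.

Lemma integrable_mixture (g : T -> R) : P.-integrable setT (EFin \o g) ->
  Q.-integrable setT (EFin \o g) -> S.-integrable setT (EFin \o g).
Proof.
move=> /integrableP[mg iP] /integrableP[_ iQ]; apply/integrableP; split => //.
rewrite (integral_mixture_ge0 (g := fun x => `|(EFin \o g) x|%E))//; last exact: measurableT_comp.
apply: lte_add_pinfty; apply: lte_mul_pinfty => //.
  by rewrite lee_fin subr_ge0; case/andP: h01.
by rewrite lee_fin; case/andP: h01.
Qed.

Lemma Rintegral_mixture (g : T -> R) : P.-integrable setT (EFin \o g) ->
  Q.-integrable setT (EFin \o g) ->
  \int[S]_x g x = (1 - h) * \int[P]_x g x + h * \int[Q]_x g x.
Proof.
have ge0 f : (forall x, 0 <= f x) -> P.-integrable setT (EFin \o f) ->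
    Q.-integrable setT (EFin \o f) ->
    \int[S]_x f x = (1 - h) * \int[P]_x f x + h * \int[Q]_x f x.
  move=> f0 fP fQ; rewrite /Rintegral integral_mixture_ge0//.
    rewrite fineD ?fineM//; try exact: integrable_fin_num.
    - by rewrite fin_numM//; exact: integrable_fin_num.
    - by rewrite fin_numM//; exact: integrable_fin_num.
  exact: measurable_int fP.
have in_norm (m : {measure set T -> \bar R}) : m.-integrable setT (EFin \o g) ->
    m.-integrable setT (EFin \o (fun x => `|g x|)).
  by move=> /integrable_abse; apply: eq_integrable.
have in_normD (m : {measure set T -> \bar R}) : m.-integrable setT (EFin \o g) ->
    m.-integrable setT (EFin \o (fun x => `|g x| + g x)).
  move=> i; have := integrableD measurableT (in_norm _ i) i.
  exact: eq_integrable.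
(* Writing [g = (|g| + g) - |g|] reduces the claim to nonnegative integrands. *)
have split_int (m : {measure set T -> \bar R}) : m.-integrable setT (EFin \o g) ->
    \int[m]_x g x = \int[m]_x (`|g x| + g x) - \int[m]_x `|g x|.
  by move=> i; rewrite RintegralD ?in_norm// addrAC subrr add0r.
move=> iP iQ; have iS := integrable_mixture iP iQ.
rewrite !split_int// !ge0 ?in_norm ?in_normD//; first by ring.
by move=> x; have := ler_norm (- g x); rewrite normrN; lra.
Qed.

End mixture_measure.

(** * Weak compactness of bounded sets of second moments *)

(** A content on compact sets in the classical sense, bounded by [1]. It is the input of the
    construction of a Radon measure: inner regularization on open sets, then outer regularization on
    all sets. *)
Record compact_content (R : realType) n := CompactContent {
  cc_val :> set 'rV[R]_n -> R;
  cc_le1 : forall A, compact A -> cc_val A <= 1;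
  cc_mono : forall A B, compact A -> compact B -> A `<=` B -> cc_val A <= cc_val B;
  cc_disj : forall A B, compact A -> compact B -> A `&` B = set0 ->
    cc_val (A `|` B) = cc_val A + cc_val B;
  cc_sub : forall A B, compact A -> compact B ->
    cc_val (A `|` B) <= cc_val A + cc_val B }.

Section content_measure.
Context {R : realType} {n : nat} (c : compact_content R n).
Local Notation T := 'rV[R]_n.
Implicit Types (A B K O : set T).

Lemma rV_compact_closed K : compact K -> closed K.
Proof. by apply: compact_closed; exact: norm_hausdorff. Qed.

Lemma compactD K O : compact K -> open O -> compact (K `&` ~` O).
Proof.
by move=> cK oO; apply: compact_closedI => //; exact: open_closedC.
Qed.

Definition inner_content O : R := sup [set c K | K in [set K | compact K /\ K `<=` O]].

Let has_sup_inner O : has_sup [set c K | K in [set K | compact K /\ K `<=` O]].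
Proof.
split; first by exists (c set0), set0 => //; split => //; exact: compact0.
by exists 1 => _ [K [cK _] <-]; exact: cc_le1.
Qed.

Lemma le_inner_content K O : compact K -> K `<=` O -> c K <= inner_content O.
Proof.
by move=> cK KO; apply: sup_upper_bound (has_sup_inner O) _ _; exists K.
Qed.

Lemma inner_content_approx O e : 0 < e ->
  exists K, [/\ compact K, K `<=` O & inner_content O - e < c K].
Proof.
move=> e0; have [_ [K [cK KO] <-] h] := sup_adherent e0 (has_sup_inner O).
by exists K.
Qed.

Lemma inner_content_le O r :
  (forall K, compact K -> K `<=` O -> c K <= r) -> inner_content O <= r.
Proof.
move=> h; apply: ge_sup; first by case: (has_sup_inner O).
by move=> _ [K [cK KO] <-]; exact: h.
Qed.

Lemma cc_set0 : c set0 = 0.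
Proof.
have := @cc_disj _ _ c set0 set0 (@compact0 _) (@compact0 _) (setI0 _).
by rewrite setU0; lra.
Qed.

Lemma inner_content_ge0 O : 0 <= inner_content O.
Proof. by rewrite -cc_set0; apply: le_inner_content => //; exact: compact0. Qed.

Lemma inner_content_mono A B : A `<=` B -> inner_content A <= inner_content B.
Proof.
move=> AB; apply: inner_content_le => K cK KA.
by apply: le_inner_content => //; exact: subset_trans AB.
Qed.

Lemma inner_content0 : inner_content set0 = 0.
Proof.
apply/eqP; rewrite eq_le inner_content_ge0 andbT.
by apply: inner_content_le => K _; rewrite subset0 => ->; rewrite cc_set0.
Qed.

(** The closed sets [K \ O2] and [K \ O1] are disjoint; normality separates them by disjoint open
    sets [U] and [V]. Then [K] is the union of the compact sets [K \ V], contained in [O1], and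
    [K \ U], contained in [O2]. *)
Lemma cc_le_innerU K O1 O2 : compact K -> open O1 -> open O2 ->
  K `<=` O1 `|` O2 -> c K <= inner_content O1 + inner_content O2.
Proof.
move=> cK oO1 oO2 KO.
have c1 := compactD cK oO1; have c2 := compactD cK oO2.
have K12 : (K `&` ~` O2) `&` (K `&` ~` O1) = set0.
  rewrite -subset0 => x [[Kx nO2x] [_ nO1x]].
  by case: (KO _ Kx).
have [U [V [oU oV KU KV UV]]] := (proj1 (@normal_openP R _) (@pseudometric_normal R _))
  _ _ (rV_compact_closed c2) (rV_compact_closed c1) K12.
have cV := compactD cK oV; have cU := compactD cK oU.
have -> : K = (K `&` ~` V) `|` (K `&` ~` U).
  apply/seteqP; split => x; last by case=> -[].
  move=> Kx; have [Vx|nVx] := pselect (V x); last by left.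
  by right; split => // Ux; have : set0 x by rewrite -UV.
apply: le_trans (cc_sub c cV cU) _; apply: lerD; apply: le_inner_content => //.
  by move=> x [Kx nVx]; apply: contrapT => nO1x; apply: nVx; apply: KV.
by move=> x [Kx nUx]; apply: contrapT => nO2x; apply: nUx; apply: KU.
Qed.

Lemma inner_contentU O1 O2 : open O1 -> open O2 ->
  inner_content (O1 `|` O2) <= inner_content O1 + inner_content O2.
Proof. by move=> o1 o2; apply: inner_content_le => K cK; exact: cc_le_innerU. Qed.

Lemma inner_content_bigsetU (F : nat -> set T) k : (forall i, open (F i)) ->
  inner_content (\bigcup_(i < k) F i) <= \sum_(i < k) inner_content (F i).
Proof.
move=> oF; elim: k => [|k IH].
  by rewrite big_ord0 II0 bigcup_set0 inner_content0.
rewrite big_ord_recr /= IIS bigcup_setU bigcup_set1.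
apply: le_trans (inner_contentU _ (oF k)) _; first exact: bigcup_open.
by rewrite lerD2r.
Qed.

(** A compact subset of the union is covered by finitely many of the open sets, which reduces
    countable to finite subadditivity. *)
Lemma inner_content_bigcup (F : nat -> set T) : (forall i, open (F i)) ->
  ((inner_content (\bigcup_i F i))%:E <= \sum_(i <oo) (inner_content (F i))%:E)%E.
Proof.
move=> oF; have s0 i : (0 <= (inner_content (F i))%:E)%E.
  by rewrite lee_fin inner_content_ge0.
have hK K : compact K -> K `<=` \bigcup_i F i ->
    ((c K)%:E <= \sum_(i <oo) (inner_content (F i))%:E)%E.
  move=> cK KF; move: (cK); rewrite compact_cover => /(_ nat setT F).
  case=> // D _ KD.
  pose k := (\max_(i <- finmap.enum_fset D) i).+1.
  have KFk : K `<=` \bigcup_(i < k) F i.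
    move=> x /KD [i /= iD Fix]; exists i => //=.
    by rewrite /k ltnS; apply: leq_bigmax_seq.
  apply: (@le_trans _ _ (\sum_(0 <= i < k) (inner_content (F i))%:E)%E).
    rewrite big_mkord sumEFin lee_fin.
    exact: le_trans (le_inner_content cK KFk) (inner_content_bigsetU _ oF).
  exact: nneseries_lim_ge.
have : (0 <= \sum_(i <oo) (inner_content (F i))%:E)%E by exact: nneseries_ge0.
move: hK; case: (\sum_(i <oo) _)%E => [r|_ _|_].
- move=> hK _; rewrite lee_fin; apply: inner_content_le => K cK KF.
  by have := hK _ cK KF; rewrite lee_fin.
- by rewrite leey.
- by rewrite leNgt ltNy0.
Qed.

Definition outer_content A : \bar R :=
  ereal_inf [set (inner_content O)%:E | O in [set O | open O /\ A `<=` O]].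

Lemma outer_content_open O : open O -> outer_content O = (inner_content O)%:E.
Proof.
move=> oO; apply/eqP; rewrite eq_le; apply/andP; split.
  by apply: ereal_inf_lbound; exists O => //; split.
by apply: le_ereal_inf_tmp => _ [W [_ OW] <-]; rewrite lee_fin inner_content_mono.
Qed.

Lemma outer_content_ge0 A : (0 <= outer_content A)%E.
Proof. by apply: le_ereal_inf_tmp => _ [W _ <-]; rewrite lee_fin inner_content_ge0. Qed.

Lemma outer_content0 : outer_content set0 = 0%E.
Proof. by rewrite outer_content_open ?inner_content0//; exact: open0. Qed.

Lemma outer_content_mono : {homo outer_content : A B / A `<=` B >-> (A <= B)%E}.
Proof.
move=> A B AB; apply: le_ereal_inf_tmp => _ [W [oW BW] <-].
by apply: ereal_inf_lbound; exists W => //; split => //; exact: subset_trans BW.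
Qed.

Lemma outer_content_fin A : outer_content A \is a fin_num.
Proof.
rewrite ge0_fin_numE ?outer_content_ge0//.
apply: (@le_lt_trans _ _ (inner_content setT)%:E); last exact: ltry.
by apply: ereal_inf_lbound; exists setT => //; split => //; exact: openT.
Qed.

Lemma outer_content_approx A e : 0 < e -> exists O,
  [/\ open O, A `<=` O & ((inner_content O)%:E <= outer_content A + e%:E)%E].
Proof.
move=> e0; have [_ [W [oW AW] <-] h] := lb_ereal_inf_adherent e0 (outer_content_fin A).
by exists W; split => //; exact: ltW.
Qed.

Lemma outer_content_sigma_subadditive : sigma_subadditive outer_content.
Proof.
move=> A; apply/lee_addgt0Pr => e e0.
rewrite (le_trans _ (epsilon_trick _ _ _))//; last 2 first.
  by move=> i; exact: outer_content_ge0.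
  exact: ltW.
have /choice[W PW] : forall i, exists O, [/\ open O, A i `<=` O &
    ((inner_content O)%:E <= outer_content (A i) + (e / (2 ^ i.+1)%:R)%:E)%E].
  by move=> i; apply: outer_content_approx; rewrite divr_gt0// ltr0n expn_gt0.
apply: (@le_trans _ _ (outer_content (\bigcup_i W i))).
  by apply: outer_content_mono; apply: subset_bigcup => i _; case: (PW i).
rewrite outer_content_open; last by apply: bigcup_open => i _; case: (PW i).
apply: le_trans (inner_content_bigcup _) _; first by move=> i; case: (PW i).
apply: lee_nneseries => [i _ _|i _]; first by rewrite lee_fin inner_content_ge0.
by case: (PW i).
Qed.

HB.instance Definition _ := isOuterMeasure.Build R T outer_content
  outer_content0 outer_content_ge0 outer_content_mono outer_content_sigma_subadditive.

(** Three approximations, each within [e / 3]: an open [W] around [X], a compact [K] inside [W] and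
    [O], and a compact [L] inside [W \ K]. As [K] and [L] are disjoint, additivity bounds
    [c K + c L] by the inner content of [W], while [X \ O] lies in [W \ K]. *)
Lemma open_caratheodory O : open O -> caratheodory_measurable outer_content O.
Proof.
move=> oO; apply: le_caratheodory_measurable => X; apply/lee_addgt0Pr => e e0.
have e3 : 0 < e / 3 by rewrite divr_gt0.
have [W [oW XW Wle]] := outer_content_approx X e3.
have [K [cK KW hK]] := inner_content_approx (W `&` O) e3.
have [L [cL LW hL]] := inner_content_approx (W `&` ~` K) e3.
have cKL : c K + c L <= inner_content W.
  rewrite -cc_disj//; first apply: le_inner_content; first exact: compactU.
    by move=> x [/KW[]//|/LW[]].
  by rewrite -subset0 => x [Kx /LW[_]]; apply.
have oWO : open (W `&` O) by exact: openI.
have oWK : open (W `&` ~` K).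
  by apply: openI => //; apply: closed_openC; exact: rV_compact_closed.
have h1 : (outer_content (X `&` O) <= (inner_content (W `&` O))%:E)%E.
  by rewrite -outer_content_open//; apply: outer_content_mono; exact: setSI.
have h2 : (outer_content (X `&` ~` O) <= (inner_content (W `&` ~` K))%:E)%E.
  rewrite -outer_content_open//; apply: outer_content_mono.
  by move=> x [/XW Wx nOx]; split => // /KW[].
apply: (le_trans (leeD h1 h2)).
rewrite -EFinD; apply: (@le_trans _ _ ((inner_content W)%:E + (2 * (e / 3))%:E)%E).
  by rewrite -EFinD lee_fin; lra.
apply: (le_trans (leeD2r _ Wle)); rewrite -addeA -EFinD.
by rewrite leeD2l// lee_fin; lra.
Qed.

Lemma borel_caratheodory A : measurable A -> caratheodory_measurable outer_content A.
Proof.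
move=> mA; apply: (mA (caratheodory_measurable outer_content)); split.
  split; first exact: caratheodory_measurable_set0.
    by move=> B mB; rewrite setTD; exact: caratheodory_measurable_setC.
  by move=> F mF; exact: caratheodory_measurable_bigcup.
exact: open_caratheodory.
Qed.

(** A second name for [outer_content], which already carries the outer measure structure, to hold
    the measure structure on Borel sets. *)
Definition content_measure : set T -> \bar R := outer_content.

Let content_measure_sigma_additive : semi_sigma_additive content_measure.
Proof.
move=> F mF tF mUF; apply: caratheodory_measure_sigma_additive => //.
  by move=> i; exact: borel_caratheodory.
exact: borel_caratheodory.
Qed.

HB.instance Definition _ := isMeasure.Build _ T R content_measure
  outer_content0 outer_content_ge0 content_measure_sigma_additive.

End content_measure.

(** The hypothesis expresses tightness: compact sets exhaust the mass, none of which escapes to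
    infinity. *)
Lemma content_measure_exists (R : realType) n (c : compact_content R n) :
  inner_content c setT = 1 ->
  exists P : probability 'rV[R]_n R, forall O, open O -> P O = (inner_content c O)%:E.
Proof.
move=> c1; have m1 : content_measure c setT = 1%E.
  by rewrite /content_measure outer_content_open ?c1//; exact: openT.
by exists (probability_of_measure m1) => O oO; exact: outer_content_open.
Qed.

(** * Lower limits on open sets and weak convergence *)

Section liminf.
Context {R : realType}.
Implicit Types (u : nat -> \bar R) (a : \bar R).
Local Open Scope ereal_scope.

Lemma limn_einf_ge u a : (\forall k \near \oo, a <= u k) -> a <= limn_einf u.
Proof.
move=> [N _ h]; rewrite limn_einf_lim (cvg_lim _ (@cvg_einfs_sup _ u))//.
apply: (@le_trans _ _ (einfs u N)); last by apply: ereal_sup_ubound; exists N.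
by apply: le_ereal_inf_tmp => _ [k /= Nk <-]; exact: h.
Qed.

Lemma lt_limn_einf u a : a < limn_einf u -> \forall k \near \oo, a < u k.
Proof.
rewrite limn_einf_lim (cvg_lim _ (@cvg_einfs_sup _ u))//.
move=> /ereal_sup_gt[_ [N _ <-] aN]; exists N => // k /= Nk.
by apply: lt_le_trans aN _; apply: ereal_inf_lbound; exists k.
Qed.

End liminf.

Section portmanteau.
Context {R : realType} {n : nat}.
Variables (P_ : nat -> probability 'rV[R]_n R) (Q : probability 'rV[R]_n R).
Hypothesis open_liminf : forall O, open O -> (Q O <= limn_einf (fun k => P_ k O))%E.

(* Layer cake: the integral of [f >= 0] is the integral of the mass of [f > r],
   so Fatou's lemma transfers the lower semicontinuity from open sets. *)
Lemma lsc_integral (f : 'rV[R]_n -> R) : continuous f -> (forall x, 0 <= f x) ->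
  (\int[Q]_x (f x)%:E <= limn_einf (fun k => \int[P_ k]_x (f x)%:E))%E.
Proof.
move=> cf f0; have mf := continuous_measurable_rV cf.
pose X : {mfun 'rV[R]_n >-> R} := HB.pack f (isMeasurableFun.Build _ _ _ _ f mf).
have layer (P : probability 'rV[R]_n R) :
    (\int[P]_x (f x)%:E = \int[lebesgue_measure]_(r in `[0%R, +oo[) ccdf (X : {RV P >-> R}) r)%E.
  have := @ge0_expectation_ccdf _ _ _ P X f0.
  by rewrite unlock.
rewrite layer (_ : (fun k => _) = fun k =>
    (\int[lebesgue_measure]_(r in `[0%R, +oo[) ccdf (X : {RV (P_ k) >-> R}) r)%E); last first.
  by apply/funext => k; exact: layer.
apply: le_trans (fatou _ _ _ _) => //.
- apply: ge0_le_integral => //.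
  + by apply: measurable_funTS; exact: ccdf_measurable.
  + apply: measurableT_comp => //; apply: measurable_fun_limn_esup => k.
    apply: measurableT_comp => //.
    by apply: measurable_funTS; exact: ccdf_measurable.
  + move=> r _; apply: open_liminf.
    by apply: open_comp; [move=> x _; exact: cf|exact: interval_open].
- by move=> k; apply: measurable_funTS; exact: ccdf_measurable.
Qed.

Lemma bounded_integrable_prob d (T : measurableType d) (P : probability T R)
    (f : T -> R) (B : R) : measurable_fun setT f -> (forall x, `|f x| <= B) ->
  P.-integrable setT (EFin \o f).
Proof.
move=> mf fB; apply: (@le_integrable _ _ _ P _ measurableT _ (cst B%:E)).
- exact/measurable_EFinP.
- by move=> x _ /=; rewrite lee_fin (le_trans (fB x))// ler_norm.
- by apply/integrableP; split => //; rewrite integral_cst//= probability_setT mule1 ltry.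
Qed.

(** Lower semicontinuity applied to the nonnegative functions [f + B] and [- f + B] gives the two
    halves of the convergence. *)
Lemma cvg_integral_bounded (f : 'rV[R]_n -> R) : continuous f ->
  (exists M : R, forall x, `|f x| <= M) ->
  (\int[P_ k]_x f x) @[k --> \oo] --> \int[Q]_x f x.
Proof.
move=> cf [B fB]; have mf := continuous_measurable_rV cf.
have low g : continuous g -> (forall x, `|g x| <= B) -> forall e, 0 < e ->
    \forall k \near \oo, \int[Q]_x g x - e < \int[P_ k]_x g x.
  move=> cg gB e e0; have mg := continuous_measurable_rV cg.
  have gB0 x : 0 <= g x + B.
    by have := gB x; rewrite ler_norml => /andP[+ _]; lra.
  have ig (P : probability 'rV[R]_n R) : (\int[P]_x (g x + B)%:E = (\int[P]_x g x + B)%:E)%E.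
    have ig := bounded_integrable_prob P mg gB.
    have iB : P.-integrable setT (EFin \o (fun=> B)).
      by apply: (@bounded_integrable_prob _ _ P _ `|B|).
    rewrite -[B in RHS]mulr1 -[1 in RHS]/(fine 1%E) -(@probability_setT _ _ _ P).
    rewrite -Rintegral_cst// -RintegralD// /Rintegral fineK//.
    by apply: integrable_fin_num => //; exact: (integrableD measurableT ig iB).
  have cgB : continuous (fun x => g x + B) by move=> x; apply: (@continuousD _ _ _ g (cst B)); [exact: cg|exact: cst_continuous].
  have := lsc_integral cgB gB0; rewrite ig (_ : (fun k => _) = fun k => (\int[P_ k]_x g x + B)%:E); last first.
    by apply/funext => k; exact: ig.
  move=> h; have : ((\int[Q]_x g x + B - e)%:E < limn_einf (fun k => (\int[P_ k]_x g x + B)%:E))%E.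
    by apply: lt_le_trans h; rewrite lte_fin; lra.
  by move=> /lt_limn_einf; apply: filterS => k; rewrite lte_fin; lra.
apply/cvgrPdist_lt => e e0.
have h1 := low _ cf fB _ e0.
have h2 : \forall k \near \oo, \int[Q]_x (- f x) - e < \int[P_ k]_x (- f x).
  by apply: low => // x; [apply: continuousN; exact: cf|rewrite normrN].
have intN (P : probability 'rV[R]_n R) : \int[P]_x (- f x) = - \int[P]_x f x.
  under eq_Rintegral do rewrite -mulN1r.
  by rewrite RintegralZl ?mulN1r//; exact: bounded_integrable_prob fB.
near=> k; rewrite ltr_distl.
have : \int[Q]_x f x - e < \int[P_ k]_x f x by near: k.
have : \int[Q]_x (- f x) - e < \int[P_ k]_x (- f x) by near: k.
by rewrite !intN; lra.
Unshelve. all: by end_near. Qed.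

End portmanteau.

(** Compactness of the segment gives a cluster point, and an ultrafilter converges to each of its
    cluster points. *)
Lemma ultra_cvg_bounded (R : realType) (U : set_system nat) (UU : UltraFilter U)
    (u : nat -> R) (B : R) : (forall k, `|u k| <= B) -> exists l : R, u @ U --> l.
Proof.
move=> uB; have FU : ProperFilter U by exact: ultra_proper.
have UB : U (u @^-1` `[- B, B]%classic).
  by apply: filterE => k /=; rewrite in_itv /= -ler_norml; exact: uB.
have [l [_ cl]] : `[- B, B]%classic `&` cluster (u @ U) !=set0.
  by apply: segment_compact; exact: UB.
exists l => V lV.
have [//|nV] := in_ultra_setVsetC (u @^-1` V) UU.
by have [x [nVx Vx]] := cl (~` V) V nV lV.
Qed.

Section enorm_balls.
Context {R : realType} {n : nat}.

Lemma compact_measurable_rV (K : set 'rV[R]_n) : compact K -> measurable K.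
Proof. by move=> /rV_compact_closed; exact: closed_measurable_rV. Qed.

Lemma compact_enorm_ball (r : R) : compact [set x : 'rV[R]_n | enorm x <= r].
Proof.
apply: bounded_closed_compact.
  exists r; split; first exact: num_real.
  by move=> s rs x /= xr; rewrite (le_trans (norm_le_enorm x))// (le_trans xr)// ltW.
rewrite (_ : [set _ | _] = enorm @^-1` [set s | s <= r])//.
by apply: closed_comp => [x _|]; [exact: continuous_enorm|exact: closed_le].
Qed.

Lemma chebyshev_enorm (P : probability 'rV[R]_n R) (M r : R) : 0 < r ->
  (\int[P]_x (enorm x ^+ 2)%:E <= M%:E)%E ->
  1 - M / r ^+ 2 <= fine (P [set x | enorm x <= r]).
Proof.
move=> r0 PM; have mr := compact_measurable_rV (@compact_enorm_ball r).
have msq : measurable_fun setT (fun x : 'rV[R]_n => (enorm x ^+ 2)%:E).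
  by apply/measurable_EFinP; exact: measurable_enorm2.
have := @le_integral_abse _ _ _ P _ measurableT _ (r ^+ 2) msq (exprn_gt0 2 r0).
rewrite setTI => h.
set K := [set x : 'rV[R]_n | enorm x <= r] in mr *.
have : ((r ^+ 2)%:E * P (~` K) <= M%:E)%E.
  apply: le_trans PM; apply: le_trans (le_trans h _).
    rewrite lee_wpmul2l ?lee_fin ?sqr_ge0// le_measure ?inE//.
      exact: measurableC.
      by rewrite -[X in measurable X]setTI; apply: emeasurable_fun_c_infty => //; exact: measurableT_comp.
    move=> x /= /negP; rewrite -ltNge => rx; rewrite lee_fin ger0_norm ?sqr_ge0//.
    by rewrite ler_sqr ?nnegrE ?enorm_ge0 ?ltW.
  rewrite le_eqVlt; apply/orP; left; apply/eqP; apply: eq_integral => x _.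
  by rewrite gee0_abs// lee_fin sqr_ge0.
rewrite probability_setC// -[P K]fineK ?fin_num_measure//.
rewrite -EFinB -EFinM lee_fin => h2.
suff : 1 - fine (P K) <= M / r ^+ 2 by lra.
by rewrite ler_pdivlMr ?exprn_gt0// mulrC.
Qed.

End enorm_balls.

(** * Ultralimits of measures and extraction of subsequences *)

Section ultralimit.
Context {R : realType} {n : nat}.
Variables (U : set_system nat) (UU : UltraFilter U).
Variable P_ : nat -> probability 'rV[R]_n R.

Let FU : ProperFilter U.
Proof. exact: ultra_proper. Qed.

Let mass (A : set 'rV[R]_n) k : R := fine (P_ k A).

Let massK A k : measurable A -> P_ k A = (mass A k)%:E.
Proof. by move=> mA; rewrite fineK// fin_num_measure. Qed.

Let mass_ge0 A k : 0 <= mass A k.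
Proof. exact/fine_ge0/measure_ge0. Qed.

Let mass_le1 A k : measurable A -> mass A k <= 1.
Proof. by move=> mA; rewrite -lee_fin -massK// probability_le1. Qed.

Let mass_mono A B k : measurable A -> measurable B -> A `<=` B -> mass A k <= mass B k.
Proof. by move=> mA mB AB; rewrite -lee_fin -!massK// le_measure// inE. Qed.

Let mK := @compact_measurable_rV R n.

Let ulim A : R := lim (mass A @ U).

Let ulim_cvg A : measurable A -> mass A @ U --> ulim A.
Proof.
move=> mA; have [l hl] : exists l : R, mass A @ U --> l.
  apply: (@ultra_cvg_bounded _ _ _ _ 1) => k.
  by rewrite ger0_norm ?mass_ge0// mass_le1.
by rewrite /ulim (cvg_lim _ hl).
Qed.

Let ulim_le1 A : compact A -> ulim A <= 1.
Proof.
move=> /mK mA; apply: cvgr_to_le (ulim_cvg mA) _.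
by apply: filterE => k; exact: mass_le1.
Qed.

Let ulim_mono A B : compact A -> compact B -> A `<=` B -> ulim A <= ulim B.
Proof.
move=> /mK mA /mK mB AB; apply: ler_cvg_to (ulim_cvg mA) (ulim_cvg mB) _.
by apply: filterE => k; exact: mass_mono.
Qed.

Let ulim_disj A B : compact A -> compact B -> A `&` B = set0 ->
  ulim (A `|` B) = ulim A + ulim B.
Proof.
move=> /mK mA /mK mB AB; apply: (@cvg_lim _ (@Rhausdorff R)).
rewrite (_ : mass (A `|` B) = fun k => mass A k + mass B k).
  by apply: cvgD; exact: ulim_cvg.
by apply/funext => k; rewrite /mass measureU// fineD// fin_num_measure.
Qed.

Let ulim_sub A B : compact A -> compact B -> ulim (A `|` B) <= ulim A + ulim B.
Proof.
move=> /mK mA /mK mB; have mAB := measurableU _ _ mA mB.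
apply: ler_cvg_to (ulim_cvg mAB) (cvgD (ulim_cvg mA) (ulim_cvg mB)) _.
apply: filterE => k.
by rewrite -lee_fin EFinD -!massK//; exact: measureU2.
Qed.

Let content := CompactContent ulim_le1 ulim_mono ulim_disj ulim_sub.

(** An open set is approximated from inside by a compact one, whose mass converges along [U] to its
    content. Monotonicity then bounds the mass of the open set from below only; mass may still
    concentrate on its boundary. *)
Lemma ultralimit_exists (M : R) :
  (forall k, (\int[P_ k]_x (enorm x ^+ 2)%:E <= M%:E)%E) ->
  exists Q : probability 'rV[R]_n R, forall O e, open O -> 0 < e ->
    U [set k | fine (Q O) - e < fine (P_ k O)].
Proof.
move=> PM; have M0 : 0 <= M.
  by rewrite -lee_fin; apply: le_trans (PM 0%N); apply: integral_ge0 => x _; rewrite lee_fin sqr_ge0.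
have c1 : inner_content content setT = 1.
  apply/eqP; rewrite eq_le; apply/andP; split.
    by apply: inner_content_le => K cK _; exact: ulim_le1.
  apply/ler_addgt0Pr => e e0; rewrite -lerBlDr.
  (* With this radius the tail [M / r^2 = e M / (M + 1)] is at most [e]; the [+ 1] keeps [r]
     positive when [M = 0]. *)
  pose r := Num.sqrt ((M + 1) / e).
  have r0 : 0 < r by rewrite sqrtr_gt0 divr_gt0// ltr_wpDl.
  have r2 : r ^+ 2 = (M + 1) / e by rewrite sqr_sqrtr// divr_ge0 ?addr_ge0// ltW.
  apply: (@le_trans _ _ (ulim [set x | enorm x <= r])); last first.
    by apply: (@le_inner_content _ _ content) => //; exact: compact_enorm_ball.
  apply: cvgr_to_ge (ulim_cvg (mK (@compact_enorm_ball _ _ r))) _.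
  apply: filterE => k; apply: le_trans (chebyshev_enorm r0 (PM k)).
  rewrite lerD2l lerN2 r2 invf_div mulrA ler_pdivrMr ?ltr_wpDl//.
  by rewrite mulrDr mulrC lerDl mulr1 ltW.
have [Q QO] := content_measure_exists c1; exists Q => W e oW e0.
have e2 : 0 < e / 2 by rewrite divr_gt0.
have [K [cK KW hK]] := inner_content_approx content W e2.
have : U [set k | ulim K - e / 2 < mass K k].
  by apply: (cvgr_gt _ (ulim_cvg (mK cK))); lra.
apply: filterS => k /=; rewrite QO//= => h.
have := mass_mono k (mK cK) (open_measurable_rV oW) KW.
by move: hK h; rewrite /= /mass; lra.
Qed.

End ultralimit.

Section extraction.
Context {R : realType} {n : nat}.

(** Finite unions of rational balls. There are countably many, and every open set is an increasing
    union of such sets, so they suffice to test lower semicontinuity. *)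
Let W (s : seq ('rV[rat]_n * nat)) : set 'rV[R]_n :=
  \bigcup_(p in [set` s]) ball (map_mx ratr p.1 : 'rV[R]_n) p.2.+1%:R^-1.

Let openW s : open (W s).
Proof. by apply: bigcup_open => p _; exact: ball_open. Qed.

(** A diagonal choice: [f m] is an index beyond [m] that meets the first [m + 1] requirements at
    precision [1 / (m + 1)]. It exists because finitely many members of the ultrafilter have a
    common point. [f] need not be increasing; [k <= f k] is all that is used. *)
Lemma weak_compactness (P_ : nat -> probability 'rV[R]_n R) (M B : R)
    (t_ s_ : nat -> R) :
  (forall k, (\int[P_ k]_x (enorm x ^+ 2)%:E <= M%:E)%E) ->
  (forall k, `|t_ k| <= B) -> (forall k, `|s_ k| <= B) ->
  exists (Q : probability 'rV[R]_n R) (t s : R) (f : nat -> nat),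
  [/\ forall k, (k <= f k)%N, t_ (f k) @[k --> \oo] --> t,
      s_ (f k) @[k --> \oo] --> s &
      forall O, open O -> (Q O <= limn_einf (fun k => P_ (f k) O))%E].
Proof.
move=> PM tB sB.
have [U [UU ooU]] := ultraFilterLemma (@eventually_filter).
have FU : ProperFilter U by exact: ultra_proper.
have [t tl] := ultra_cvg_bounded UU tB.
have [s sl] := ultra_cvg_bounded UU sB.
have [Q QU] := ultralimit_exists UU PM.
pose V j := W (odflt [::] (unpickle j)).
have inv0 m : 0 < m.+1%:R^-1 :> R by rewrite invr_gt0.
have /choice[f fP] : forall m, exists k, [/\ (m <= k)%N, `|t - t_ k| < m.+1%:R^-1,
    `|s - s_ k| < m.+1%:R^-1 & forall j, (j <= m)%N ->
    fine (Q (V j)) - m.+1%:R^-1 < fine (P_ k (V j))].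
  move=> m.
  have h1 : U [set k | (m <= k)%N] by apply: ooU; exists m.
  have h2 : U [set k | `|t - t_ k| < m.+1%:R^-1] by move/cvgrPdist_lt : tl; apply.
  have h3 : U [set k | `|s - s_ k| < m.+1%:R^-1] by move/cvgrPdist_lt : sl; apply.
  have h4 : U [set k | forall j : 'I_m.+1,
      fine (Q (V j)) - m.+1%:R^-1 < fine (P_ k (V j))].
    apply: filter_forall => j; apply: QU => //; exact: openW.
  have [k [[[k1 k2] k3] k4]] := filter_ex (filterI (filterI (filterI h1 h2) h3) h4).
  by exists k; split => // j; rewrite -ltnS => jm; exact: (k4 (Ordinal jm)).
exists Q, t, s, f; split.
- by move=> k; case: (fP k).
- apply/cvgrPdist_lt => e e0; have [N _ hN] := near_infty_natSinv_lt (PosNum e0).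
  by exists N => // k /= Nk; case: (fP k) => _ + _ _ => /lt_trans; apply; exact: hN.
- apply/cvgrPdist_lt => e e0; have [N _ hN] := near_infty_natSinv_lt (PosNum e0).
  by exists N => // k /= Nk; case: (fP k) => _ _ + _ => /lt_trans; apply; exact: hN.
move=> A oA.
(* The balls inside [A] among the first [N] codes; their unions increase to [A]. *)
pose S N := [seq p <- pmap unpickle (iota 0 N) |
  `[< ball (map_mx ratr p.1 : 'rV[R]_n) p.2.+1%:R^-1 `<=` A >]].
have mW N : measurable (W (S N)) by apply: open_measurable_rV; exact: openW.
have WA N : W (S N) `<=` A.
  by move=> x [p /=]; rewrite mem_filter => /andP[/asboolP pA _]; exact: pA.
have WS : nondecreasing_seq (fun N => W (S N)).
  move=> i j ij; apply/subsetPset => x [p /= + px].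
  rewrite mem_filter => /andP[pA].
  rewrite mem_pmap => /mapP[k]; rewrite mem_iota add0n /= => ki kp.
  exists p => //=; rewrite mem_filter pA /= mem_pmap; apply/mapP; exists k => //.
  by rewrite mem_iota add0n /= (leq_trans ki).
have UW : \bigcup_N W (S N) = A.
  apply/seteqP; split => [x [N _]|x]; first exact: WA.
  rewrite {1}(open_rV_bigcup oA) => -[p /= pA px].
  exists (pickle p).+1 => //; exists p => //=; rewrite mem_filter; apply/andP; split.
    exact/asboolP.
  by rewrite mem_pmap; apply/mapP; exists (pickle p); rewrite ?pickleK // mem_iota add0n ltnS leqnn.
have := @nondecreasing_cvg_mu _ _ _ Q (fun N => W (S N)) mW.
rewrite UW => /(_ (open_measurable_rV oA) WS) QW.
suff approx (e : R) : 0 < e -> (Q A - e%:E <= limn_einf (fun k => P_ (f k) A))%E.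
  by apply/lee_addgt0Pr => e e0; rewrite -leeBlDr//; exact: approx.
move=> e0.
have e2 : 0 < e / 2 by rewrite divr_gt0.
have QfA : Q A \is a fin_num by rewrite fin_num_measure//; exact: open_measurable_rV.
have QfW N : Q (W (S N)) \is a fin_num by rewrite fin_num_measure.
have [N hN] : exists N, fine (Q A) - e / 2 < fine (Q (W (S N))).
  have : fine \o (Q \o (fun N => W (S N))) @ \oo --> fine (Q A).
    by apply: fine_cvg; rewrite fineK.
  move=> /cvgr_gt /(_ (fine (Q A) - e / 2)); rewrite ltrBlDr ltrDl => /(_ e2).
  by move=> [N _ h]; exists N; apply: h => /=.
apply: limn_einf_ge.
have [N2 _ hN2] := near_infty_natSinv_lt (PosNum e2).
(* Beyond the code of [S N], the requirement on the union [W (S N)] is among those met by [f k]. *)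
exists (maxn N2 (pickle (S N))) => // k /=; rewrite geq_max => /andP[N2k Nk].
have [_ _ _ /(_ _ Nk)] := fP k.
rewrite /V pickleK /= => hk.
have hWA : (P_ (f k) (W (S N)) <= P_ (f k) A)%E.
  by rewrite le_measure// inE//; exact: open_measurable_rV.
apply: le_trans hWA; rewrite -[Q A]fineK// -[P_ _ _]fineK ?fin_num_measure//.
rewrite -EFinB lee_fin; have := hN2 _ N2k; rewrite /= => hk2.
by move: hN hk hk2; move: (k.+1%:R^-1) => z; lra.
Qed.

End extraction.

Section second_moment.
Context {R : realType} {d : nat}.
Implicit Types (mu : P2 R d) (f g : 'rV[R]_d -> R).

Lemma P2_integrable_sqr mu : mu.-integrable setT (EFin \o (fun x => enorm x ^+ 2)).
Proof.
apply/integrableP; split; first by apply/measurable_EFinP; exact: measurable_enorm2.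
apply: le_lt_trans (P2moment mu); rewrite le_eqVlt; apply/orP; left; apply/eqP.
by apply: eq_integral => x _ /=; rewrite ger0_norm// sqr_ge0.
Qed.

Lemma M2E mu : (\int[mu]_x (enorm x ^+ 2)%:E = (M2 mu)%:E)%E.
Proof. by rewrite /M2 fineK//; exact: integrable_fin_num (P2_integrable_sqr mu). Qed.

Lemma M2_ge0 mu : 0 <= M2 mu.
Proof. by apply: Rintegral_ge0 => x _; exact: sqr_ge0. Qed.

Lemma integrable_prob_cst dT (T : measurableType dT) (P : probability T R) (a : R) :
  P.-integrable setT (EFin \o (fun=> a)).
Proof. exact: (@bounded_integrable_prob _ _ _ P _ `|a|). Qed.

Lemma Rintegral_prob_cst dT (T : measurableType dT) (P : probability T R) (a : R) :
  \int[P]_x a = a.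
Proof. by rewrite Rintegral_cst// (_ : fine (P setT) = 1) ?mulr1// (@probability_setT _ _ _ P). Qed.

Lemma P2_integrable_quad mu (a b : R) :
  mu.-integrable setT (EFin \o (fun x => a + b * enorm x ^+ 2)).
Proof.
have := integrableD measurableT (integrable_prob_cst mu a)
  (integrableZl measurableT b (P2_integrable_sqr mu)).
by apply: eq_integrable.
Qed.

Lemma Rintegral_quad mu (a b : R) :
  \int[mu]_x (a + b * enorm x ^+ 2) = a + b * M2 mu.
Proof.
rewrite RintegralD//; last 2 first.
- exact: integrable_prob_cst.
- by have := P2_integrable_quad mu 0 b; apply: eq_integrable => // x _ /=; rewrite add0r.
by rewrite Rintegral_prob_cst RintegralZl//; exact: P2_integrable_sqr.
Qed.

Lemma P2_integrable mu f (a b : R) : measurable_fun setT f ->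
  (forall x, `|f x| <= a + b * enorm x ^+ 2) -> mu.-integrable setT (EFin \o f).
Proof.
move=> mf fab; apply: le_integrable (P2_integrable_quad mu a b) => //.
  exact/measurable_EFinP.
by move=> x _ /=; rewrite lee_fin (le_trans (fab x))// ler_norm.
Qed.

Lemma le_Rintegral_quad mu f (a b : R) : measurable_fun setT f ->
  (forall x, `|f x| <= a + b * enorm x ^+ 2) -> `|\int[mu]_x f x| <= a + b * M2 mu.
Proof.
move=> mf fab; have intf := P2_integrable mu mf fab.
apply: le_trans (le_normr_Rintegral measurableT intf) _.
rewrite -Rintegral_quad; apply: le_Rintegral => //; last exact: P2_integrable_quad.
by have := integrable_abse intf; apply: eq_integrable.
Qed.

Lemma enorm_le_sqr (x : 'rV[R]_d) : enorm x <= 1 + enorm x ^+ 2.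
Proof. by have := sqr_ge0 (enorm x - 1 / 2); lra. Qed.

Lemma lipschitz_growth f (L : R) : (forall x y, `|f x - f y| <= L * enorm (x - y)) ->
  forall x, `|f x| <= (`|f 0| + `|L|) + `|L| * enorm x ^+ 2.
Proof.
move=> fL x; have := fL x 0; rewrite subr0 => h.
have := ler_normD (f x - f 0) (f 0); rewrite subrK => h2.
have h3 : L * enorm x <= `|L| * (1 + enorm x ^+ 2).
  apply: (@le_trans _ _ (`|L| * enorm x)).
    by rewrite ler_wpM2r ?enorm_ge0// ler_norm.
  by rewrite ler_wpM2l// enorm_le_sqr.
by lra.
Qed.

Lemma lipschitz_integrable mu f (L : R) :
  (forall x y, `|f x - f y| <= L * enorm (x - y)) -> mu.-integrable setT (EFin \o f).
Proof.
move=> fL; apply: P2_integrable (lipschitz_growth fL).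
by apply: continuous_measurable_rV; exact: continuous_lipschitz fL.
Qed.

End second_moment.

Section weak_compactness_P2.
Context {R : realType} {d : nat}.
Implicit Types (mu : P2 R d) (f g : 'rV[R]_d -> R).

(** Second moments are only lower semicontinuous under this convergence. The last clause records it,
    and it is the right direction for a penalty [- del * M2] in a maximization. Two time sequences
    are extracted along with the measures because time is doubled. *)
Lemma weak_compactness_P2 (mu_ : nat -> P2 R d) (M B : R) (t_ s_ : nat -> R) :
  (forall k, M2 (mu_ k) <= M) ->
  (forall k, `|t_ k| <= B) -> (forall k, `|s_ k| <= B) ->
  exists mu (t s : R) (f : nat -> nat),
  [/\ forall k, (k <= f k)%N, t_ (f k) @[k --> \oo] --> t,
      s_ (f k) @[k --> \oo] --> s, weak_cvg (fun k => mu_ (f k)) mu &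
      forall r, r < M2 mu -> \forall k \near \oo, r < M2 (mu_ (f k))].
Proof.
move=> muM tB sB.
have muM' k : (\int[mu_ k]_x (enorm x ^+ 2)%:E <= M%:E)%E by rewrite M2E lee_fin.
have [Q [t [s [f [fk ft fs fO]]]]] := weak_compactness muM' tB sB.
have csq : continuous (fun x : 'rV[R]_d => enorm x ^+ 2).
  move=> x; apply: (@continuous_comp _ _ _ (@enorm R d) (fun r => r ^+ 2)).
    exact: continuous_enorm.
  exact: exprn_continuous.
have lsc := lsc_integral fO csq (fun x => sqr_ge0 _).
have Qlt : (\int[Q]_x (enorm x ^+ 2)%:E < +oo)%E.
  rewrite ltNge leye_eq; apply/negP => /eqP Qoo.
  move: lsc; rewrite Qoo leye_eq => /eqP e.
  have : (M%:E < limn_einf (fun k => \int[mu_ (f k)]_x (enorm x ^+ 2)%:E))%E.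
    by rewrite e ltry.
  move=> /lt_limn_einf[N _ /(_ N (leqnn N))].
  by rewrite ltNge muM'.
exists (MkP2 Qlt), t, s, f; split => //.
  split; last by exists M.
  by move=> g cg gB; exact: (cvg_integral_bounded fO).
move=> r rM.
have : (r%:E < limn_einf (fun k => \int[mu_ (f k)]_x (enorm x ^+ 2)%:E))%E.
  apply: lt_le_trans lsc; have := M2E (MkP2 Qlt); rewrite /= => ->.
  by rewrite lte_fin.
by move=> /lt_limn_einf; apply: filterS => k; rewrite M2E lte_fin.
Qed.

Let clamp (K a : R) := Num.max (- K) (Num.min a K).

Let clamp_lip K a b : `|clamp K a - clamp K b| <= `|a - b|.
Proof.
rewrite /clamp /Num.max /Num.min.
case: (ltP a K) => aK; case: (ltP b K) => bK;
case: (ltP (- K) a) => h1; case: (ltP (- K) b) => h2; case: (ltP (- K) K) => h3;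
rewrite ler_norml; case: (ler0P (a - b)) => h; apply/andP; split; lra.
Qed.

Let clamp_bound K a : 0 <= K -> `|clamp K a| <= K.
Proof.
move=> K0; rewrite /clamp /Num.max /Num.min.
by case: (ltP a K) => aK; case: (ltP (- K) a) => h1; case: (ltP (- K) K) => h2;
  rewrite ler_norml; apply/andP; split; lra.
Qed.

(** Where truncation acts, [|a| > K], so the error is at most [|a| <= a^2 / K]: a quantity that
    second moments control. *)
Let clamp_err K a : 0 < K -> `|a - clamp K a| <= a ^+ 2 / K.
Proof.
move=> K0; rewrite ler_pdivlMr//.
have [aK|aK] := lerP `|a| K.
  suff -> : clamp K a = a by rewrite subrr normr0 mul0r sqr_ge0.
  move: aK; rewrite ler_norml => /andP[h1 h2]; rewrite /clamp.
  by rewrite (min_idPl h2) (max_idPr h1).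
have : `|a - clamp K a| <= `|a|.
  rewrite /clamp /Num.max /Num.min.
  case: (ger0P a) aK => a0 aK; case: (ltP a K) => h1;
    case: (ltP (- K) a) => h2; case: (ltP (- K) K) => h3;
    rewrite ler_norml; apply/andP; split; lra.
move=> h; apply: (@le_trans _ _ (`|a| * `|a|)); last by rewrite -expr2 real_normK ?num_real.
by apply: ler_pM => //; exact: ltW.
Qed.

Variables (mu_ : nat -> P2 R d) (mu : P2 R d).
Hypothesis mu_cvg : weak_cvg mu_ mu.

Lemma weak_cvg_M2_bound : exists2 M : R, 0 <= M & M2 mu <= M /\ forall k, M2 (mu_ k) <= M.
Proof.
case: mu_cvg => _ [M hM]; exists (Num.max (M2 mu) M).
  by rewrite le_max M2_ge0.
by split=> [|k]; rewrite le_max ?lexx// hM orbT.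
Qed.

(** Truncation at [K] makes the integrand bounded, and the error is at most [L^2 M / K] for all the
    measures at once. *)
Lemma weak_cvg_lipschitz1 f (L : R) : 0 <= L -> f 0 = 0 ->
  (forall x y, `|f x - f y| <= L * enorm (x - y)) ->
  (\int[mu_ k]_x f x) @[k --> \oo] --> \int[mu]_x f x.
Proof.
move=> L0 f0 fL; have [M M0 [muM mukM]] := weak_cvg_M2_bound.
have fx x : `|f x| <= L * enorm x by have := fL x 0; rewrite f0 !subr0.
have mf : measurable_fun setT f.
  by apply: continuous_measurable_rV; exact: continuous_lipschitz fL.
have cL K x y : `|clamp K (f x) - clamp K (f y)| <= L * enorm (x - y).
  exact: le_trans (clamp_lip _ _ _) (fL x y).
have mc K : measurable_fun setT (fun x => clamp K (f x)).
  apply: continuous_measurable_rV.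
  exact: (@continuous_lipschitz _ _ (fun x => clamp K (f x)) L (cL K)).
have tail (nu : P2 R d) K : 0 < K -> M2 nu <= M ->
    `|\int[nu]_x f x - \int[nu]_x clamp K (f x)| <= L ^+ 2 * M / K.
  move=> K0 nuM; rewrite -RintegralB//; last 2 first.
  - exact: lipschitz_integrable fL.
  - exact: (@lipschitz_integrable _ _ nu (fun x => clamp K (f x)) L (cL K)).
  apply: (@le_trans _ _ (0 + L ^+ 2 / K * M2 nu)).
    apply: (@le_Rintegral_quad _ _ nu (fun x => f x - clamp K (f x))).
      exact: measurable_funB.
    move=> x; apply: le_trans (clamp_err _ K0) _; rewrite add0r [leRHS]mulrAC.
    rewrite ler_wpM2r ?invr_ge0 ?(ltW K0)// -exprMn -[leLHS]real_normK ?num_real//.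
    by rewrite ler_sqr ?nnegrE ?mulr_ge0 ?enorm_ge0.
  by rewrite add0r mulrAC ler_wpM2r ?invr_ge0 ?(ltW K0)// ler_wpM2l ?sqr_ge0.
apply/cvgrPdist_lt => e e0.
(* Makes each of the two truncation errors smaller than [e / 3]. *)
pose K := 3 * (L ^+ 2 * M + 1) / e.
have LM0 : 0 <= L ^+ 2 * M by rewrite mulr_ge0// sqr_ge0.
have K0 : 0 < K by rewrite divr_gt0// mulr_gt0// ltr_wpDl.
have KE : L ^+ 2 * M / K < e / 3.
  rewrite ltr_pdivrMr// /K; have -> : e / 3 * (3 * (L ^+ 2 * M + 1) / e) = L ^+ 2 * M + 1.
    by field; rewrite gt_eqF.
  by lra.
have e3 : 0 < e / 3 by rewrite divr_gt0.
have /cvgrPdist_lt /(_ _ e3) : (\int[mu_ k]_x clamp K (f x)) @[k --> \oo] --> \int[mu]_x clamp K (f x).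
  case: mu_cvg => + _; apply.
    exact: (@continuous_lipschitz _ _ (fun x => clamp K (f x)) L (cL K)).
  by exists K => x; apply: clamp_bound; exact: ltW.
apply: filterS => k h.
have h1 := tail mu K K0 muM; have h2 := tail (mu_ k) K K0 (mukM k).
move: h h1 h2 KE; rewrite ltr_distl !ler_norml => /andP[? ?] /andP[? ?] /andP[? ?] ?.
by rewrite ltr_distl; apply/andP; split; lra.
Qed.

(* An ultralimit of a sequence of violating functions is again Lipschitz, and
   by equicontinuity the sequence is close to it on large balls. *)
Lemma weak_cvg_lipschitz (L e : R) : 0 <= L -> 0 < e -> \forall k \near \oo,
  forall f, (forall x y, `|f x - f y| <= L * enorm (x - y)) ->
  `|\int[mu_ k]_x f x - \int[mu]_x f x| <= e.
Proof.
move=> L0 e0; apply: contrapT => nh.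
have /choice[k_ /choice[f_ fP]] : forall N, exists k, exists f, [/\ (N <= k)%N,
    forall x y, `|f x - f y| <= L * enorm (x - y) &
    e < `|\int[mu_ k]_x f x - \int[mu]_x f x|].
  move=> N; apply: contrapT => hN; apply: nh; exists N => // k /= Nk f fL.
  by rewrite leNgt; apply/negP => hlt; apply: hN; exists k, f.
have [M M0 [muM mukM]] := weak_cvg_M2_bound.
(* Subtracting the value at [0] does not change the difference of the two integrals and makes the
   sequence bounded at each point. *)
pose g_ N x := f_ N x - f_ N 0.
have gL N x y : `|g_ N x - g_ N y| <= L * enorm (x - y).
  by rewrite /g_ opprB addrA subrK; case: (fP N).
have g0 N : g_ N 0 = 0 by rewrite /g_ subrr.
have gx N x : `|g_ N x| <= L * enorm x by have := gL N x 0; rewrite g0 !subr0.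
have gint (nu : P2 R d) N : \int[nu]_x g_ N x = \int[nu]_x f_ N x - f_ N 0.
  rewrite RintegralB//; first by rewrite Rintegral_prob_cst.
    by apply: (@lipschitz_integrable _ _ nu _ L); case: (fP N).
  exact: integrable_prob_cst.
have ge N : e < `|\int[mu_ (k_ N)]_x g_ N x - \int[mu]_x g_ N x|.
  by rewrite !gint opprB addrA subrK; case: (fP N).
have [U [UU ooU]] := ultraFilterLemma (@eventually_filter).
have FU : ProperFilter U by exact: ultra_proper.
have /choice[g gl] : forall x, exists l : R, (fun N => g_ N x) @ U --> l.
  by move=> x; apply: ultra_cvg_bounded => N; exact: gx.
have ggL x y : `|g x - g y| <= L * enorm (x - y).
  have h : (fun N => `|g_ N x - g_ N y|) @ U --> `|g x - g y|.
    by apply: cvg_norm; apply: cvgB; exact: gl.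
  by apply: cvgr_to_le h _; apply: filterE => N; exact: gL.
have gg0 : g 0 = 0.
  apply: (@cvg_unique _ (@Rhausdorff R) _ _ _ _ (gl 0)).
  rewrite (_ : (fun N => _) = cst 0); first exact: cvg_cst.
  by apply/funext => N; exact: g0.
have ggx x : `|g x| <= L * enorm x by have := ggL x 0; rewrite gg0 !subr0.
(* On the large ball, passing through the centre of a covering ball costs [e1 + 2 L e1 = e / 16]. *)
pose e1 := e / (16 * (1 + 2 * L)).
have LL : 0 < 1 + 2 * L by rewrite ltr_pwDl// mulr_ge0.
have e10 : 0 < e1 by rewrite divr_gt0// mulr_gt0.
have e1E : e1 + 2 * L * e1 = e / 16 by rewrite /e1; field; rewrite gt_eqF.
(* Outside the ball the difference is at most [2 L |x| <= (2 L / r) |x|^2], whose integral is at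
   most [e / 16]. *)
pose r := 32 * L * M / e + 1.
have LM0 : 0 <= 32 * L * M / e by rewrite divr_ge0 ?mulr_ge0// ltW.
have r0 : 0 < r by rewrite /r ltr_wpDl.
have rE : 2 * L / r * M <= e / 16.
  rewrite mulrAC ler_pdivrMr// /r mulrDr.
  have -> : e / 16 * (32 * L * M / e) = 2 * L * M by field; rewrite gt_eqF.
  by lra.
have := @compact_enorm_ball R d r; rewrite compact_cover.
move=> /(_ 'rV[R]_d [set x | enorm x <= r] (fun x => [set y | enorm (y - x) < e1])).
case.
- move=> x _; rewrite (_ : [set y | _] = (fun y => enorm (y - x)) @^-1` [set s | s < e1])//.
  apply: open_comp; last exact: open_lt.
  move=> y _; apply: (@continuous_lipschitz _ _ (fun y => enorm (y - x)) 1) => a b.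
  by rewrite mul1r (le_trans (ler_enorm_dist _ _))// opprB addrA subrK.
- by move=> x xr; exists x => //=; rewrite subrr enorm0.
move=> D _ Dcover.
have UD : U [set N | forall x, x \in finmap.enum_fset D -> `|g x - g_ N x| < e1].
  have h (s : seq 'rV[R]_d) : U [set N | forall x, x \in s -> `|g x - g_ N x| < e1].
    elim: s => [|x s IH]; first by apply: filterE => N x; rewrite in_nil.
    have hx : U [set N | `|g x - g_ N x| < e1] by move/cvgrPdist_lt : (gl x); apply.
    apply: filterS (filterI hx IH) => N [h1 h2] y.
    by rewrite inE => /predU1P[->//|]; exact: h2.
  exact: h.
have gcvg := weak_cvg_lipschitz1 L0 gg0 ggL.
have e4 : 0 < e / 4 by rewrite divr_gt0.
have /cvgrPdist_lt /(_ _ e4)[N1 _ hN1] := gcvg.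
have UN1 : U [set N | (N1 <= N)%N] by apply: ooU; exists N1.
have [N [hND N1N]] := filter_ex (filterI UD UN1).
have close x : `|g_ N x - g x| <= e / 16 + 2 * L / r * enorm x ^+ 2.
  have q0 : 0 <= 2 * L / r * enorm x ^+ 2.
    by rewrite mulr_ge0 ?sqr_ge0// divr_ge0 ?mulr_ge0// ltW.
  have [xr|xr] := lerP (enorm x) r.
    have [z /= zD zx] := Dcover x xr.
    have h1 := hND z zD; have h2 := gL N x z; have h3 := ggL x z.
    have h4 : L * enorm (x - z) <= L * e1 by rewrite ler_wpM2l// ltW.
    move: h1 h2 h3; rewrite distrC ltr_distl !ler_norml => /andP[? ?] /andP[? ?] /andP[? ?].
    by apply/andP; split; lra.
  have h1 := gx N x; have h2 := ggx x.
  have h3 : `|g_ N x - g x| <= 2 * L * enorm x.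
    by apply: le_trans (ler_normB _ _) _; lra.
  apply: le_trans h3 _; apply: (@le_trans _ _ (2 * L / r * enorm x ^+ 2)); last first.
    by rewrite lerDr divr_ge0// ltW.
  rewrite -!mulrA ler_wpM2l// ler_wpM2l// ler_pdivlMl// mulrC expr2.
  by rewrite ler_wpM2l ?enorm_ge0// ltW.
have mg : measurable_fun setT g.
  by apply: continuous_measurable_rV; exact: continuous_lipschitz ggL.
have mgN : measurable_fun setT (g_ N).
  by apply: continuous_measurable_rV; exact: continuous_lipschitz (gL N).
have diff (nu : P2 R d) : M2 nu <= M ->
    `|\int[nu]_x g_ N x - \int[nu]_x g x| <= e / 8.
  move=> nuM; rewrite -RintegralB//; last 2 first.
  - exact: lipschitz_integrable (gL N).
  - exact: lipschitz_integrable ggL.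
  apply: (@le_trans _ _ (e / 16 + 2 * L / r * M2 nu)).
    apply: (@le_Rintegral_quad _ _ nu (fun x => g_ N x - g x)) => //.
    exact: measurable_funB.
  suff : 2 * L / r * M2 nu <= e / 16 by lra.
  apply: le_trans rE; rewrite ler_wpM2l// divr_ge0 ?mulr_ge0// ltW//.
have kN : (N1 <= k_ N)%N by case: (fP N) => Nk _ _; exact: leq_trans N1N Nk.
have := ge N; have := diff mu muM; have := diff (mu_ (k_ N)) (mukM _).
have := hN1 _ kN; rewrite /= ltr_distl !ler_norml => /andP[? ?] /andP[? ?] /andP[? ?].
suff : `|\int[mu_ (k_ N)]_x g_ N x - \int[mu]_x g_ N x| <= e by lra.
by rewrite ler_norml; apply/andP; split; lra.
Qed.

End weak_compactness_P2.

(** * Flat derivatives *)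

Section couplings.
Context {R : realType} {d : nat}.
Local Notation Rd := 'rV[R]_d.
Implicit Types (mu nu rho : P2 R d) (pi : probability (Rd * Rd)%type R).

Lemma measurable_cost : measurable_fun setT (fun z : Rd * Rd => enorm (z.1 - z.2)).
Proof. by apply: measurable_enorm; exact: measurable_rVB. Qed.

Lemma W1_le_coupling mu nu pi (c : R) : coupling mu nu pi ->
  (\int[pi]_z (enorm (z.1 - z.2))%:E <= c%:E)%E -> W1 mu nu <= c.
Proof.
move=> cpi hc; rewrite /W1; set S := (X in ereal_inf X).
have S0 : (0 <= ereal_inf S)%E.
  apply: le_ereal_inf_tmp => _ [pi' _ <-]; apply: integral_ge0 => z _.
  by rewrite lee_fin enorm_ge0.
have Sc : (ereal_inf S <= c%:E)%E.
  by apply: le_trans hc; apply: ereal_inf_lbound; exists pi.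
rewrite -lee_fin fineK// ge0_fin_numE//.
by apply: le_lt_trans Sc _; exact: ltry.
Qed.

Lemma W2_le_coupling mu nu pi (c : R) : 0 <= c -> coupling mu nu pi ->
  (\int[pi]_z (enorm (z.1 - z.2) ^+ 2)%:E <= (c ^+ 2)%:E)%E -> W2 mu nu <= c.
Proof.
move=> c0 cpi hc; rewrite /W2; set S := (X in ereal_inf X).
have S0 : (0 <= ereal_inf S)%E.
  apply: le_ereal_inf_tmp => _ [pi' _ <-]; apply: integral_ge0 => z _.
  by rewrite lee_fin sqr_ge0.
have Sc : (ereal_inf S <= (c ^+ 2)%:E)%E.
  by apply: le_trans hc; apply: ereal_inf_lbound; exists pi.
rewrite -[leRHS]ger0_norm// -sqrtr_sqr ler_wsqrtr// -lee_fin fineK// ge0_fin_numE//.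
by apply: le_lt_trans Sc _; exact: ltry.
Qed.

Lemma diagonal_coupling mu : exists pi, coupling mu mu pi /\
  forall g : Rd * Rd -> \bar R, measurable_fun setT g -> (forall z, 0 <= g z)%E ->
    (\int[pi]_z g z = \int[mu]_x g (x, x))%E.
Proof.
have mdiag : measurable_fun setT (fun x : Rd => (x, x)) by exact: measurable_fun_pair.
have [pi hpi] := image_exists mdiag mu.
exists pi; split; last by move=> g mg g0; rewrite (integral_image_ge0 mdiag hpi).
split=> A mA; rewrite /pushforward hpi//.
  by rewrite -[X in measurable X]setTI; exact: measurable_fst.
by rewrite -[X in measurable X]setTI; exact: measurable_snd.
Qed.

Lemma mixture_coupling (h : R) mu1 nu1 mu2 nu2 mu nu pi1 pi2 pi :
  coupling mu1 nu1 pi1 -> coupling mu2 nu2 pi2 ->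
  is_mixture h mu1 mu2 mu -> is_mixture h nu1 nu2 nu ->
  (forall A, measurable A -> pi A = ((1 - h)%:E * pi1 A + h%:E * pi2 A)%E) ->
  coupling mu nu pi.
Proof.
move=> [f1 s1] [f2 s2] hmu hnu hpi; split=> A mA; rewrite ?hmu ?hnu// ?f1 ?f2 ?s1 ?s2//;
  rewrite /pushforward hpi// -[X in measurable X]setTI.
  exact: measurable_fst.
exact: measurable_snd.
Qed.

Lemma P2_mixture_exists (h : R) mu nu : 0 <= h <= 1 -> exists rho, is_mixture h mu nu rho.
Proof.
move=> h01; have [S hS] := mixture_exists mu nu h01.
have mS : (\int[S]_x (enorm x ^+ 2)%:E < +oo)%E.
  rewrite (integral_mixture_ge0 h01 hS).
  - rewrite !M2E -!EFinM -EFinD; exact: ltry.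
  - by apply/measurable_EFinP; exact: measurable_enorm2.
  - by move=> x; rewrite lee_fin sqr_ge0.
by exists (MkP2 mS).
Qed.

Lemma P2_dirac_exists (x : Rd) : exists rho : P2 R d, P2prob rho = (\d_x : probability Rd R).
Proof.
have mS : (\int[(\d_x : probability Rd R)]_x (enorm x ^+ 2)%:E < +oo)%E.
  rewrite integral_dirac//; last by apply/measurable_EFinP; exact: measurable_enorm2.
  by rewrite diracT mul1e ltry.
by exists (MkP2 mS).
Qed.

Lemma W2_refl_le0 mu : W2 mu mu <= 0.
Proof.
have [pi [cpi hpi]] := diagonal_coupling mu.
apply: (W2_le_coupling _ cpi) => //; rewrite hpi.
- by rewrite integral0_eq ?expr0n// => x _ /=; rewrite subrr enorm0 expr0n.
- by apply/measurable_EFinP; apply: measurable_funX; exact: measurable_cost.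
- by move=> z; rewrite lee_fin sqr_ge0.
Qed.

End couplings.

Section real_derivative.
Context {R : realType}.

Lemma quotient_is_derive (g : R -> R) (x l : R) :
  (forall e : R, 0 < e -> exists2 del : R, 0 < del & forall s, s != 0 -> `|s| < del ->
     `|(g (x + s) - g x) / s - l| < e) -> is_derive x 1 g l.
Proof.
move=> h; have cg : (fun s => s^-1 *: ((g \o shift x) (s *: 1) - g x)) @ 0^' --> l.
  apply/cvgrPdist_lt => e /h[del del0 hdel]; exists del => //= s.
  rewrite /= sub0r normrN => sdel s0; have := hdel s s0 sdel.
  by rewrite distrC /GRing.scale /= mulr1 (addrC s) (mulrC s^-1).
by apply: DeriveDef; [apply/cvg_ex; exists l|exact: (cvg_lim _ cg)].
Qed.

Lemma quotient_cvg_right (g : R -> R) (x l : R) :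
  (forall e : R, 0 < e -> exists2 del : R, 0 < del & forall s : R, 0 < s -> s < del ->
     `|(g (x + s) - g x) / s - l| < e) -> g y @[y --> x^'+] --> g x.
Proof.
move=> h; apply/cvgrPdist_lt => e e0; have [del del0 hdel] := h 1 ltr01.
have k0 : 0 < `|l| + 1 by rewrite ltr_wpDl.
exists (Num.min del (e / (`|l| + 1))); first by rewrite /= lt_min del0 divr_gt0.
move=> y /=; rewrite distrC lt_min => /andP[yd ye] xy.
have s0 : 0 < y - x by rewrite subr_gt0.
rewrite gtr0_norm// in yd ye.
have := hdel _ s0 yd; rewrite (addrC x) subrK => hq.
rewrite distrC -[X in `|X|](@divfK _ (y - x)) ?gt_eqF// normrM (gtr0_norm s0).
have : `|(g y - g x) / (y - x)| <= `|l| + 1.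
  have := ler_normD ((g y - g x) / (y - x) - l) l; rewrite subrK; lra.
move=> /(ler_wpM2r (ltW s0)) /le_lt_trans; apply.
by rewrite mulrC -ltr_pdivlMr.
Qed.

Lemma quotient_cvg_left (g : R -> R) (x l : R) :
  (forall e : R, 0 < e -> exists2 del : R, 0 < del & forall s : R, 0 < s -> s < del ->
     `|(g x - g (x - s)) / s - l| < e) -> g y @[y --> x^'-] --> g x.
Proof.
move=> h; apply/cvgrPdist_lt => e e0; have [del del0 hdel] := h 1 ltr01.
have k0 : 0 < `|l| + 1 by rewrite ltr_wpDl.
exists (Num.min del (e / (`|l| + 1))); first by rewrite /= lt_min del0 divr_gt0.
move=> y /=; rewrite lt_min => /andP[yd ye] xy.
have s0 : 0 < x - y by rewrite subr_gt0.
rewrite gtr0_norm// in yd ye.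
have := hdel _ s0 yd; rewrite opprB (addrC x) subrK => hq.
rewrite -[X in `|X|](@divfK _ (x - y)) ?gt_eqF// normrM (gtr0_norm s0).
have : `|(g x - g y) / (x - y)| <= `|l| + 1.
  have := ler_normD ((g x - g y) / (x - y) - l) l; rewrite subrK; lra.
move=> /(ler_wpM2r (ltW s0)) /le_lt_trans; apply.
by rewrite mulrC -ltr_pdivlMr.
Qed.

End real_derivative.

Section flat_calculus.
Context {R : realType} {d : nat}.
Local Notation Rd := 'rV[R]_d.
Implicit Types (mu nu rho : P2 R d).

Lemma flat_derivativeP (F : P2 R d -> R) mu :
  flat_differentiable F mu -> is_flat_derivative F mu (flat_derivative F mu).
Proof. exact: getPex. Qed.

Lemma flat_derivative_integrable (F : P2 R d -> R) mu nu (g : Rd -> R) :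
  is_flat_derivative F mu g -> nu.-integrable setT (EFin \o g).
Proof.
case=> mg [C gC] _ _; apply: (@P2_integrable _ _ nu g C C) => // x.
by have := gC x; rewrite mulrDr mulr1.
Qed.

(** Raising the weight of the second endpoint from [h] to [h + s] is a mixture of the current point
    with that endpoint, of weight [s / (1 - h)]. Lowering it by [s] mixes with the first endpoint,
    with weight [s / h]. *)
Let mix_up (h s a b : R) : 1 - h != 0 ->
  ((1 - (h + s))%:E * a%:E + (h + s)%:E * b%:E =
   (1 - s / (1 - h))%:E * ((1 - h)%:E * a%:E + h%:E * b%:E) + (s / (1 - h))%:E * b%:E)%E.
Proof. by move=> h1; rewrite -!EFinM -!EFinD; congr EFin; field. Qed.

Let mix_down (h s a b : R) : h != 0 ->
  ((1 - (h - s))%:E * a%:E + (h - s)%:E * b%:E =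
   (1 - s / h)%:E * ((1 - h)%:E * a%:E + h%:E * b%:E) + (s / h)%:E * a%:E)%E.
Proof. by move=> h1; rewrite -!EFinM -!EFinD; congr EFin; field. Qed.

(* Along a mixture the flat derivative in the direction of either endpoint gives
   the same one-sided slope, so F is differentiable there. *)
Lemma flat_mvt (F : P2 R d -> R) (D : P2 R d -> Rd -> R) mu nu :
  (forall rho, is_flat_derivative F rho (D rho)) ->
  exists (h : R) rho, [/\ 0 < h < 1, is_mixture h mu nu rho &
    F nu - F mu = \int[nu]_x D rho x - \int[mu]_x D rho x].
Proof.
move=> FD.
(* [F] is applied to a record, while a mixture is fixed only by its values on measurable sets. The
   endpoints are therefore imposed as equalities. *)
have /choice[p pP] : forall h : R, exists rho,
    [/\ 0 <= h <= 1 -> is_mixture h mu nu rho, h = 0 -> rho = mu & h = 1 -> rho = nu].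
  move=> h; have [->|h0] := eqVneq h 0.
    exists mu; split=> //; last by move/eqP; rewrite eq_sym oner_eq0.
    by move=> _ A mA; rewrite subr0 mul1e mul0e adde0.
  have [->|h1] := eqVneq h 1.
    exists nu; split=> //; last by move/eqP; rewrite oner_eq0.
    by move=> _ A mA; rewrite subrr mul1e mul0e add0e.
  have [h01|h01] := boolP (0 <= h <= 1).
    have [rho hrho] := P2_mixture_exists mu nu h01; exists rho.
    by split=> // hh; move: h0 h1; rewrite hh eqxx.
  by exists mu; split=> // hh; move: h0 h1; rewrite hh eqxx.
pose g h := F (p h).
pose l h := \int[nu]_x D (p h) x - \int[mu]_x D (p h) x.
(* The normalization at [p h]. It turns the integrals of the flat derivative against [nu] and [mu]
   into [(1 - h) * l h] and [- h * l h], so that both one-sided slopes equal [l h]. *)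
have mixD (h : R) : 0 <= h <= 1 ->
    (1 - h) * \int[mu]_x D (p h) x + h * \int[nu]_x D (p h) x = 0.
  move=> h01; have [hm _ _] := pP h; have [_ _ _ z] := FD (p h).
  rewrite -(Rintegral_mixture h01 (hm h01)) ?z//;
  exact: flat_derivative_integrable (FD (p h)).
have right_q (h : R) : 0 <= h < 1 -> forall e : R, 0 < e -> exists2 del : R, 0 < del &
    forall s : R, 0 < s -> s < del -> `|(g (h + s) - g h) / s - l h| < e.
  move=> /andP[h0 h1] e e0; have h1' : 0 < 1 - h by rewrite subr_gt0.
  have hh1 : 0 <= h <= 1 by rewrite h0 ltW.
  have [_ _ /(_ nu _ (mulr_gt0 e0 h1'))[del del0 hdel] _] := FD (p h).
  exists (Num.min del 1 * (1 - h)); first by rewrite mulr_gt0// lt_min del0 ltr01.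
  move=> s s0; rewrite -ltr_pdivrMr// lt_min => /andP[sd s1].
  have sq0 : 0 < s / (1 - h) by rewrite divr_gt0.
  have hs1 : 0 <= h + s <= 1.
    by move: s1; rewrite ltr_pdivrMr// mul1r; lra.
  have mix : is_mixture (s / (1 - h)) (p h) nu (p (h + s)).
    move=> A mA; have [hm _ _] := pP h; have [hsm _ _] := pP (h + s).
    rewrite hsm// hm// -[mu A]fineK ?fin_num_measure// -[nu A]fineK ?fin_num_measure//.
    by apply: mix_up; rewrite gt_eqF.
  have := hdel _ _ sq0 (ltW s1) sd mix.
  have [_ _ _ z] := FD (p h); rewrite z subr0 => hq.
  have lE : \int[nu]_x D (p h) x = (1 - h) * l h.
    by have := mixD h hh1; rewrite /l; lra.
  rewrite -(ltr_pM2r h1') -[X in _ * X](gtr0_norm h1') -normrM mulrBl mulrAC.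
  move: hq; rewrite lE invf_div mulrA /g.
  by rewrite (mulrC (1 - h) (l h)).
have left_q (h : R) : 0 < h <= 1 -> forall e : R, 0 < e -> exists2 del : R, 0 < del &
    forall s : R, 0 < s -> s < del -> `|(g h - g (h - s)) / s - l h| < e.
  move=> /andP[h0 h1] e e0.
  have hh1 : 0 <= h <= 1 by rewrite h1 ltW.
  have [_ _ /(_ mu _ (mulr_gt0 e0 h0))[del del0 hdel] _] := FD (p h).
  exists (Num.min del 1 * h); first by rewrite mulr_gt0// lt_min del0 ltr01.
  move=> s s0; rewrite -ltr_pdivrMr// lt_min => /andP[sd s1].
  have sq0 : 0 < s / h by rewrite divr_gt0.
  have hs1 : 0 <= h - s <= 1.
    by move: s1; rewrite ltr_pdivrMr// mul1r; lra.
  have mix : is_mixture (s / h) (p h) mu (p (h - s)).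
    move=> A mA; have [hm _ _] := pP h; have [hsm _ _] := pP (h - s).
    rewrite hsm// hm// -[mu A]fineK ?fin_num_measure// -[nu A]fineK ?fin_num_measure//.
    by apply: mix_down; rewrite gt_eqF.
  have := hdel _ _ sq0 (ltW s1) sd mix.
  have [_ _ _ z] := FD (p h); rewrite z subr0 => hq.
  have lE : \int[mu]_x D (p h) x = - (h * l h).
    by have := mixD h hh1; rewrite /l; lra.
  rewrite -(ltr_pM2r h0) -[X in _ * X](gtr0_norm h0) -normrM mulrBl mulrAC.
  move: hq; rewrite lE invf_div mulrA /g opprK -normrN.
  by rewrite (mulrC h (l h)) opprD -!mulNr opprB.
have gd (x : R) : x \in `]0, 1[ -> is_derive x (1 : R) g (l x).
  rewrite in_itv /= => /andP[x0 x1]; apply: quotient_is_derive => e e0.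
  have [d1 d10 h1] : exists2 del : R, 0 < del & forall s : R, 0 < s -> s < del ->
      `|(g (x + s) - g x) / s - l x| < e by apply: right_q => //; rewrite ltW.
  have [d2 d20 h2] : exists2 del : R, 0 < del & forall s : R, 0 < s -> s < del ->
      `|(g x - g (x - s)) / s - l x| < e by apply: left_q => //; rewrite x0 ltW.
  exists (Num.min d1 d2); first by rewrite lt_min d10.
  move=> s s0; rewrite lt_min => /andP[sd1 sd2].
  move: s0; rewrite neq_lt => /orP[s0|s0].
    have sN : 0 < - s by rewrite oppr_gt0.
    rewrite ltr0_norm// in sd2; have := h2 _ sN sd2.
    by rewrite opprK invrN mulrN -mulNr opprB.
  by rewrite gtr0_norm// in sd1; exact: h1.
have gc : {within `[0, 1], continuous g}.
  apply/continuous_within_itvP => //; split.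
  - move=> x xI; apply: differentiable_continuous; apply/derivable1_diffP.
    by have [] := gd x xI.
  - by apply: (@quotient_cvg_right _ g 0 (l 0)); apply: right_q; rewrite lexx ltr01.
  - by apply: (@quotient_cvg_left _ g 1 (l 1)); apply: left_q; rewrite lexx ltr01.
have [h hI] := MVT ltr01 gd gc; rewrite in_itv /= in hI.
have [_ p0 _] := pP 0; have [_ _ p1] := pP 1.
rewrite /g p0// p1// subr0 mulr1 => ->; exists h, (p h); split=> //.
have [hm _ _] := pP h; apply: hm; move: hI => /andP[? ?]; lra.
Qed.

(** Mix [mu] with Dirac masses at [x] and at [y], both of weight [h]. Leaving the common part at
    rest shows that the mixtures are at [W1] distance at most [h |x - y|]; division by [h] and [h]
    tending to [0] give the bound. *)
Lemma flat_derivative_lipschitz (F : P2 R d -> R) (L : R) mu (g : Rd -> R) :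
  (forall nu rho, `|F nu - F rho| <= L * W1 nu rho) -> is_flat_derivative F mu g ->
  forall x y, `|g x - g y| <= `|L| * enorm (x - y).
Proof.
move=> FL [mg _ gq g0] x y; apply/ler_addgt0Pr => e e0.
have [rx rxE] := P2_dirac_exists x; have [ry ryE] := P2_dirac_exists y.
have Ix : \int[rx]_z g z = g x.
  rewrite rxE /Rintegral integral_dirac//; last exact/measurable_EFinP.
  by rewrite diracT mul1e.
have Iy : \int[ry]_z g z = g y.
  rewrite ryE /Rintegral integral_dirac//; last exact/measurable_EFinP.
  by rewrite diracT mul1e.
have e2 : 0 < e / 2 by rewrite divr_gt0.
have [dx dx0 hx] := gq rx _ e2; have [dy dy0 hy] := gq ry _ e2.
pose h := Num.min 1 (Num.min dx dy) / 2.
have m0 : 0 < Num.min 1 (Num.min dx dy) by rewrite !lt_min ltr01 dx0.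
have h0 : 0 < h by rewrite divr_gt0.
have hm : h < Num.min 1 (Num.min dx dy) by rewrite /h; lra.
move: (hm); rewrite !lt_min => /and3P[h1 hdx hdy].
have h01 : 0 <= h <= 1 by rewrite !ltW.
have [nx nxE] := P2_mixture_exists mu rx h01.
have [ny nyE] := P2_mixture_exists mu ry h01.
have := hx _ _ h0 (ltW h1) hdx nxE; have := hy _ _ h0 (ltW h1) hdy nyE.
rewrite Ix Iy g0 !subr0 => hhy hhx.
have [pi1 [cpi1 pi1E]] := diagonal_coupling mu.
have [pi hpi] := mixture_exists pi1 (\d_(x, y) : probability _ R) h01.
have mcost : measurable_fun setT (fun z : Rd * Rd => (enorm (z.1 - z.2))%:E).
  by apply/measurable_EFinP; exact: measurable_cost.
have c0 (z : Rd * Rd) : (0 <= (enorm (z.1 - z.2))%:E)%E by rewrite lee_fin enorm_ge0.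
have cxy : coupling rx ry (\d_(x, y) : probability (Rd * Rd)%type R).
  by rewrite /coupling rxE ryE; split=> A mA.
have W1h : W1 nx ny <= h * enorm (x - y).
  apply: (W1_le_coupling (mixture_coupling cpi1 cxy nxE nyE hpi)).
  have pi10 : (\int[pi1]_z (enorm (z.1 - z.2))%:E = 0)%E.
    by rewrite pi1E//; apply: integral0_eq => z _ /=; rewrite subrr enorm0.
  rewrite (integral_mixture_ge0 h01 hpi mcost c0) pi10 mule0 add0e.
  by rewrite integral_dirac// diracT mul1e -EFinM.
have FW : `|F nx - F ny| / h <= `|L| * enorm (x - y).
  rewrite ler_pdivrMr//; apply: le_trans (FL nx ny) _.
  have W1h' : L * W1 nx ny <= `|L| * (h * enorm (x - y)).
    apply: (@le_trans _ _ (`|L| * W1 nx ny)); last by rewrite ler_wpM2l.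
    rewrite ler_wpM2r ?ler_norm//; apply: fine_ge0; apply: le_ereal_inf_tmp => _ [p _ <-].
    by apply: integral_ge0 => z _; rewrite lee_fin enorm_ge0.
  by apply: le_trans W1h' _; rewrite mulrA mulrAC.
have : `|(F nx - F mu) / h - (F ny - F mu) / h| <= `|L| * enorm (x - y).
  by rewrite -mulrBl opprB addrA subrK normrM normfV (gtr0_norm h0).
move: hhx hhy; rewrite !ltr_norml !ler_norml.
move=> /andP[? ?] /andP[? ?] /andP[? ?]; apply/andP; split; lra.
Qed.

End flat_calculus.

(** * Mean value and Taylor estimates along lines *)

Section directional_calculus.
Context {R : realType} {d : nat}.
Local Notation Rd := 'rV[R]_d.
Implicit Types (x y : Rd) (s : R).

Lemma derive_grad (f : Rd -> R) x y : differentiable f x ->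
  'D_y f x = dot (grad f x) y.
Proof.
move=> df; rewrite deriveE// {1}(row_sum_delta y) linear_sum /dot.
apply: eq_bigr => i _; rewrite linearZ /= mxE /partial deriveE//.
exact: mulrC.
Qed.

Lemma is_derive_line (f : Rd -> R) x y s : differentiable f (x + s *: y) ->
  is_derive s 1 (fun r => f (x + r *: y)) (dot (grad f (x + s *: y)) y).
Proof.
move=> df; rewrite -derive_grad//.
have cf : h^-1 *: ((f \o shift (x + s *: y)) (h *: y) - f (x + s *: y)) @[h --> 0^']
    --> 'D_y f (x + s *: y) by exact: diff_derivable.
have cg : h^-1 *: (((fun r : R => f (x + r *: y)) \o shift s) (h *: 1) - f (x + s *: y)) @[h --> 0^']
    --> 'D_y f (x + s *: y).
  apply: cvg_trans cf; apply: near_eq_cvg; apply: filterE => h /=.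
  by rewrite [h *: 1]mulr1 scalerDl addrCA.
by apply: DeriveDef; [apply/cvg_ex; eexists; exact: cg|exact: (cvg_lim _ cg)].
Qed.

Lemma is_derive_line_coord (g : Rd -> Rd) x y s j : differentiable g (x + s *: y) ->
  is_derive s 1 (fun r => g (x + r *: y) 0 j) ((y *m 'J g (x + s *: y)) 0 j).
Proof.
move=> dg; rewrite /jacobian mul_rV_lin1 -deriveE//.
have cf : h^-1 *: ((g \o shift (x + s *: y)) (h *: y) - g (x + s *: y)) @[h --> 0^']
    --> 'D_y g (x + s *: y) by exact: diff_derivable.
have cg : h^-1 *: (((fun r : R => g (x + r *: y) 0 j) \o shift s) (h *: 1) - g (x + s *: y) 0 j) @[h --> 0^']
    --> 'D_y g (x + s *: y) 0 j.
  have := cvg_comp _ _ cf (@coord_continuous R 1 d 0 j ('D_y g (x + s *: y))).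
  apply: cvg_trans; apply: near_eq_cvg; apply: filterE => h /=.
  by rewrite [h *: 1]mulr1 scalerDl addrCA !mxE.
by apply: DeriveDef; [apply/cvg_ex; eexists; exact: cg|exact: (cvg_lim _ cg)].
Qed.

Lemma is_derive_continuous (g dg : R -> R) (a b : R) :
  (forall s, is_derive s 1 g (dg s)) -> {within `[a, b], continuous g}.
Proof.
move=> h; apply: continuous_subspaceT => s; apply: differentiable_continuous.
by apply/derivable1_diffP; have [] := h s.
Qed.

Lemma mvt01 (g dg : R -> R) : (forall s, is_derive s 1 g (dg s)) ->
  exists2 s, 0 < s < 1 & g 1 - g 0 = dg s.
Proof.
move=> h; have [s sI ->] := MVT (@ltr01 R) (fun s _ => h s) (is_derive_continuous h).
by exists s; [move: sI; rewrite in_itv|rewrite subr0 mulr1].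
Qed.

(** The mean value theorem is applied to each coordinate, with its own intermediate point. One
    factor [d] comes from the sum over a column of the Jacobian, the other from [enorm_le_coord]. *)
Lemma grad_lipschitz (f : Rd -> R) (C : R) :
  (forall x, differentiable (grad f) x) -> (forall x, `|hessian f x| <= C) ->
  forall x y, enorm (grad f (x + y) - grad f x) <= d%:R ^+ 2 * C * enorm y.
Proof.
move=> dg hC x y; rewrite expr2 -!mulrA; apply: enorm_le_coord => j; rewrite !mxE.
have h (s : R) : is_derive s 1 (fun r => grad f (x + r *: y) 0 j)
    ((y *m 'J (grad f) (x + s *: y)) 0 j) by exact: is_derive_line_coord.
have [s _] := mvt01 h; rewrite scale1r scale0r addr0 !mxE => ->.
apply: le_trans (ler_norm_sum _ _ _) _.
apply: (@le_trans _ _ (\sum_(i < d) C * enorm y)).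
  apply: ler_sum => i _; rewrite normrM mulrC.
  have C0 := le_trans (normr_ge0 _) (hC x).
  apply: ler_pM => //; last exact: coord_le_enorm.
  exact: le_trans (mx_entry_le_norm _ _ _) (hC _).
by rewrite sumr_const card_ord mulr_natl.
Qed.

Lemma taylor_bound (f : Rd -> R) (C : R) : (forall x, differentiable f x) ->
  (forall x, differentiable (grad f) x) -> (forall x, `|hessian f x| <= C) ->
  forall x y, `|f (x + y) - f x - dot (grad f x) y| <= d%:R ^+ 2 * C * enorm y ^+ 2.
Proof.
move=> df dg hC x y; have C0 := le_trans (normr_ge0 _) (hC x).
have h (s : R) : is_derive s 1 (fun r => f (x + r *: y))
    (dot (grad f (x + s *: y)) y) by exact: is_derive_line.
have [s /andP[s0 s1]] := mvt01 h; rewrite scale1r scale0r addr0 => ->.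
rewrite -dotBl; apply: le_trans (dot_le_enorm _ _) _; rewrite expr2 mulrA.
rewrite ler_wpM2r ?enorm_ge0//; apply: le_trans (grad_lipschitz dg hC _ _) _.
rewrite enormZ gtr0_norm// mulrA ler_wpM2r ?enorm_ge0//.
by rewrite ler_piMr// ?mulr_ge0 ?exprn_ge0// ltW.
Qed.

Lemma grad_bounded (f : Rd -> R) (L : R) x : 0 <= L -> differentiable f x ->
  (forall a b, `|f a - f b| <= L * enorm (a - b)) -> enorm (grad f x) <= d%:R * L.
Proof.
move=> L0 df fL; apply: enorm_le_coord => i; rewrite mxE /partial.
set e := delta_mx _ _.
have en : enorm e = 1 := enorm_delta i.
have cf : h^-1 *: ((f \o shift x) (h *: e) - f x) @[h --> 0^'] --> 'D_e f x.
  exact: diff_derivable.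
apply: cvgr_to_le (cvg_norm cf) _; exists 1 => //= h _ h0.
rewrite normrM normfV mulrC ler_pdivrMr ?normr_gt0//.
by apply: le_trans (fL _ _) _; rewrite addrK enormZ en mulr1.
Qed.

(* With [k s = f (x + s e) + f (x - s e) - 2 f x], [k' s ~ 2 s H], so [H > L]
   would force [k s > L s ^ 2] for small [s]. *)
Lemma hessian_diag_le (f : Rd -> R) x (L : R) i : (forall x, differentiable f x) ->
  (forall x, differentiable (grad f) x) ->
  (exists2 r : R, 0 < r & forall s, 0 < s < r ->
     f (x + s *: delta_mx 0 i) + f (x - s *: delta_mx 0 i) - 2 * f x <= L * s ^+ 2) ->
  hessian f x i i <= L.
Proof.
move=> df dg [r r0 fr]; rewrite leNgt; apply/negP => LH.
set e := delta_mx 0 i in fr; set H := hessian f x i i in LH *.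
have gE z : dot (grad f z) e = grad f z 0 i.
  rewrite /dot (bigD1 i)//= big1 => [|j ji].
    by rewrite addr0 [X in _ * X]mxE !eqxx mulr1.
  by rewrite [X in _ * X]mxE (negbTE ji) andbF mulr0.
pose g s := grad f (x + s *: e) 0 i.
have gd : is_derive 0 (1 : R) g H.
  have -> : H = (e *m 'J (grad f) (x + 0 *: e)) 0 i.
    by rewrite scale0r addr0 -rowE mxE.
  exact: is_derive_line_coord.
pose M := (H + L) / 2.
have HM : 0 < H - M by rewrite /M; lra.
have [del del0 hdel] : exists2 del : R, 0 < del & forall h : R, `|h| < del -> h != 0 ->
    `|(g h - g 0) / h - H| < H - M.
  have cg : h^-1 *: ((g \o shift 0) (h *: 1) - g 0) @[h --> 0^'] --> H.
    by have [? <-] := gd.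
  move/cvgrPdist_lt : cg => /(_ _ HM) [del del0 hdel]; exists del => // h hh h0.
  have := hdel h; rewrite /= sub0r normrN => /(_ hh h0).
  by rewrite [h *: 1]mulr1 addr0 distrC /GRing.scale/= mulrC.
have slope (h : R) : 0 < h -> h < del -> 2 * M * h < g h - g (- h).
  move=> h0 hd.
  have h1 : `|(g h - g 0) / h - H| < H - M by apply: hdel; rewrite ?gt_eqF// gtr0_norm.
  have h2 : `|(g (- h) - g 0) / (- h) - H| < H - M.
    by apply: hdel; rewrite ?normrN ?oppr_eq0 ?gt_eqF// gtr0_norm.
  move: h1 h2; rewrite !ltr_norml => /andP[h1 _] /andP[h2 _].
  have {}h1 : M < (g h - g 0) / h by lra.
  have {}h2 : M < (g (- h) - g 0) / (- h) by lra.
  by move: h1 h2; rewrite ltr_pdivlMr// invrN mulrN -mulNr ltr_pdivlMr//; lra.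
pose k s := f (x + s *: e) + f (x - s *: e) - 2 * f x - M * s ^+ 2.
have kd s : is_derive s (1 : R) k (g s - g (- s) - 2 * M * s).
  have d1 : is_derive s (1 : R) (fun r => f (x + r *: e)) (g s).
    by rewrite /g -gE; exact: is_derive_line.
  have d2 : is_derive s (1 : R) (fun r => f (x + r *: (- e))) (- g (- s)).
    rewrite /g -gE -dotNr scaleNr -scalerN; exact: is_derive_line.
  have -> : k = (fun r => f (x + r *: e)) + (fun r => f (x + r *: (- e)))
      - (cst (2 * f x)) - (M \*: (@id R ^+ 2)).
    by apply/funext => r'; rewrite /k !fctE scalerN.
  have d3 : is_derive s (1 : R) (M \*: (@id R ^+ 2)) (2 * M * s).
    by apply: is_derive_eq; rewrite /GRing.scale/= mulr1 expr1; ring.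
  apply: is_derive_eq; rewrite /GRing.scale/=; ring.
pose s0 := Num.min r del / 2.
have m0 : 0 < Num.min r del by rewrite lt_min r0.
have s00 : 0 < s0 by rewrite divr_gt0.
have : s0 < Num.min r del by rewrite /s0; lra.
rewrite lt_min => /andP[s0r s0d].
have [c cI] := MVT s00 (fun s _ => kd s) (is_derive_continuous kd).
rewrite in_itv /= in cI; case/andP: cI => c0 cs.
have k0 : k 0 = 0 by rewrite /k scale0r addr0 subr0; ring.
rewrite k0 subr0 => kE.
have kpos : 0 < k s0.
  rewrite kE subr0 mulr_gt0// subr_gt0; apply: slope => //; exact: lt_trans cs s0d.
have := fr s0; rewrite s00 s0r => /(_ isT).
have s2 : 0 < s0 ^+ 2 by rewrite exprn_gt0.
have : L * s0 ^+ 2 < M * s0 ^+ 2 by rewrite ltr_pM2r// /M; lra.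
by move: kpos; rewrite /k; lra.
Qed.

End directional_calculus.

(** * Expansion along plans *)

Section plan_calculus.
Context {R : realType} {d : nat}.
Local Notation Rd := 'rV[R]_d.
Implicit Types (mu nu rho : P2 R d) (xi gamma : probability (Rd * Rd)%type R).

Let quad (a b c : R) (z : Rd * Rd) : R := a + b * enorm z.1 ^+ 2 + c * enorm z.2 ^+ 2.

Let mfst : measurable_fun setT (fst : Rd * Rd -> Rd) := measurable_fst.
Let msnd : measurable_fun setT (snd : Rd * Rd -> Rd) := measurable_snd.

Let dist_triangle (u v w p q : R) : `|u - v| <= p -> `|v - w| <= q -> `|u - w| <= p + q.
Proof. by move=> h1 h2; apply: le_trans (ler_distD v _ _) _; exact: lerD. Qed.

Lemma plan_integrable_sqr1 mu xi : plan_at mu xi ->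
  xi.-integrable setT (EFin \o (fun z : Rd * Rd => enorm z.1 ^+ 2)).
Proof.
move=> [h _]; apply/integrableP; split.
  by apply/measurable_EFinP; exact: measurable_enorm2.
apply: le_lt_trans h; apply: ge0_le_integral => //.
- by apply/measurable_EFinP; apply: measurableT_comp => //; exact: measurable_enorm2.
- by apply/measurable_EFinP; apply: measurable_funD; exact: measurable_enorm2.
- by move=> z _ /=; rewrite lee_fin ger0_norm ?sqr_ge0// lerDl sqr_ge0.
Qed.

Lemma plan_integrable_sqr2 mu xi : plan_at mu xi ->
  xi.-integrable setT (EFin \o (fun z : Rd * Rd => enorm z.2 ^+ 2)).
Proof.
move=> [h _]; apply/integrableP; split.
  by apply/measurable_EFinP; exact: measurable_enorm2.
apply: le_lt_trans h; apply: ge0_le_integral => //.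
- by apply/measurable_EFinP; apply: measurableT_comp => //; exact: measurable_enorm2.
- by apply/measurable_EFinP; apply: measurable_funD; exact: measurable_enorm2.
- by move=> z _ /=; rewrite lee_fin ger0_norm ?sqr_ge0// lerDr sqr_ge0.
Qed.

Lemma plan_norm_sqr xi : plan_norm xi ^+ 2 = \int[xi]_z (enorm z.2 ^+ 2).
Proof.
by rewrite sqr_sqrtr//; apply: Rintegral_ge0 => z _; exact: sqr_ge0.
Qed.

Lemma plan_norm_ge0 xi : 0 <= plan_norm xi.
Proof. exact: sqrtr_ge0. Qed.

Lemma plan_integrable mu xi (f : Rd * Rd -> R) (a b c : R) : plan_at mu xi ->
  measurable_fun setT f ->
  (forall z, `|f z| <= a + b * enorm z.1 ^+ 2 + c * enorm z.2 ^+ 2) ->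
  xi.-integrable setT (EFin \o f).
Proof.
move=> hxi mf fabc.
have iq : xi.-integrable setT (EFin \o quad a b c).
  have := integrableD measurableT (integrableD measurableT (integrable_prob_cst xi a)
    (integrableZl measurableT b (plan_integrable_sqr1 hxi)))
    (integrableZl measurableT c (plan_integrable_sqr2 hxi)).
  exact: eq_integrable.
apply: le_integrable iq => //; first exact/measurable_EFinP.
by move=> z _ /=; rewrite lee_fin (le_trans (fabc z))// ler_norm.
Qed.

(** The second moment is exactly quadratic along a plan: its gradient is [2 x] and its remainder is
    the squared norm of the plan. *)
Lemma M2_exp mu nu xi : plan_at mu xi -> is_exp xi nu ->
  M2 nu = M2 mu + 2 * \int[xi]_z dot z.1 z.2 + plan_norm xi ^+ 2.
Proof.
move=> hxi hnu; have [_ hmu] := hxi.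
have mdot : measurable_fun setT (fun z : Rd * Rd => dot z.1 z.2).
  exact: measurable_dot.
have idot : xi.-integrable setT (EFin \o (fun z : Rd * Rd => dot z.1 z.2)).
  apply: (plan_integrable (a := 0) (b := 1) (c := 1) hxi mdot) => z.
  have := dot_le_sqr z.1 z.2; have := normr_ge0 (dot z.1 z.2).
  have := sqr_ge0 (enorm z.1); have := sqr_ge0 (enorm z.2); lra.
have i1 := plan_integrable_sqr1 hxi; have i2 := plan_integrable_sqr2 hxi.
have madd : measurable_fun setT (fun z : Rd * Rd => z.1 + z.2) by exact: measurable_rVD.
have i2dot : xi.-integrable setT (EFin \o (fun z : Rd * Rd => 2 * dot z.1 z.2)).
  by have := integrableZl measurableT 2 idot; exact: eq_integrable.
have i12 : xi.-integrable setT (EFin \o (fun z : Rd * Rd => enorm z.1 ^+ 2 + 2 * dot z.1 z.2)).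
  by have := integrableD measurableT i1 i2dot; exact: eq_integrable.
rewrite plan_norm_sqr -RintegralZl// /M2.
rewrite (Rintegral_image mfst hmu)//; last exact: measurable_enorm2.
rewrite -RintegralD// -RintegralD//.
rewrite (Rintegral_image madd hnu); first last.
- have := integrableD measurableT i12 i2; apply: eq_integrable => // z _ /=.
  by rewrite enorm_sqrD EFinD.
- exact: measurable_enorm2.
by apply: eq_Rintegral => z _; rewrite enorm_sqrD.
Qed.

Variable F : P2 R d -> R.
Variable L : R.
Hypothesis L0 : 0 <= L.
Hypothesis FC2 : partially_C2 F.
Hypothesis FL : forall nu rho, `|F nu - F rho| <= L * W1 nu rho.

Lemma partially_C2_flat mu : is_flat_derivative F mu (flat_derivative F mu).
Proof. by case: FC2 => -[h _ _ _] _ _ _; apply: flat_derivativeP. Qed.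

Lemma partially_C2_lipschitz mu x y :
  `|flat_derivative F mu x - flat_derivative F mu y| <= L * enorm (x - y).
Proof.
rewrite -{1}(ger0_norm L0).
by apply: flat_derivative_lipschitz FL (partially_C2_flat mu) _ _.
Qed.

Lemma partially_C2_differentiable mu x : differentiable (flat_derivative F mu) x.
Proof. by case: FC2 => -[_ _ _ [h _ _]] _ _ _; exact: h. Qed.

Lemma partially_C2_dmu_differentiable mu x :
  differentiable (grad (flat_derivative F mu)) x.
Proof. by case: FC2 => _ h _ _; exact: h. Qed.

Lemma dmu_bounded mu x : enorm (dmu F mu x) <= d%:R * L.
Proof.
apply: grad_bounded => //; first exact: partially_C2_differentiable.
exact: partially_C2_lipschitz.
Qed.

Lemma measurable_dmu mu : measurable_fun setT (dmu F mu).
Proof.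
apply/measurable_rVP => j; apply: continuous_measurable_rV => x.
apply: (@continuous_comp _ _ _ (dmu F mu) (fun v : Rd => v 0 j)).
  apply: differentiable_continuous; exact: partially_C2_dmu_differentiable.
exact: coord_continuous.
Qed.

(** Along a sequence violating the claim, the gradients converge at each point by joint continuity
    and are bounded by [d L], so dominated convergence applies. The [L^2] form is needed because
    plans have velocities in [L^2] only. *)
Lemma dmu_L2_continuous mu (e : R) : 0 < e -> exists2 del : R, 0 < del &
  forall rho, W2 mu rho < del ->
  \int[mu]_x (enorm (dmu F rho x - dmu F mu x) ^+ 2) <= e.
Proof.
move=> e0; apply: contrapT => nh.
have /choice[r_ rP] : forall k : nat, exists rho, W2 mu rho < k.+1%:R^-1 /\
    e < \int[mu]_x (enorm (dmu F rho x - dmu F mu x) ^+ 2).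
  move=> k; apply: contrapT => hk; apply: nh; exists k.+1%:R^-1.
    by rewrite invr_gt0.
  by move=> rho hrho; rewrite leNgt; apply/negP => hlt; apply: hk; exists rho.
pose f_ k x := (enorm (dmu F (r_ k) x - dmu F mu x) ^+ 2)%:E.
pose B := (2 * (d%:R * L)) ^+ 2.
have mf k : measurable_fun setT (f_ k).
  apply/measurable_EFinP; apply: measurable_enorm2.
  by apply: measurable_rVB; exact: measurable_dmu.
have fB k x : (`|f_ k x| <= B%:E)%E.
  rewrite /f_ lee_fin ger0_norm ?sqr_ge0// ler_sqr ?nnegrE ?enorm_ge0 ?mulr_ge0//.
  apply: le_trans (ler_enormB _ _) _.
  by rewrite (mulr_natl _ 2) mulr2n lerD ?dmu_bounded.
have fcvg x : f_ k x @[k --> \oo] --> 0%E.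
  apply: cvg_EFin; first exact: nearW.
  apply/cvgrPdist_lt => t t0.
  have s0 : 0 < Num.sqrt t by rewrite sqrtr_gt0.
  (* Continuity is given in the sup norm; [enorm] costs a factor [d], and [+ 1] keeps the divisor
     positive. *)
  pose s := Num.sqrt t / (d%:R + 1).
  have d0 : 0 < d%:R + 1 :> R by rewrite ltr_wpDl.
  have ss0 : 0 < s by rewrite divr_gt0.
  case: FC2 => -[_ _ _ [_ hc _]] _ _ _.
  have [del del0 hdel] := hc x mu _ ss0.
  have [N _ hN] := near_infty_natSinv_lt (PosNum del0).
  exists N => // k /= Nk; rewrite sub0r normrN ger0_norm ?sqr_ge0//.
  rewrite -[ltRHS](sqr_sqrtr (ltW t0)) ltr_sqr ?nnegrE ?enorm_ge0 ?sqrtr_ge0//.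
  apply: le_lt_trans (enorm_le_norm _) _.
  have h : `|dmu F (r_ k) x - dmu F mu x| < s.
    apply: hdel; first by rewrite subrr normr0.
    by apply: lt_trans (hN _ Nk); case: (rP k).
  apply: (@le_lt_trans _ _ (d%:R * s)); first by rewrite ler_wpM2l// ltW.
  have -> : Num.sqrt t = (d%:R + 1) * s by rewrite mulrC divfK// gt_eqF.
  by rewrite ltr_pM2r// ltrDl.
have [_ _] := @dominated_convergence _ _ _ mu _ measurableT f_ (cst 0%E) (cst B%:E)
  mf (measurable_cst _) (aeW _ (fun x _ => fcvg x)) (integrable_prob_cst mu B)
  (aeW _ (fun x k _ => fB k x)).
rewrite integral0_eq// => /fine_cvgP[_ /cvgrPdist_lt /(_ _ e0)[N _ /(_ N (leqnn N))]].
rewrite /= sub0r normrN; apply/negP; rewrite -leNgt.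
apply: le_trans (ler_norm _); case: (rP N) => _ /ltW; exact.
Qed.

Lemma hessian_bound : exists2 C : R, 0 <= C &
  forall mu x, `|hessian (flat_derivative F mu) x| <= C.
Proof.
case: FC2 => _ _ _ [C hC]; exists `|C| => // mu x.
exact: le_trans (hC mu x) (ler_norm _).
Qed.

(* The second-order error of the increment of [D rho] along the plan is
   controlled by the Hessian bound, the first-order one by
   [dmu_L2_continuous], since the mean-value measure [rho] is close to [mu]. *)
Lemma flat_taylor_plan mu (e : R) : 0 < e -> exists2 del : R, 0 < del &
  forall xi nu, plan_at mu xi -> is_exp xi nu -> plan_norm xi < del ->
  `|F nu - F mu - \int[xi]_z dot (dmu F mu z.1) z.2| <= e * plan_norm xi.
Proof.
move=> e0; have [C C0 hC] := hessian_bound.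
pose K := d%:R ^+ 2 * C.
have K0 : 0 <= K by rewrite mulr_ge0 ?exprn_ge0.
have e2 : 0 < (e / 2) ^+ 2 by rewrite exprn_gt0// divr_gt0.
have [del del0 hdel] := dmu_L2_continuous mu e2.
have eK : 0 < e / (2 * (K + 1)) by rewrite divr_gt0// mulr_gt0// ltr_wpDl.
(* On this range [K n <= e / 2]; the other half of [e] pays for the variation of the gradient
   between [mu] and [rho]. *)
exists (Num.min del (e / (2 * (K + 1)))); first by rewrite lt_min del0.
move=> xi nu hxi hnu; rewrite lt_min => /andP[nd nK].
have [_ hmu] := hxi; set n := plan_norm xi in nd nK *.
have n0 : 0 <= n := plan_norm_ge0 xi.
have n2 : n ^+ 2 = \int[xi]_z (enorm z.2 ^+ 2) := plan_norm_sqr xi.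
have i2 := plan_integrable_sqr2 hxi.
have madd : measurable_fun setT (fun z : Rd * Rd => z.1 + z.2) by exact: measurable_rVD.
have [h [rho [/andP[h0 h1] hrho ->]]] := flat_mvt mu nu partially_C2_flat.
have h01 : 0 <= h <= 1 by rewrite !ltW.
(* Leave the fraction [1 - h] at rest and move the fraction [h] along [xi]: the cost is [h n^2]. *)
have W2rho : W2 mu rho <= n.
  have [pi1 [cpi1 pi1E]] := diagonal_coupling mu.
  have mq : measurable_fun setT (fun z : Rd * Rd => (z.1, z.1 + z.2)).
    exact: measurable_fun_pair.
  have [pi2 hpi2] := image_exists mq xi.
  have cpi2 : coupling mu nu pi2.
    split=> A mA.
      have mfA : measurable (fst @^-1` A : set (Rd * Rd)).
        by rewrite -[X in measurable X]setTI; exact: measurable_fst.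
      by rewrite (hmu A mA) /pushforward (hpi2 _ mfA).
    have msA : measurable (snd @^-1` A : set (Rd * Rd)).
      by rewrite -[X in measurable X]setTI; exact: measurable_snd.
    by rewrite (hnu A mA) /pushforward (hpi2 _ msA).
  have [pi hpi] := mixture_exists pi1 pi2 h01.
  have mumu : is_mixture h mu mu mu.
    move=> A mA; rewrite -[mu A]fineK ?fin_num_measure//.
    by rewrite -!EFinM -EFinD -mulrDl subrK mul1r.
  have mcost : measurable_fun setT (fun z : Rd * Rd => (enorm (z.1 - z.2) ^+ 2)%:E).
    by apply/measurable_EFinP; apply: measurable_funX; exact: measurable_cost.
  have c0 (z : Rd * Rd) : (0 <= (enorm (z.1 - z.2) ^+ 2)%:E)%E by rewrite lee_fin sqr_ge0.
  apply: (W2_le_coupling n0 (mixture_coupling cpi1 cpi2 mumu hrho hpi)).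
  have pi10 : (\int[pi1]_z (enorm (z.1 - z.2) ^+ 2)%:E = 0)%E.
    by rewrite pi1E//; apply: integral0_eq => z _ /=; rewrite subrr enorm0 expr0n.
  rewrite (integral_mixture_ge0 h01 hpi mcost c0) pi10 mule0 add0e.
  rewrite (integral_image_ge0 mq hpi2)//=.
  have -> : (\int[xi]_x (enorm (x.1 - (x.1 + x.2)) ^+ 2)%:E = (n ^+ 2)%:E)%E.
    rewrite n2 /Rintegral fineK; last exact: integrable_fin_num i2.
    by apply: eq_integral => z _; rewrite opprD addrA subrr add0r enormN.
  by rewrite -EFinM lee_fin ler_piMl ?sqr_ge0// ltW.
have := hdel rho (le_lt_trans W2rho nd).
pose a z := enorm (dmu F rho z - dmu F mu z).
have ma : measurable_fun setT a.
  by apply: measurable_enorm; apply: measurable_rVB; exact: measurable_dmu.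
have a0 z : 0 <= a z := enorm_ge0 _.
have aB z : a z ^+ 2 <= (2 * (d%:R * L)) ^+ 2.
  rewrite ler_sqr ?nnegrE ?enorm_ge0 ?mulr_ge0//.
  apply: le_trans (ler_enormB _ _) _.
  by rewrite (mulr_natl _ 2) mulr2n lerD ?dmu_bounded.
have ia : xi.-integrable setT (EFin \o (fun z => a z.1 ^+ 2)).
  apply: (plan_integrable (a := (2 * (d%:R * L)) ^+ 2) (b := 0) (c := 0) hxi).
    by apply: measurable_funX; exact: measurableT_comp.
  by move=> z; rewrite !mul0r !addr0 ger0_norm ?sqr_ge0.
have ima : \int[mu]_x (a x ^+ 2) = \int[xi]_z (a z.1 ^+ 2).
  by rewrite (Rintegral_image mfst hmu)//; exact: measurable_funX.
rewrite -/(a _) ima => ha.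
pose D := flat_derivative F rho.
have Dq x y : `|D (x + y) - D x - dot (dmu F rho x) y| <= K * enorm y ^+ 2.
  by apply: taylor_bound; [exact: partially_C2_differentiable
    |exact: partially_C2_dmu_differentiable|exact: hC].
have mD : measurable_fun setT D by have [] := partially_C2_flat rho.
have mdD := measurable_dmu mu.
have mdot : measurable_fun setT (fun z : Rd * Rd => dot (dmu F mu z.1) z.2).
  by apply: measurable_dot => //; exact: measurableT_comp.
have idot : xi.-integrable setT (EFin \o (fun z : Rd * Rd => dot (dmu F mu z.1) z.2)).
  apply: (plan_integrable (a := (d%:R * L) ^+ 2) (b := 0) (c := 1) hxi mdot) => z.
  have h2 := dot_le_sqr (dmu F mu z.1) z.2.
  have : enorm (dmu F mu z.1) ^+ 2 <= (d%:R * L) ^+ 2.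
    by rewrite ler_sqr ?nnegrE ?enorm_ge0 ?mulr_ge0 ?dmu_bounded.
  have := normr_ge0 (dot (dmu F mu z.1) z.2).
  rewrite mul0r addr0 mul1r; lra.
have iDnu : xi.-integrable setT (EFin \o (fun z : Rd * Rd => D (z.1 + z.2))).
  by apply/(integrable_image madd hnu mD); exact: flat_derivative_integrable (partially_C2_flat rho).
have iDmu : xi.-integrable setT (EFin \o (fun z : Rd * Rd => D z.1)).
  by apply/(integrable_image mfst hmu mD); exact: flat_derivative_integrable (partially_C2_flat rho).
rewrite (Rintegral_image madd hnu mD iDnu) (Rintegral_image mfst hmu mD iDmu).
rewrite -RintegralB//.
have iDD : xi.-integrable setT (EFin \o (fun z : Rd * Rd => D (z.1 + z.2) - D z.1)).
  by have := integrableB measurableT iDnu iDmu; exact: eq_integrable.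
rewrite -RintegralB//.
have iG : xi.-integrable setT (EFin \o
    (fun z : Rd * Rd => D (z.1 + z.2) - D z.1 - dot (dmu F mu z.1) z.2)).
  by have := integrableB measurableT iDD idot; exact: eq_integrable.
(* The inequality of means divides by [t], and [n] may vanish; hence [t > n], after which [t] tends
   to [n]. *)
have bound (t : R) : n < t ->
    `|\int[xi]_z (D (z.1 + z.2) - D z.1 - dot (dmu F mu z.1) z.2)| <= (K * n + e / 2) * t.
  move=> nt; have t0 : 0 < t by exact: le_lt_trans nt.
  have pw z : `|D (z.1 + z.2) - D z.1 - dot (dmu F mu z.1) z.2| <=
      (K + e / (4 * t)) * enorm z.2 ^+ 2 + t / e * a z.1 ^+ 2.
    have h2 := Dq z.1 z.2.
    have h3 : `|dot (dmu F rho z.1) z.2 - dot (dmu F mu z.1) z.2| <= a z.1 * enorm z.2.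
      by rewrite -dotBl; exact: dot_le_enorm.
    (* AM-GM: [a |y| <= (t / e) a^2 + (e / 4t) |y|^2] *)
    have h4 : a z.1 * enorm z.2 <= e / (4 * t) * enorm z.2 ^+ 2 + t / e * a z.1 ^+ 2.
      have := sqr_ge0 (e * enorm z.2 - 2 * t * a z.1).
      have et : 0 < 4 * t * e by rewrite !mulr_gt0.
      move=> h5; rewrite -subr_ge0 -(pmulr_rge0 _ et); move: h5; congr (0 <= _).
      by field; rewrite !gt_eqF.
    rewrite mulrDl -[leRHS]addrA; exact: dist_triangle h2 (le_trans h3 h4).
  apply: le_trans (le_normr_Rintegral measurableT iG) _.
  have iy : xi.-integrable setT (EFin \o (fun z : Rd * Rd => (K + e / (4 * t)) * enorm z.2 ^+ 2)).
    by have := integrableZl measurableT (K + e / (4 * t)) i2; exact: eq_integrable.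
  have iat : xi.-integrable setT (EFin \o (fun z : Rd * Rd => t / e * a z.1 ^+ 2)).
    by have := integrableZl measurableT (t / e) ia; exact: eq_integrable.
  have iya := integrableD measurableT iy iat.
  apply: (@le_trans _ _ (\int[xi]_z ((K + e / (4 * t)) * enorm z.2 ^+ 2 + t / e * a z.1 ^+ 2))).
    apply: le_Rintegral.
    - exact: measurableT.
    - by have := integrable_abse iG; apply: eq_integrable.
    - by apply: eq_integrable iya.
    - by move=> z _; exact: pw.
  rewrite RintegralD// RintegralZl// RintegralZl// -n2.
  have nt2 : n ^+ 2 <= n * t by rewrite expr2 ler_wpM2l// ltW.
  have h5 : e / (4 * t) * n ^+ 2 <= e / 4 * t.
    have -> : e / 4 * t = e / (4 * t) * t ^+ 2 by field; rewrite gt_eqF.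
    rewrite ler_wpM2l ?divr_ge0 ?mulr_ge0// ?ltW//.
    by rewrite ltr_sqr ?nnegrE// ltW.
  have h6 : t / e * \int[xi]_z (a z.1 ^+ 2) <= e / 4 * t.
    have -> : e / 4 * t = t / e * (e / 2) ^+ 2 by field; rewrite gt_eqF.
    by rewrite ler_wpM2l// divr_ge0// ltW.
  have h7 : K * n ^+ 2 <= K * (n * t) by rewrite ler_wpM2l.
  rewrite mulrDl (mulrDl (K * n)) -mulrA; lra.
have KnE : K * n + e / 2 <= e.
  have : K * n <= e / 2.
    have h8 : (K + 1) * n <= (K + 1) * (e / (2 * (K + 1))) by rewrite ler_wpM2l ?addr_ge0// ltW.
    have h9 : (K + 1) * (e / (2 * (K + 1))) = e / 2 by field; rewrite gt_eqF// ltr_wpDl.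
    by move: h8; rewrite h9 mulrDl mul1r; lra.
  by lra.
apply: (@le_trans _ _ ((K * n + e / 2) * n)); last by rewrite ler_wpM2r.
have Kn0 : 0 < K * n + e / 2 by rewrite ltr_wpDl ?mulr_ge0// divr_gt0.
rewrite -ler_pdivrMl//; apply/ler_addgt0Pr => s s0.
rewrite ler_pdivrMl//; apply: bound; by rewrite ltrDl.
Qed.

End plan_calculus.

(** * Tangency of gradient plans *)

Section subgradient_graph.
Context {R : realType} {d : nat}.
Local Notation Rd := 'rV[R]_d.
Variables (psi : Rd -> R) (T : Rd -> Rd) (C : R).
Hypothesis psi_cont : continuous psi.
Hypothesis psi_growth : forall x, `|psi x| <= C * (1 + enorm x ^+ 2).
Hypothesis mT : measurable_fun setT T.
Hypothesis T_growth : forall x, enorm (T x) ^+ 2 <= C * (1 + enorm x ^+ 2).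
Hypothesis psi_convex : forall x y,
  psi x + dot (T x) (y - x) + 1 / 4 * enorm (y - x) ^+ 2 <= psi y.

Let C0 : 0 <= C.
Proof.
have := le_trans (normr_ge0 _) (psi_growth 0).
by rewrite enorm0 expr0n addr0 mulr1.
Qed.

Let r (n : nat) : Rd := map_mx ratr (odflt (0 : 'rV[rat]_d) (unpickle n)).

Let conj_term (n : nat) (y : Rd) : R := dot (r n) y - psi (r n).

(** Strong convexity at [0] makes the conjugate finite: the right side minus the left side is at
    least the square [|y - T 0 - x / 2|^2]. *)
Let dot_psi_ub x y : dot x y - psi x <= enorm (y - T 0) ^+ 2 - psi 0.
Proof.
have := psi_convex 0 x; rewrite subr0 => h.
have h2 := sqr_ge0 (enorm (y - T 0 - (1 / 2) *: x)).
have h3 : enorm (y - T 0 - (1 / 2) *: x) ^+ 2 =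
    enorm (y - T 0) ^+ 2 - dot x y + dot (T 0) x + 1 / 4 * enorm x ^+ 2.
  rewrite enorm_sqrD dotNr dotZr dotBl enormN enormZ exprMn (dotC x y).
  by rewrite ger0_norm ?divr_ge0//; field.
move: h h2; rewrite h3; move: (psi 0) (psi x) (dot x y) (dot (T 0) x).
by move: (enorm (y - T 0) ^+ 2) (enorm x ^+ 2) => a b c e f g; lra.
Qed.

(* The supremum ranges over rational vectors only, to be measurable. *)
Definition conjugate (y : Rd) : R := sup (range (fun n => conj_term n y)).

Let has_sup_conj y : has_sup (range (fun n => conj_term n y)).
Proof.
split; first by exists (conj_term 0 y), 0%N.
by exists (enorm (y - T 0) ^+ 2 - psi 0) => _ [n _ <-]; exact: dot_psi_ub.
Qed.

Lemma conjugate_le y b : (forall x, dot x y - psi x <= b) -> conjugate y <= b.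
Proof.
move=> h; apply: ge_sup; first by case: (has_sup_conj y).
by move=> _ [n _ <-]; exact: h.
Qed.

(** Continuity of [psi] and density of rational vectors recover the supremum over all vectors. *)
Lemma le_conjugate x y : dot x y - psi x <= conjugate y.
Proof.
apply/ler_addgt0Pr => e e0.
have cf : continuous (fun x => dot x y - psi x).
  move=> z; apply: (@continuousB _ _ _ (fun x => dot x y) psi); last exact: psi_cont.
  apply: (@continuous_lipschitz _ _ (fun x => dot x y) (enorm y)) => a b.
  by rewrite -dotBl mulrC; exact: dot_le_enorm.
have /cvgrPdist_lt /(_ _ e0) /nbhs_ballP [s /= s0 hs] := cf x.
have [k ks] : exists k, k.+1%:R^-1 < s.
  by have [k _ /(_ k (leqnn k)) h] := near_infty_natSinv_lt (PosNum s0); exists k.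
have /choice[q qx] : forall j, exists q : rat, `|ratr q - x 0 j| < s.
  move=> j; have /rat_in_itvoo[q] : x 0 j - s < x 0 j + s by lra.
  by rewrite in_itv/= => h; exists q; rewrite ltr_distl.
have := hs (r (pickle (\row_j q j))).
have -> : r (pickle (\row_j q j)) = map_mx ratr (\row_j q j) by rewrite /r pickleK.
move=> h; have {}h := h _.
have : `|dot x y - psi x - (dot (map_mx ratr (\row_j q j)) y -
    psi (map_mx ratr (\row_j q j) : Rd))| < e.
  by apply: h; apply/mx_ballP => // j; rewrite !mxE distrC.
rewrite ltr_norml => /andP[_ h2].
have : conj_term (pickle (\row_j q j)) y <= conjugate y.
  by apply: sup_upper_bound (has_sup_conj y) _ _; exists (pickle (\row_j q j)).
by rewrite /conj_term /r pickleK /=; lra.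
Qed.

Lemma conjugate_eq x : conjugate (T x) = dot x (T x) - psi x.
Proof.
apply/eqP; rewrite eq_le le_conjugate andbT; apply: conjugate_le => z.
have := psi_convex x z; have := sqr_ge0 (enorm (z - x)).
by rewrite dotBr (dotC (T x) z) (dotC (T x) x); lra.
Qed.

Lemma measurable_conjugate : measurable_fun setT conjugate.
Proof.
have mt n : measurable_fun setT (conj_term n).
  apply: measurable_funB => //; exact: measurable_dot.
rewrite (_ : conjugate = (fun y => sups (conj_term ^~ y) 0)).
  apply: measurable_fun_sups => // y _.
  by case: (has_sup_conj y).
by apply/funext => y; rewrite /conjugate /sups /sdrop; congr sup; apply/seteqP; split=> ? [n _ <-]; exists n.
Qed.

Lemma conjugate_growth : exists b, forall y, `|conjugate y| <= b * (1 + enorm y ^+ 2).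
Proof.
exists (2 * (1 + enorm (T 0) ^+ 2) + C) => y.
have hpsi : `|psi 0| <= C by have := psi_growth 0; rewrite enorm0 expr0n addr0 mulr1.
have h1 := le_conjugate 0 y.
have h2 : conjugate y <= enorm (y - T 0) ^+ 2 - psi 0.
  by apply: conjugate_le => x; exact: dot_psi_ub.
have h3 := enorm_sqrB_le y (T 0).
have hy := sqr_ge0 (enorm y); have ht := sqr_ge0 (enorm (T 0)).
move: hpsi h1 h2 h3; rewrite dotC dot0r !ler_norml => /andP[p1 p2] h1 h2 h3.
move: (conjugate y) (psi 0) h1 h2 h3 p1 p2 hy ht C0.
move: (enorm (y - T 0) ^+ 2) (enorm y ^+ 2) (enorm (T 0) ^+ 2) => a b c e f.
by move=> *; apply/andP; split; nra.
Qed.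

(** Equality of marginals is given as a relation between set functions; a common probability measure
    is needed in order to integrate against it. *)
Lemma same_image d1 d2 (T1 : measurableType d1) (T2 : measurableType d2)
    (f : T1 -> T2) (P P' : probability T1 R) : measurable_fun setT f ->
  is_image f P (pushforward P' f) ->
  exists Q : probability T2 R, is_image f P Q /\ is_image f P' Q.
Proof.
move=> mf h; have [Q hQ] := image_exists mf P'.
by exists Q; split => // A mA; rewrite hQ// h.
Qed.

(** Kantorovich duality with the potentials [A = |x|^2 - 2 psi] and [B = |y|^2 - 2 psi*]. Fenchel's
    inequality gives [A x + B y <= |x - y|^2], with equality on the graph of [T], and the integral
    of [A + B] depends on the marginals only. *)
Lemma subgradient_graph_optimal (mu : P2 R d) (pi : probability (Rd * Rd)%type R) :
  is_image (fun x => (x, T x)) mu pi -> optimal_plan pi.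
Proof.
move=> hpi pi' h1 h2.
have mg : measurable_fun setT (fun x : Rd => (x, T x)) by exact: measurable_fun_pair.
have mfst : measurable_fun setT (fst : Rd * Rd -> Rd) by exact: measurable_fst.
have msnd : measurable_fun setT (snd : Rd * Rd -> Rd) by exact: measurable_snd.
have [Q1 [hQ1 hQ1']] := same_image mfst h1.
have [Q2 [hQ2 hQ2']] := same_image msnd h2.
have [b hb] := conjugate_growth.
pose A (x : Rd) : R := enorm x ^+ 2 - 2 * psi x.
pose B (y : Rd) : R := enorm y ^+ 2 - 2 * conjugate y.
have mpsi := continuous_measurable_rV psi_cont.
have mA : measurable_fun setT A.
  by apply: measurable_funB; [exact: measurable_enorm2|exact: measurable_funM].
have mB : measurable_fun setT B.
  apply: measurable_funB; first exact: measurable_enorm2.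
  by apply: measurable_funM => //; exact: measurable_conjugate.
have iA : mu.-integrable setT (EFin \o A).
  apply: (@P2_integrable _ _ mu A (2 * C) (1 + 2 * C)) => // x.
  apply: le_trans (ler_normB _ _) _; rewrite (normrM 2) (ger0_norm (sqr_ge0 _)) (ger0_norm (ler0n _ 2)).
  by have := psi_growth x; lra.
have iB : mu.-integrable setT (EFin \o (B \o T)).
  have b0 : 0 <= b.
    have := le_trans (normr_ge0 _) (hb 0).
    by rewrite enorm0 expr0n addr0 mulr1.
  apply: (@P2_integrable _ _ mu (B \o T) ((1 + 2 * b) * C + 2 * b) ((1 + 2 * b) * C)).
    exact: measurableT_comp.
  move=> x /=; apply: le_trans (ler_normB _ _) _; rewrite (normrM 2) (ger0_norm (sqr_ge0 _)) (ger0_norm (ler0n _ 2)).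
  have h3 := hb (T x); have h4 := T_growth x.
  have : (1 + 2 * b) * enorm (T x) ^+ 2 <= (1 + 2 * b) * (C * (1 + enorm x ^+ 2)).
    by rewrite ler_wpM2l// addr_ge0// mulr_ge0.
  by move: h3; move: (`|_|) (enorm (T x) ^+ 2) (enorm x ^+ 2) => u v w; lra.
have iA1 : pi.-integrable setT (EFin \o (A \o fst)).
  apply/(integrable_image mg hpi); first exact: measurableT_comp.
  exact: iA.
have iB1 : pi.-integrable setT (EFin \o (B \o snd)).
  apply/(integrable_image mg hpi); first exact: measurableT_comp.
  exact: iB.
have iAQ : Q1.-integrable setT (EFin \o A) by apply/(integrable_image mfst hQ1 mA).
have iBQ : Q2.-integrable setT (EFin \o B) by apply/(integrable_image msnd hQ2 mB).
have iA2 : pi'.-integrable setT (EFin \o (A \o fst)).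
  exact/(integrable_image mfst hQ1' mA).
have iB2 : pi'.-integrable setT (EFin \o (B \o snd)).
  exact/(integrable_image msnd hQ2' mB).
have mcost : measurable_fun setT (fun z : Rd * Rd => enorm (z.1 - z.2) ^+ 2).
  by apply: measurable_funX; exact: measurable_cost.
have costE (z : Rd * Rd) : A z.1 + B z.2 <= enorm (z.1 - z.2) ^+ 2.
  rewrite enorm_sqrD dotNr enormN /A /B.
  have := le_conjugate z.1 z.2.
  by move: (conjugate _) (psi _) (dot _ _) (enorm _ ^+ 2) => u v w t; lra.
have costT x : enorm (x - T x) ^+ 2 = A x + B (T x).
  rewrite enorm_sqrD dotNr enormN /A /B conjugate_eq; ring.
have -> : (\int[pi]_z (enorm (z.1 - z.2) ^+ 2)%:E =
    \int[pi]_z (A z.1 + B z.2)%:E)%E.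
  rewrite (integral_image_ge0 mg hpi); last 2 first.
  - exact/measurable_EFinP.
  - by move=> z; rewrite lee_fin sqr_ge0.
  have mAB : measurable_fun setT (fun z : Rd * Rd => (A z.1 + B z.2)%:E).
    by apply/measurable_EFinP; apply: measurable_funD; exact: measurableT_comp.
  have AB0 x : A x + B (T x) = enorm (x - T x) ^+ 2 by rewrite costT.
  have -> : (\int[pi]_z (A z.1 + B z.2)%:E = \int[mu]_x (A x + B (T x))%:E)%E.
    have iAB : mu.-integrable setT (EFin \o ((fun z => A z.1 + B z.2) \o (fun x => (x, T x)))).
      by have := integrableD measurableT iA iB; apply: eq_integrable.
    have iAB' : pi.-integrable setT (EFin \o (fun z => A z.1 + B z.2)).
      by have := integrableD measurableT iA1 iB1; apply: eq_integrable.
    rewrite -[LHS]fineK; last exact: integrable_fin_num iAB'.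
    rewrite -[RHS]fineK; last exact: integrable_fin_num iAB.
    congr EFin; apply: (Rintegral_image mg hpi (g := fun z => A z.1 + B z.2)) => //.
    by apply/measurable_EFinP.
  by apply: eq_integral => x _ /=; rewrite costT.
have iAB : pi.-integrable setT (EFin \o (fun z => A z.1 + B z.2)).
  by have := integrableD measurableT iA1 iB1; apply: eq_integrable.
have iAB' : pi'.-integrable setT (EFin \o (fun z => A z.1 + B z.2)).
  by have := integrableD measurableT iA2 iB2; apply: eq_integrable.
have -> : (\int[pi]_z (A z.1 + B z.2)%:E = \int[pi']_z (A z.1 + B z.2)%:E)%E.
  rewrite -[LHS]fineK; last exact: integrable_fin_num iAB.
  rewrite -[RHS]fineK; last exact: integrable_fin_num iAB'.
  congr EFin; transitivity (\int[pi]_z A z.1 + \int[pi]_z B z.2).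
    exact: (@RintegralD _ _ _ pi _ (A \o fst) (B \o snd)).
  transitivity (\int[pi']_z A z.1 + \int[pi']_z B z.2); last first.
    by apply/esym; exact: (@RintegralD _ _ _ pi' _ (A \o fst) (B \o snd)).
  rewrite -(Rintegral_image mfst hQ1 mA iA1) -(Rintegral_image msnd hQ2 mB iB1).
  by rewrite (Rintegral_image mfst hQ1' mA iA2) (Rintegral_image msnd hQ2' mB iB2).
(* An infinite cost leaves nothing to prove; a finite one is integrable, which the comparison with
   the signed function [A + B] uses. *)
have [cfin|cfin] := boolP (\int[pi']_z (enorm (z.1 - z.2) ^+ 2)%:E == +oo)%E.
  by rewrite (eqP cfin) leey.
apply: le_integral => //.
- apply/integrableP; split; first exact/measurable_EFinP.
  rewrite (_ : (\int[_]_x _ = \int[pi']_z (enorm (z.1 - z.2) ^+ 2)%:E)%E) ?ltey//.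
  by apply: eq_integral => z _ /=; rewrite ger0_norm ?sqr_ge0.
- by move=> z _; rewrite lee_fin; exact: costE.
Qed.

End subgradient_graph.

Section tangent_plans.
Context {R : realType} {d : nat}.
Local Notation Rd := 'rV[R]_d.
Implicit Types (mu nu : P2 R d) (gamma xi : probability (Rd * Rd)%type R).

Lemma graph_plan_at mu (q : Rd -> Rd) gamma (C : R) : measurable_fun setT q ->
  (forall x, enorm (q x) ^+ 2 <= C * (1 + enorm x ^+ 2)) ->
  is_image (fun x => (x, q x)) mu gamma -> plan_at mu gamma.
Proof.
move=> mq qC hg.
have mg : measurable_fun setT (fun x : Rd => (x, q x)) by exact: measurable_fun_pair.
split; last first.
  move=> A mA; rewrite /pushforward hg//.
  by rewrite -[X in measurable X]setTI; exact: measurable_fst.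
rewrite (integral_image_ge0 mg hg) /=; last 2 first.
- by apply/measurable_EFinP; apply: measurable_funD; exact: measurable_enorm2.
- by move=> z; rewrite lee_fin addr_ge0 ?sqr_ge0.
have : mu.-integrable setT (EFin \o (fun x => enorm x ^+ 2 + enorm (q x) ^+ 2)).
  apply: (@P2_integrable _ _ mu _ C (1 + C)).
    by apply: measurable_funD; exact: measurable_enorm2.
  move=> x; rewrite ger0_norm ?addr_ge0 ?sqr_ge0//.
  by have := qC x; lra.
move=> /integrableP[_]; apply: le_lt_trans; rewrite le_eqVlt; apply/orP; left.
by apply/eqP/eq_integral => x _ /=; rewrite ger0_norm// addr_ge0 ?sqr_ge0.
Qed.

(** Lets a plan serve as its own approximation in the closure that defines [TanK]. *)
Lemma Wmu_refl_le0 mu (q : Rd -> Rd) gamma : measurable_fun setT q ->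
  is_image (fun x => (x, q x)) mu gamma -> Wmu gamma gamma <= 0.
Proof.
move=> mq hg.
have mg : measurable_fun setT (fun x : Rd => (x, q x)) by exact: measurable_fun_pair.
have mt : measurable_fun setT (fun x : Rd => ((x, q x), q x)) by exact: measurable_fun_pair.
have [theta ht] := image_exists mt mu.
have gl : gluing gamma gamma theta.
  split=> A mA; rewrite (hg A mA) /pushforward ht//.
    by rewrite -[X in measurable X]setTI; exact: measurable_fst.
  have m2 : measurable_fun setT (fun w : Rd * Rd * Rd => (w.1.1, w.2)).
    apply: measurable_fun_pair => //.
    exact: (measurableT_comp measurable_fst measurable_fst).
  by rewrite -[X in measurable X]setTI; exact: m2.
rewrite /Wmu; set S := (X in ereal_inf X).
have S0 : (0 <= ereal_inf S)%E.
  apply: le_ereal_inf_tmp => _ [t _ <-]; apply: integral_ge0 => z _.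
  by rewrite lee_fin sqr_ge0.
suff -> : ereal_inf S = 0%E by rewrite /= sqrtr0.
apply/eqP; rewrite eq_le S0 andbT; apply: ereal_inf_lbound; exists theta => //.
rewrite (integral_image_ge0 mt ht) /=.
- by apply: integral0_eq => x _; rewrite subrr enorm0 expr0n.
- apply/measurable_EFinP; apply: measurable_enorm2; apply: measurable_rVB => //.
  exact: (measurableT_comp measurable_snd measurable_fst).
- by move=> z; rewrite lee_fin sqr_ge0.
Qed.

(* [x |-> x + eta q x] is the gradient of [|x| ^ 2 / 2 + eta f], which is convex
   for small [eta]. *)
Lemma quadratic_taylor_TanK mu (f : Rd -> R) (q : Rd -> Rd) (C K : R) gamma :
  continuous f -> (forall x, `|f x| <= C * (1 + enorm x ^+ 2)) ->
  measurable_fun setT q -> (forall x, enorm (q x) ^+ 2 <= C * (1 + enorm x ^+ 2)) ->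
  (forall x y, `|f (x + y) - f x - dot (q x) y| <= K * enorm y ^+ 2) ->
  is_image (fun x => (x, q x)) mu gamma -> TanK mu gamma.
Proof.
move=> cf fC mq qC fq hg.
have C0 : 0 <= C.
  by have := le_trans (normr_ge0 _) (fC 0); rewrite enorm0 expr0n addr0 mulr1.
have pg := graph_plan_at mq qC hg.
split=> // e e0; exists gamma; split => //; last first.
  exact: le_lt_trans (Wmu_refl_le0 mq hg) e0.
(* The remainder of [f] costs [eta K <= 1 / 4] of the modulus [1 / 2] of [|x|^2 / 2], which leaves
   the [1 / 4] required of [psi]. *)
pose eta := 1 / (4 * (`|K| + 1)).
have k0 : 0 < `|K| + 1 by rewrite ltr_wpDl.
have eta0 : 0 < eta by rewrite divr_gt0// mulr_gt0.
have etaK : eta * K <= 1 / 4.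
  rewrite /eta mulrAC ler_pdivrMr ?mulr_gt0// mul1r.
  by have := ler_norm K; lra.
exists eta => //.
pose T x := x + eta *: q x.
pose psi x := 1 / 2 * enorm x ^+ 2 + eta * f x.
have mT : measurable_fun setT T by apply: measurable_rVD => //; exact: measurable_rVZ.
have mgT : measurable_fun setT (fun x : Rd => (x, T x)) by exact: measurable_fun_pair.
have [pi hpi] := image_exists mgT mu; exists pi.
  move=> A mA; rewrite hpi// /pushforward hg//.
  have m2 : measurable_fun setT (fun z : Rd * Rd => (z.1, z.1 + eta *: z.2)).
    apply: measurable_fun_pair => //; apply: measurable_rVD => //.
    exact: measurable_rVZ.
  by rewrite -[X in measurable X]setTI; exact: m2.
pose B := 2 + eta * C + 2 * (eta ^+ 2 * C).
have eC0 : 0 <= eta * C by rewrite mulr_ge0// ltW.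
have e2C0 : 0 <= eta ^+ 2 * C by rewrite mulr_ge0// sqr_ge0.
apply: (@subgradient_graph_optimal _ _ psi T B) hpi => //.
- move=> x; apply: (@continuousD _ _ _ (fun x : Rd => 1 / 2 * enorm x ^+ 2) (fun x => eta * f x)).
    apply: (@continuous_comp _ _ _ (@enorm R d) (fun r => 1 / 2 * r ^+ 2)).
      exact: continuous_enorm.
    apply: (@continuous_comp _ _ _ (fun r : R => r ^+ 2) (fun r => 1 / 2 * r)).
      exact: exprn_continuous.
    exact: mulrl_continuous.
  apply: (@continuous_comp _ _ _ f (fun r => eta * r)); first exact: cf.
  exact: mulrl_continuous.
- move=> x; have x0 := sqr_ge0 (enorm x).
  have h1 : eta * `|f x| <= eta * (C * (1 + enorm x ^+ 2)) by rewrite ler_wpM2l// ltW.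
  apply: le_trans (ler_normD _ _) _.
  rewrite (normrM (1 / 2)) (normrM eta) (gtr0_norm eta0) ger0_norm ?divr_ge0// (ger0_norm x0).
  have h2 : 0 <= (eta ^+ 2 * C) * enorm x ^+ 2 by rewrite mulr_ge0.
  rewrite /B; move: h1 h2 x0 e2C0; rewrite (mulrA eta C).
  by move: (eta * C) (eta ^+ 2 * C) (eta * `|_|) (enorm x ^+ 2) => a b c t; lra.
- move=> x; have x0 := sqr_ge0 (enorm x); apply: le_trans (enorm_sqrD_le _ _) _.
  rewrite enormZ exprMn (gtr0_norm eta0).
  have h1 : eta ^+ 2 * enorm (q x) ^+ 2 <= eta ^+ 2 * (C * (1 + enorm x ^+ 2)).
    by rewrite ler_wpM2l ?sqr_ge0.
  have h2 : 0 <= (eta * C) * enorm x ^+ 2 by rewrite mulr_ge0.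
  rewrite /B; move: h1 h2 x0 eC0; rewrite (mulrA _ C).
  by move: (eta * C) (eta ^+ 2 * C) (eta ^+ 2 * enorm _ ^+ 2) (enorm x ^+ 2) => a b c t; lra.
- move=> x y; have := fq x (y - x); rewrite (addrC x) subrK => h.
  have hy : enorm y ^+ 2 = enorm x ^+ 2 + 2 * dot x (y - x) + enorm (y - x) ^+ 2.
    by rewrite -enorm_sqrD (addrC x) subrK.
  rewrite /psi hy /T dotDl dotZl.
  have v0 := sqr_ge0 (enorm (y - x)).
  have h1 : eta * (f x + dot (q x) (y - x) - K * enorm (y - x) ^+ 2) <= eta * f y.
    rewrite ler_wpM2l ?(ltW eta0)//; move: h; rewrite ler_norml => /andP[+ _]; lra.
  have h2 : eta * K * enorm (y - x) ^+ 2 <= 1 / 4 * enorm (y - x) ^+ 2.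
    by rewrite ler_wpM2r.
  move: h1 h2 v0; clear; move: (f x) (f y) (dot (q x) _) (enorm (y - x) ^+ 2).
  by move: (enorm x ^+ 2) (dot _ _) => a b u v w t; lra.
Qed.

End tangent_plans.

(** * Comparison *)

Section touching.
Context {R : realType} {d : nat}.
Local Notation Rd := 'rV[R]_d.
Implicit Types (mu nu : P2 R d) (gamma xi : probability (Rd * Rd)%type R)
  (theta : probability (Rd * Rd * Rd)%type R).

(** [gamma] does not charge the complement of the graph of [q], hence under [theta] the second
    component equals [q] of the first almost everywhere. *)
Lemma pairing_graph mu (q : Rd -> Rd) gamma xi theta : measurable_fun setT q ->
  is_image (fun x => (x, q x)) mu gamma -> gluing gamma xi theta ->
  pairing theta = \int[theta]_w dot (q w.1.1) w.2.
Proof.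
move=> mq hg [h1 h2].
have m11 : measurable_fun setT (fun w : Rd * Rd * Rd => w.1.1).
  exact: (measurableT_comp measurable_fst measurable_fst).
have m12 : measurable_fun setT (fun w : Rd * Rd * Rd => w.1.2).
  exact: (measurableT_comp measurable_snd measurable_fst).
have m2 : measurable_fun setT (fun w : Rd * Rd * Rd => w.2) by exact: measurable_snd.
have mf1 : measurable_fun setT (fst : Rd * Rd -> Rd) by exact: measurable_fst.
have mf2 : measurable_fun setT (snd : Rd * Rd -> Rd) by exact: measurable_snd.
congr fine; apply: ae_eq_integral => //.
- by apply/measurable_EFinP; exact: measurable_dot.
- by apply/measurable_EFinP; apply: measurable_dot => //; exact: measurableT_comp.
pose N := [set z : Rd * Rd | enorm (z.2 - q z.1) != 0].
have mN : measurable N.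
  have -> : N = (fun z : Rd * Rd => enorm (z.2 - q z.1)) @^-1` (~` [set 0]).
    by apply/seteqP; split => z /= /eqP.
  rewrite -[X in measurable X]setTI.
  have : measurable_fun setT (fun z : Rd * Rd => enorm (z.2 - q z.1)).
    by apply: measurable_enorm; apply: measurable_rVB => //; exact: measurableT_comp.
  by apply => //; apply: measurableC; exact: measurable_set1.
have N0 : gamma N = 0%E.
  rewrite hg// /pushforward (_ : _ @^-1` N = set0) ?measure0//.
  by apply/seteqP; split => // x; rewrite /N /= subrr enorm0 eqxx.
exists ((fun w : Rd * Rd * Rd => w.1) @^-1` N); split.
- rewrite -[X in measurable X]setTI.
  have mw1 : measurable_fun setT (fun w : Rd * Rd * Rd => w.1) by exact: measurable_fst.
  exact: mw1.
- by rewrite -N0 (h1 N mN).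
- move=> w /= hw; apply/negP => /eqP/eqP; rewrite enorm_eq0 subr_eq0 => /eqP E.
  by apply: hw => _; rewrite E.
Qed.

Variables (T : R) (U : R -> P2 R d -> R) (F : P2 R d -> R) (L : R).
Hypothesis L0 : 0 <= L.
Hypothesis FC2 : partially_C2 F.
Hypothesis FL : forall nu rho, `|F nu - F rho| <= L * W1 nu rho.

(** The gradient in [x] of [flat_derivative F mu x - del |x|^2], that is, the gradient at [mu] of
    [F - del M2]. *)
Definition penalized_velocity (del : R) mu x := dmu F mu x - (2 * del) *: x.

Lemma measurable_penalized_velocity del mu :
  measurable_fun setT (penalized_velocity del mu).
Proof.
apply: measurable_rVB; first exact: measurable_dmu FC2 _.
by apply: measurable_rVZ; exact: measurable_id.
Qed.

Lemma penalized_velocity_growth del mu : exists C : R, forall x,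
  enorm (penalized_velocity del mu x) ^+ 2 <= C * (1 + enorm x ^+ 2).
Proof.
exists (2 * (d%:R * L) ^+ 2 + 2 * (2 * del) ^+ 2) => x.
apply: le_trans (enorm_sqrB_le _ _) _; rewrite enormZ exprMn real_normK ?num_real//.
have : enorm (dmu F mu x) ^+ 2 <= (d%:R * L) ^+ 2.
  by rewrite ler_sqr ?nnegrE ?enorm_ge0 ?mulr_ge0 ?(dmu_bounded L0 FC2 FL).
have a0 := sqr_ge0 (d%:R * L); have b0 := sqr_ge0 (2 * del).
have x0 := sqr_ge0 (enorm x).
have ax := mulr_ge0 a0 x0; move: a0 b0 x0 ax.
move: ((d%:R * L) ^+ 2) ((2 * del) ^+ 2) (enorm x ^+ 2) (enorm _ ^+ 2) => a b t c.
by lra.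
Qed.

Lemma penalized_velocity_TanK del mu gamma : 0 <= del ->
  is_image (fun x => (x, penalized_velocity del mu x)) mu gamma -> TanK mu gamma.
Proof.
move=> del0 hg; pose D := flat_derivative F mu.
have [C qC] := penalized_velocity_growth del mu.
have [K K0 hK] := hessian_bound FC2.
have DL := partially_C2_lipschitz L0 FC2 FL mu.
have Dg := lipschitz_growth DL.
pose f x := D x - del * enorm x ^+ 2.
pose C' := `|C| + (`|D 0| + 2 * `|L|) + del.
apply: (@quadratic_taylor_TanK _ _ mu f (penalized_velocity del mu) C' (d%:R ^+ 2 * K + del)) => //.
- move=> x; apply: (@continuousB _ _ _ D (fun x : Rd => del * enorm x ^+ 2)).
    exact: (continuous_lipschitz DL).
  apply: (@continuous_comp _ _ _ (@enorm R d) (fun r => del * r ^+ 2)).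
    exact: continuous_enorm.
  apply: (@continuous_comp _ _ _ (fun r : R => r ^+ 2) (fun r => del * r)).
    exact: exprn_continuous.
  exact: mulrl_continuous.
- move=> x; apply: le_trans (ler_normB _ _) _.
  rewrite (normrM del) (ger0_norm del0) (ger0_norm (sqr_ge0 _)).
  have x0 := sqr_ge0 (enorm x).
  have h1 : 0 <= (`|C| + `|D 0| + `|L|) * enorm x ^+ 2 by rewrite mulr_ge0// !addr_ge0.
  have cx := mulr_ge0 (normr_ge0 C) x0.
  have dx := mulr_ge0 (normr_ge0 (D 0)) x0; have lx := mulr_ge0 (normr_ge0 L) x0.
  have := Dg x; rewrite -/D /C'; move: x0 h1 (normr_ge0 C) (normr_ge0 L) (normr_ge0 (D 0)) del0 cx.
  move: dx lx; clear.
  by move: (`|D x|) (`|D 0|) (`|C|) (`|L|) (enorm x ^+ 2) => a b c e t; lra.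
- exact: measurable_penalized_velocity.
- move=> x; apply: le_trans (qC x) _; rewrite ler_wpM2r ?addr_ge0 ?sqr_ge0//.
  apply: le_trans (ler_norm _) _; have h0 := normr_ge0 (D 0); have hL := normr_ge0 L.
  by rewrite /C'; lra.
- move=> x y.
  have := taylor_bound (partially_C2_differentiable FC2 mu)
    (partially_C2_dmu_differentiable FC2 mu) (hK mu) x y.
  rewrite -/D -/(dmu F mu) => h.
  have -> : f (x + y) - f x - dot (penalized_velocity del mu x) y =
      (D (x + y) - D x - dot (dmu F mu x) y) - del * enorm y ^+ 2.
    by rewrite /f /penalized_velocity enorm_sqrD dotBl dotZl; ring.
  apply: le_trans (ler_normB _ _) _; rewrite mulrDl.
  by rewrite (normrM del) (ger0_norm del0) (ger0_norm (sqr_ge0 _)) lerD2r.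
Qed.

(* The quadratic penalty in time and the second moment are differentiable with
   quadratic remainders, so the test function is differentiable jointly. *)
Lemma touching_subdiff (t0 s0 del kappa : R) mu gamma :
  0 <= del -> 0 <= kappa ->
  (forall s nu, 0 <= s <= T -> F nu - F mu - del * (M2 nu - M2 mu)
     - kappa * ((t0 - s) ^+ 2 - (t0 - s0) ^+ 2) <= U s nu - U s0 mu) ->
  is_image (fun x => (x, penalized_velocity del mu x)) mu gamma ->
  subdiff T (fun s nu => (U s nu)%:E) s0 mu (2 * kappa * (t0 - s0)) gamma.
Proof.
move=> del0 kappa0 hU hg; split => //; first exact: penalized_velocity_TanK hg.
move=> e e0.
have e2 : 0 < e / 2 by rewrite divr_gt0.
have [r r0 hr] := flat_taylor_plan L0 FC2 FL mu e2.
have d1 : 0 < del + 1 by rewrite ltr_wpDl.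
have k1 : 0 < kappa + 1 by rewrite ltr_wpDl.
(* One threshold for each error: the expansion of [F] and [del n^2] take [e / 2] times [n] each, and
   [kappa (s - s0)^2] takes [e |s - s0|]. *)
exists (Num.min r (Num.min (e / (2 * (del + 1))) (e / (kappa + 1)))).
  by rewrite !lt_min r0 !divr_gt0// mulr_gt0.
move=> s xi theta nu sT hxi hgl hnu; rewrite !lt_min => /and3P[h1 h2 h3].
rewrite -EFinB lee_fin; apply: le_trans (hU s nu sT).
have n0 := plan_norm_ge0 xi; have a0 := normr_ge0 (s - s0).
have {}hr : `|F nu - F mu - \int[xi]_z dot (dmu F mu z.1) z.2| <= e / 2 * plan_norm xi.
  by apply: hr => //; lra.
have mq := measurable_penalized_velocity del mu.
have [_ hgl2] := hgl.
have mproj : measurable_fun setT (fun w : Rd * Rd * Rd => (w.1.1, w.2)).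
  apply: measurable_fun_pair => //.
  exact: (measurableT_comp measurable_fst measurable_fst).
have mf1 : measurable_fun setT (fst : Rd * Rd -> Rd) by exact: measurable_fst.
have mf2 : measurable_fun setT (snd : Rd * Rd -> Rd) by exact: measurable_snd.
have md : measurable_fun setT (fun z : Rd * Rd => dot (dmu F mu z.1) z.2).
  by apply: measurable_dot => //; apply: measurableT_comp => //; exact: measurable_dmu FC2 _.
have mdot : measurable_fun setT (fun z : Rd * Rd => dot z.1 z.2) by exact: measurable_dot.
have id : xi.-integrable setT (EFin \o (fun z : Rd * Rd => dot (dmu F mu z.1) z.2)).
  apply: (plan_integrable (a := (d%:R * L) ^+ 2) (b := 0) (c := 1) hxi md) => z.
  have h4 := dot_le_sqr (dmu F mu z.1) z.2.
  have : enorm (dmu F mu z.1) ^+ 2 <= (d%:R * L) ^+ 2.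
    by rewrite ler_sqr ?nnegrE ?enorm_ge0 ?mulr_ge0 ?(dmu_bounded L0 FC2 FL).
  have := normr_ge0 (dot (dmu F mu z.1) z.2).
  rewrite mul0r addr0 mul1r; lra.
have idot : xi.-integrable setT (EFin \o (fun z : Rd * Rd => dot z.1 z.2)).
  apply: (plan_integrable (a := 0) (b := 1) (c := 1) hxi mdot) => z.
  have := dot_le_sqr z.1 z.2; have := normr_ge0 (dot z.1 z.2).
  have := sqr_ge0 (enorm z.1); have := sqr_ge0 (enorm z.2); lra.
have idot2 : xi.-integrable setT (EFin \o (fun z : Rd * Rd => (2 * del) * dot z.1 z.2)).
  by have := integrableZl measurableT (2 * del) idot; exact: eq_integrable.
have pE : pairing theta = \int[xi]_z dot (dmu F mu z.1) z.2 - 2 * del * \int[xi]_z dot z.1 z.2.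
  rewrite (pairing_graph mq hg hgl) -RintegralZl// -RintegralB//.
  have mq2 : measurable_fun setT (fun z : Rd * Rd => dot (penalized_velocity del mu z.1) z.2).
    by apply: measurable_dot => //; exact: measurableT_comp.
  have iq2 : xi.-integrable setT (EFin \o (fun z : Rd * Rd => dot (penalized_velocity del mu z.1) z.2)).
    have := integrableB measurableT id idot2; apply: eq_integrable => // z _ /=.
    by rewrite /penalized_velocity dotBl dotZl EFinB.
  transitivity (\int[xi]_z dot (penalized_velocity del mu z.1) z.2).
    apply/esym; apply: (Rintegral_image mproj hgl2 mq2).
    exact/(integrable_image mproj hgl2 mq2).
  by apply: eq_Rintegral => z _; rewrite /penalized_velocity dotBl dotZl.
have M2n := M2_exp hxi hnu.
rewrite pE; set n := plan_norm xi in n0 hr h1 h2 h3 M2n *.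
have hn : del * n ^+ 2 <= e / 2 * n.
  rewrite expr2 mulrA ler_wpM2r//.
  have : (del + 1) * n <= (del + 1) * (e / (2 * (del + 1))).
    by rewrite ler_wpM2l ?ltW//; lra.
  have -> : (del + 1) * (e / (2 * (del + 1))) = e / 2 by field; rewrite gt_eqF.
  by rewrite mulrDl mul1r; lra.
have hs : kappa * (s - s0) ^+ 2 <= e * `|s - s0|.
  rewrite -real_normK ?num_real// expr2 mulrA ler_wpM2r//.
  have : (kappa + 1) * `|s - s0| <= (kappa + 1) * (e / (kappa + 1)).
    by rewrite ler_wpM2l ?ltW//; lra.
  have -> : (kappa + 1) * (e / (kappa + 1)) = e by field; rewrite gt_eqF.
  by rewrite mulrDl mul1r; lra.
(* An exact expansion: the linear part is the time slope, and the square is absorbed by [hs]. *)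
have tE : (t0 - s) ^+ 2 - (t0 - s0) ^+ 2 = - 2 * (t0 - s0) * (s - s0) + (s - s0) ^+ 2.
  by ring.
rewrite tE M2n; move: hr hn hs; rewrite ler_norml => /andP[+ _].
clear; move: (F nu) (F mu) (\int[xi]_z dot (dmu F mu z.1) z.2) (\int[xi]_z dot z.1 z.2).
move: (M2 mu) (`|s - s0|) (n ^+ 2) ((s - s0) ^+ 2) => m a n2 s2 f1 f2 i1 i2.
lra.
Qed.

End touching.

(** * Weak continuity and existence of maximizers *)

Section weak_continuity.
Context {R : realType} {d : nat}.
Local Notation Rd := 'rV[R]_d.
Implicit Types (mu nu : P2 R d).

Lemma W1_ge0 mu nu : 0 <= W1 mu nu.
Proof.
apply: fine_ge0; apply: le_ereal_inf_tmp => _ [p _ <-].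
by apply: integral_ge0 => z _; rewrite lee_fin enorm_ge0.
Qed.

(** The increment of [F] is the integral against [mu_ k - mu] of some [L]-Lipschitz function, which
    depends on [k] and [F]. Quantifying [F] after [k] allows [F] to be a time slice at the varying
    time [t_ k]. *)
Lemma weak_cvg_uniform (L e : R) (mu_ : nat -> P2 R d) mu : 0 <= L -> 0 < e ->
  weak_cvg mu_ mu -> \forall k \near \oo, forall F, partially_C2 F ->
  (forall nu rho, `|F nu - F rho| <= L * W1 nu rho) -> `|F (mu_ k) - F mu| <= e.
Proof.
move=> L0 e0 hw; have := weak_cvg_lipschitz hw L0 e0.
apply: filterS => k hk F FC2 FL.
have [h [rho [_ _ ->]]] := flat_mvt mu (mu_ k) (partially_C2_flat FC2).
by apply: hk => x y; exact: partially_C2_lipschitz.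
Qed.

Lemma time_derivable_quotient (T : R) (U : R -> P2 R d -> R) (t : R) mu (e : R) :
  0 < e -> time_derivable T U t mu -> exists2 del : R, 0 < del &
  forall s, 0 <= s <= T -> s != t -> `|s - t| < del ->
    `|(U s mu - U t mu) / (s - t) - time_derivative T U t mu| < e.
Proof.
move=> e0; rewrite /time_derivable => hc.
have /cvgrPdist_lt /(_ _ e0) [del /= del0 hdel] :
    time_quotient U mu t s @[s --> within `[0, T]%classic t^'] --> time_derivative T U t mu.
  exact: hc.
exists del => // s sT st sd; rewrite distrC.
have sI : s \in `[0, T] by rewrite in_itv.
have ts : `|t - s| < del by rewrite distrC.
exact: (hdel s ts st sI).
Qed.

Lemma time_derivable_continuous (T : R) (U : R -> P2 R d -> R) (t : R) mu (e : R) :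
  0 < e -> time_derivable T U t mu -> exists2 del : R, 0 < del &
  forall s, 0 <= s <= T -> `|s - t| < del -> `|U s mu - U t mu| < e.
Proof.
move=> e0 /(time_derivable_quotient ltr01)[del del0 hdel].
set l := time_derivative T U t mu in hdel.
have k0 : 0 < `|l| + 1 by rewrite ltr_wpDl.
exists (Num.min del (e / (`|l| + 1))); first by rewrite lt_min del0 divr_gt0.
move=> s sT; rewrite lt_min => /andP[sd se].
have [->|st] := eqVneq s t; first by rewrite subrr normr0.
have s0 : 0 < `|s - t| by rewrite normr_gt0 subr_eq0.
have := hdel s sT st sd => hq.
have hb : `|(U s mu - U t mu) / (s - t)| <= `|l| + 1.
  have := ler_normD ((U s mu - U t mu) / (s - t) - l) l; rewrite subrK; lra.
rewrite -[X in `|X|](@divfK _ (s - t)) ?subr_eq0// normrM.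
apply: le_lt_trans (ler_wpM2r (ltW s0) hb) _.
by rewrite mulrC -ltr_pdivlMr.
Qed.

(** The measure is moved first, at time [t_ k], with an estimate uniform over slices; the time is
    then moved at the fixed limit measure, where derivability in time is enough. *)
Lemma weakly_continuous_classical (T L : R) (U : R -> P2 R d -> R) : 0 <= L ->
  (forall t, 0 <= t <= T -> partially_C2 (U t)) ->
  (forall t mu, 0 <= t <= T -> time_derivable T U t mu) ->
  (forall t mu nu, 0 <= t <= T -> `|U t mu - U t nu| <= L * W1 mu nu) ->
  weakly_continuous T U.
Proof.
move=> L0 UC2 Ut UL t_ mu_ t mu tT_ tT tcvg mucvg.
apply/cvgrPdist_lt => e e0.
have e2 : 0 < e / 2 by rewrite divr_gt0.
have [del del0 hdel] := time_derivable_continuous e2 (Ut t mu tT).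
have h1 := weak_cvg_uniform L0 e2 mucvg.
move/cvgrPdist_lt : tcvg => /(_ _ del0) h2.
apply: filterS (filterI h1 h2) => k [h3 h4].
have h5 : `|U (t_ k) (mu_ k) - U (t_ k) mu| <= e / 2.
  by apply: h3; [exact: UC2|move=> nu rho; exact: UL].
have h6 : `|U (t_ k) mu - U t mu| < e / 2 by apply: hdel; rewrite // distrC.
rewrite distrC [ltRHS]splitr.
apply: le_lt_trans (ler_distD (U (t_ k) mu) _ _) _.
exact: ler_ltD.
Qed.

End weak_continuity.

Section maximizers.
Context {R : realType} {d : nat}.
Implicit Types (mu nu : P2 R d).
Variables (T B del : R) (V U : R -> P2 R d -> R).
Hypothesis T0 : 0 <= T.
Hypothesis del0 : 0 < del.
Hypothesis Vcont : weakly_continuous T V.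
Hypothesis Ucont : weakly_continuous T U.
Hypothesis VUB : forall t s mu, 0 <= t <= T -> 0 <= s <= T -> V t mu - U s mu <= B.

Definition doubled (kappa t s : R) mu : R :=
  V t mu - U s mu - del * M2 mu - kappa * (t - s) ^+ 2.

Lemma time_interval_cvg (t_ : nat -> R) (t : R) :
  (forall k, 0 <= t_ k <= T) -> t_ k @[k --> \oo] --> t -> 0 <= t <= T.
Proof.
move=> h hc; apply/andP; split.
  by apply: (cvgr_to_ge hc); apply: nearW => k; case/andP: (h k).
by apply: (cvgr_to_le hc); apply: nearW => k; case/andP: (h k).
Qed.

Lemma weak_extraction (t_ s_ : nat -> R) (mu_ : nat -> P2 R d) (M : R) :
  (forall k, 0 <= t_ k <= T) -> (forall k, 0 <= s_ k <= T) ->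
  (forall k, M2 (mu_ k) <= M) ->
  exists mu (t s : R) (f : nat -> nat),
  [/\ forall k, (k <= f k)%N, 0 <= t <= T, 0 <= s <= T &
    forall e : R, 0 < e -> \forall k \near \oo,
    [/\ `|t_ (f k) - t| < e, `|s_ (f k) - s| < e,
        `|V (t_ (f k)) (mu_ (f k)) - V t mu| < e,
        `|U (s_ (f k)) (mu_ (f k)) - U s mu| < e & M2 mu - e < M2 (mu_ (f k))]].
Proof.
move=> tT sT muM.
have bT (u : R) : 0 <= u <= T -> `|u| <= T by move=> /andP[? ?]; rewrite ger0_norm.
have [mu [t [s [f [fk ft fs fmu fM]]]]] :=
  weak_compactness_P2 muM (fun k => bT _ (tT k)) (fun k => bT _ (sT k)).
have tI := time_interval_cvg (fun k => tT (f k)) ft.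
have sI := time_interval_cvg (fun k => sT (f k)) fs.
exists mu, t, s, f; split=> // e e0.
have hV := Vcont (fun k => tT (f k)) tI ft fmu.
have hU := Ucont (fun k => sT (f k)) sI fs fmu.
have hM : \forall k \near \oo, M2 mu - e < M2 (mu_ (f k)) by apply: fM; lra.
move/cvgrPdist_lt : ft => /(_ _ e0) h1; move/cvgrPdist_lt : fs => /(_ _ e0) h2.
move/cvgrPdist_lt : hV => /(_ _ e0) h3; move/cvgrPdist_lt : hU => /(_ _ e0) h4.
apply: filterS (filterI (filterI (filterI h1 h2) (filterI h3 h4)) hM).
by move=> k [[[k1 k2] [k3 k4]] k5]; split => //; rewrite distrC.
Qed.

(** The direct method: the penalty bounds second moments along a maximizing sequence, and [doubled]
    is upper semicontinuous along the extracted subsequence. *)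
Lemma maximizer_exists (kappa : R) : 0 <= kappa -> exists t0 s0 mu0,
  [/\ 0 <= t0 <= T, 0 <= s0 <= T & forall t s mu, 0 <= t <= T -> 0 <= s <= T ->
    doubled kappa t s mu <= doubled kappa t0 s0 mu0].
Proof.
move=> k0.
pose S := [set x : R | exists t s mu, [/\ 0 <= t <= T, 0 <= s <= T & x = doubled kappa t s mu]].
have dB t s mu : 0 <= t <= T -> 0 <= s <= T ->
    doubled kappa t s mu <= B - del * M2 mu.
  move=> tT sT; have := VUB mu tT sT; have := mulr_ge0 k0 (sqr_ge0 (t - s)).
  by rewrite /doubled; lra.
have hS : has_sup S.
  have [mu _] := P2_dirac_exists (0 : 'rV[R]_d).
  split; first by exists (doubled kappa 0 0 mu), 0, 0, mu; rewrite lexx T0.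
  exists B => _ [t [s [mu' [tT sT ->]]]]; apply: le_trans (dB _ _ _ tT sT) _.
  by rewrite gerBl mulr_ge0 ?M2_ge0// ltW.
have /choice[p pP] : forall k : nat, exists p : R * R * P2 R d,
    [/\ 0 <= p.1.1 <= T, 0 <= p.1.2 <= T &
        sup S - k.+1%:R^-1 < doubled kappa p.1.1 p.1.2 p.2].
  move=> k; have i0 : 0 < k.+1%:R^-1 :> R by rewrite invr_gt0.
  have [_ [t [s [mu [tT sT ->]]]] h] := sup_adherent i0 hS.
  by exists (t, s, mu).
(* The values exceed [sup S - 1] and are at most [B - del * M2]. *)
have pM k : M2 (p k).2 <= (B - sup S + 1) / del.
  rewrite ler_pdivlMr//; have [tT sT h] := pP k; have := dB _ _ (p k).2 tT sT.
  have : k.+1%:R^-1 <= 1 :> R by rewrite invf_le1// ler1n.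
  rewrite (mulrC (M2 _)); move: h; move: (k.+1%:R^-1) => z; lra.
have pt k : 0 <= (p k).1.1 <= T by case: (pP k).
have ps k : 0 <= (p k).1.2 <= T by case: (pP k).
have [mu [t [s [f [fk tI sI near]]]]] := weak_extraction pt ps pM.
exists t, s, mu; split => // t' s' mu' tT' sT'.
apply: (@le_trans _ _ (sup S)); first by apply: ub_le_sup; [case: hS|exists t', s', mu'].
apply/ler_addgt0Pr => e e0.
have kT : 0 <= kappa * (T + 1) by rewrite mulr_ge0// addr_ge0.
have T1 : 0 < 1 + del + 1 + 4 * kappa * (T + 1) by move: del0 kT; lra.
(* The factor collects the errors of [V], [M2], [U] and the time penalty, in total [e / 4]; the
   defect of the maximizing sequence is at most [e / 2]. *)
pose a := Num.min 1 (e / (4 * (1 + del + 1 + 4 * kappa * (T + 1)))).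
have a0 : 0 < a by rewrite lt_min ltr01 divr_gt0// mulr_gt0.
have a1 : a <= 1 by rewrite ge_min lexx.
have ae : a * (1 + del + 1 + 4 * kappa * (T + 1)) <= e / 4.
  rewrite -ler_pdivlMr//; apply: (@le_trans _ _ (e / (4 * (1 + del + 1 + 4 * kappa * (T + 1))))).
    by rewrite ge_min lexx orbT.
  by rewrite invfM mulrA.
have e2 : 0 < e / 2 by rewrite divr_gt0.
have [N _ hN] := near_infty_natSinv_lt (PosNum e2).
have [N2 _ hN2] := near a a0.
pose k := maxn N N2.
have [h1 h2 h3 h4 h5] := hN2 k (leq_maxr _ _).
have hk : (f k).+1%:R^-1 < e / 2.
  by apply: hN => /=; exact: leq_trans (leq_maxl _ _) (fk k).
have [_ _ hp] := pP (f k).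
(* [|t - s| <= T] and each time moves by less than [a], so the square drops by at most [4 T a]. A
   lower bound is enough, as the square is subtracted. *)
have hsq : (t - s) ^+ 2 - 4 * (T + 1) * a <= ((p (f k)).1.1 - (p (f k)).1.2) ^+ 2.
  move: h1 h2; rewrite !ltr_norml => /andP[h1 h1'] /andP[h2 h2'].
  move: tI sI => /andP[t00 t1] /andP[s00 s1].
  set u := (p (f k)).1.1 in h1 h1' *; set v := (p (f k)).1.2 in h2 h2' *.
  have -> : (u - v) ^+ 2 = (t - s) ^+ 2 + 2 * (t - s) * ((u - v) - (t - s))
      + ((u - v) - (t - s)) ^+ 2 by ring.
  have := sqr_ge0 ((u - v) - (t - s)).
  have : `|(t - s) * ((u - v) - (t - s))| <= T * (2 * a).
    have ts : `|t - s| <= T by rewrite ler_norml; apply/andP; split; lra.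
    have uv : `|u - v - (t - s)| <= 2 * a.
      move: h1 h1' h2 h2'; move: (u) (v) => u' v'; clear => *.
      by rewrite ler_norml; apply/andP; split; lra.
    by rewrite normrM; apply: ler_pM.
  rewrite ler_norml => /andP[+ _]; have := mulr_ge0 T0 (ltW a0); lra.
have hdelM : del * (M2 mu - a) <= del * M2 (p (f k)).2 by rewrite ler_wpM2l// ltW.
have hksq := ler_wpM2l k0 hsq.
move: hp h3 h4; rewrite /doubled !ltr_norml => hp /andP[_ h3] /andP[h4 _].
move: hp hk h3 h4 hdelM hksq ae; move: ((f k).+1%:R^-1) => z.
move: ((t - s) ^+ 2) (((p (f k)).1.1 - (p (f k)).1.2) ^+ 2) (M2 mu) (M2 _) => a1' a2 m1 m2.
move: (V _ _) (V _ _) (U _ _) (U _ _) (sup S) => v1 v2 u1 u2 S0.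
by move: e0; clear; lra.
Qed.

Variables (sigma t1 : R) (mu1 : P2 R d).
Hypothesis sigma0 : 0 < sigma.
Hypothesis t1T : 0 <= t1 <= T.
Hypothesis start : sigma <= V t1 mu1 - U t1 mu1 - del * M2 mu1.
Hypothesis terminal : forall mu, V T mu = U T mu.

(** Take a maximizer for every penalty [k + 1]. Its value stays above [sigma], which forces the two
    times together. If one of them were always [T], both would tend to [T], where [V = U], and weak
    continuity would bring the value below [sigma]. *)
Lemma interior_maximizer_exists : exists kappa t0 s0 mu0,
  [/\ 0 <= kappa, 0 <= t0 < T, 0 <= s0 < T, del * M2 mu0 <= B &
    forall t s mu, 0 <= t <= T -> 0 <= s <= T ->
    doubled kappa t s mu <= doubled kappa t0 s0 mu0].
Proof.
have /choice[p pP] : forall k : nat, exists p : R * R * P2 R d,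
    [/\ 0 <= p.1.1 <= T, 0 <= p.1.2 <= T & forall t s mu, 0 <= t <= T -> 0 <= s <= T ->
      doubled k.+1%:R t s mu <= doubled k.+1%:R p.1.1 p.1.2 p.2].
  move=> k; have [t0 [s0 [mu0 h]]] := @maximizer_exists k.+1%:R (ler0n _ _).
  by exists (t0, s0, mu0).
have pt k : 0 <= (p k).1.1 <= T by case: (pP k).
have ps k : 0 <= (p k).1.2 <= T by case: (pP k).
(* The competitor [(t1, t1, mu1)] pays no time penalty, so this bound does not depend on [k]. *)
have low k : sigma <= doubled k.+1%:R (p k).1.1 (p k).1.2 (p k).2.
  have [_ _ h] := pP k; apply: le_trans (h t1 t1 mu1 t1T t1T).
  by rewrite /doubled subrr expr0n mulr0 subr0.
have pB k : del * M2 (p k).2 <= B.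
  have := low k; have := VUB (p k).2 (pt k) (ps k).
  have := mulr_ge0 (ler0n R k.+1) (sqr_ge0 ((p k).1.1 - (p k).1.2)).
  by move: sigma0; rewrite /doubled; lra.
have pgap k : k.+1%:R * ((p k).1.1 - (p k).1.2) ^+ 2 <= B.
  have := low k; have := VUB (p k).2 (pt k) (ps k).
  have := mulr_ge0 (ltW del0) (M2_ge0 (p k).2).
  by move: sigma0; rewrite /doubled; lra.
have pM k : M2 (p k).2 <= B / del by rewrite ler_pdivlMr// mulrC.
apply: contrapT => nh.
have edge k : (p k).1.1 = T \/ (p k).1.2 = T.
  apply: contrapT => /not_orP[/eqP n1 /eqP n2]; apply: nh.
  exists k.+1%:R, (p k).1.1, (p k).1.2, (p k).2; split => //; last by case: (pP k).
    by rewrite lt_neqAle n1; exact: pt.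
  by rewrite lt_neqAle n2; exact: ps.
have [mu [t [s [f [fk tI sI near]]]]] := weak_extraction pt ps pM.
have B0 : 0 < B.
  have := VUB mu1 t1T t1T; have := mulr_ge0 (ltW del0) (M2_ge0 mu1).
  by move: start sigma0; lra.
have gap0 (e : R) : 0 < e -> exists N, forall k, (N <= k)%N ->
    `|(p (f k)).1.1 - (p (f k)).1.2| < e.
  move=> e0; have q0 : 0 < e ^+ 2 / B by rewrite divr_gt0// exprn_gt0.
  have [N _ hN] := near_infty_natSinv_lt (PosNum q0).
  exists N => k Nk; have := hN (f k) (leq_trans Nk (fk k)); rewrite /= => h.
  have k1 : 0 < (f k).+1%:R :> R by [].
  rewrite -ltr_sqr ?nnegrE ?(ltW e0)// real_normK ?num_real//.
  apply: (@le_lt_trans _ _ (B * (f k).+1%:R^-1)).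
    by rewrite ler_pdivlMr// mulrC.
  by rewrite mulrC -ltr_pdivlMr.
have close (e : R) : 0 < e -> exists k, [/\ `|(p (f k)).1.1 - t| < e, `|(p (f k)).1.2 - s| < e,
     `|(p (f k)).1.1 - (p (f k)).1.2| < e,
     `|V (p (f k)).1.1 (p (f k)).2 - V t mu| < e & `|U (p (f k)).1.2 (p (f k)).2 - U s mu| < e].
  move=> e0; have [N1 hN1] := gap0 e e0; have [N2 _ hN2] := near e e0.
  exists (maxn N1 N2); have [? ? ? ? _] := hN2 (maxn N1 N2) (leq_maxr _ _).
  by split=> //; apply: hN1; exact: leq_maxl.
have tT : t = T.
  apply/eqP; rewrite eq_le; case/andP: (tI) => _ -> /=; apply/ler_addgt0Pr => e e0.
  have e2 : 0 < e / 2 by rewrite divr_gt0.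
  have [k [h1 _ h3 _ _]] := close _ e2.
  move: h1 h3; rewrite !ltr_norml => /andP[? ?] /andP[? ?].
  by case: (edge (f k)) => E; lra.
have sT : s = T.
  apply/eqP; rewrite eq_le; case/andP: (sI) => _ -> /=; apply/ler_addgt0Pr => e e0.
  have e2 : 0 < e / 2 by rewrite divr_gt0.
  have [k [_ h2 h3 _ _]] := close _ e2.
  move: h2 h3; rewrite !ltr_norml => /andP[? ?] /andP[? ?].
  by case: (edge (f k)) => E; lra.
(* [V] and [U] are each within [sigma / 4] of their common terminal value, so the maximum falls
   below [sigma / 2]. *)
have s4 : 0 < sigma / 4 by rewrite divr_gt0.
have [k [_ _ _ h4 h5]] := close _ s4.
move: h4 h5; rewrite tT sT terminal !ltr_norml => /andP[? ?] /andP[? ?].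
have := low (f k); have := mulr_ge0 (ltW del0) (M2_ge0 (p (f k)).2).
have := mulr_ge0 (ler0n R (f k).+1) (sqr_ge0 ((p (f k)).1.1 - (p (f k)).1.2)).
by move: sigma0; rewrite /doubled; lra.
Qed.

End maximizers.

Section comparison.
Context {R : realType} {d : nat}.
Local Notation Rd := 'rV[R]_d.
Implicit Types (mu nu : P2 R d).

Lemma W2_continuous_slice (f : Rd * Rd -> P2 R d -> R) mu :
  W2_continuous (f : _ -> _ -> R^o) -> continuous (f ^~ mu).
Proof.
move=> fc z; apply/cvgrPdist_lt => e e0.
have [del del0 hdel] := fc z mu e e0.
have h y : `|y - z| < del -> `|f z mu - f y mu| < e.
  by move=> yz; rewrite distrC; apply: hdel => //; exact: le_lt_trans (W2_refl_le0 mu) del0.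
exists (ball z.1 del, ball z.2 del) => /=; first by split; exact: nbhsx_ballx.
move=> [y1 y2] /= [h1 h2]; apply: (h (y1, y2)); rewrite distrC.
have : ball z del (y1, y2) by split.
by rewrite -ball_normE.
Qed.

Lemma laplacian_integral_le (F : P2 R d -> R) mu (C : R) : partially_C2 F ->
  (forall x, laplacian (flat_derivative F mu) x <= C) ->
  \int[mu]_x (\tr ('J (dmu F mu) x)) <= C.
Proof.
move=> FC2 hC; have [K K0 hK] := hessian_bound FC2.
pose l x := laplacian (flat_derivative F mu) x.
have trB (A : 'M[R]_d) : `|\tr A| <= d%:R * `|A|.
  apply: le_trans (ler_norm_sum _ _ _) _.
  apply: (@le_trans _ _ (\sum_(i < d) `|A|)); first by apply: ler_sum => i _; exact: mx_entry_le_norm.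
  by rewrite sumr_const card_ord mulr_natl.
have cl : continuous l.
  move=> x A /nbhs_ballP[e /= e0 eA].
  have d1 : 0 < d%:R + 1 :> R by rewrite ltr_wpDl.
  case: FC2 => _ _ hc _; have [del del0 hdel] := hc x mu _ (divr_gt0 e0 d1).
  apply/nbhs_ballP; exists del => //= y; rewrite -ball_normE /= => xy.
  apply: eA; rewrite -ball_normE /= distrC /l /laplacian -raddfB /=.
  apply: le_lt_trans (trB _) _.
  have W0 : W2 mu mu < del := le_lt_trans (W2_refl_le0 mu) del0.
  have yx : `|y - x| < del by rewrite distrC.
  have h := hdel y mu yx W0.
  apply: (@le_lt_trans _ _ (d%:R * (e / (d%:R + 1)))).
    by apply: ler_wpM2l; [exact: ler0n|exact: ltW h].
  by rewrite mulrA ltr_pdivrMr// mulrC ltr_pM2l// ltrDl.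
have il : mu.-integrable setT (EFin \o l).
  apply: (@bounded_integrable_prob _ _ _ mu l (d%:R * K)).
    exact: continuous_measurable_rV.
  by move=> x; apply: le_trans (trB _) _; rewrite ler_wpM2l.
rewrite -[leRHS](Rintegral_prob_cst mu C); apply: le_Rintegral => //.
- exact: integrable_prob_cst.
- by move=> x _; exact: hC.
Qed.

Variables (T eps : R) (H : Rd -> Rd -> P2 R d -> R) (G : P2 R d -> R).
Variables (Ueps U : R -> P2 R d -> R).
Hypothesis T_gt0 : 0 < T.
Hypothesis eps_gt0 : 0 < eps.
Hypothesis HG_data : data_assumptions H G.
Hypothesis Ueps_bounded : bounded_on T Ueps.
Hypothesis U_bounded : bounded_on T U.
Hypothesis U_super : HJ0_supersolution T H U.
Hypothesis terminal : forall mu, Ueps T mu = U T mu.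
Hypothesis Ueps_lip : unif_lipschitz T W1 Ueps.
Hypothesis U_cont : weakly_continuous T U.
Hypothesis Ueps_classical : HJeps_classical_subsolution T eps H Ueps.

Lemma hamiltonian_integrable mu (q : Rd -> Rd) (C : R) : measurable_fun setT q ->
  (forall x, enorm (q x) ^+ 2 <= C * (1 + enorm x ^+ 2)) ->
  mu.-integrable setT (EFin \o (fun x => H x (q x) mu)).
Proof.
move=> mq qC; have [Hc _ [K K0 hK] _ _] := HG_data.
apply: (@P2_integrable _ _ mu _ (K * (1 + C + M2 mu)) (K * (1 + C))).
  apply: (@measurable_continuous2 R _ Rd d d id q (fun z => H z.1 z.2 mu)) => //.
  exact: (@W2_continuous_slice (fun z nu => H z.1 z.2 nu) mu Hc).
move=> x; apply: le_trans (hK _ _ _) _.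
rewrite -mulrA -mulrDr; apply: ler_wpM2l; [exact: ltW|have := qC x; lra].
Qed.

(** The local Lipschitz constant of [H] grows linearly in the velocity, so the error at [x] is a
    constant times [(1 + 2 P + 2 del |x|) (2 del |x|)], and the bound on [del M2] controls its
    integral. *)
Lemma penalty_error : exists2 K : R, 0 < K &
  forall mu (p : Rd -> Rd) (P eta B : R), 0 <= P -> measurable_fun setT p ->
  (forall x, enorm (p x) <= P) -> 0 <= eta <= 1 -> eta ^+ 2 * M2 mu <= B ->
  \int[mu]_x H x (p x - (2 * eta ^+ 2) *: x) mu - \int[mu]_x H x (p x) mu <=
  eta * (K * (1 + 2 * P) * (1 + B) + 4 * K * B).
Proof.
have [_ [K K0 hK] _ _ _] := HG_data; exists K => //.
move=> mu p P eta B P0 mp pP /andP[eta0 eta1] hB.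
set del := eta ^+ 2 in hB *.
have del0 : 0 <= del by exact: sqr_ge0.
pose q x := p x - (2 * del) *: x.
have mq : measurable_fun setT q.
  by apply: measurable_rVB => //; apply: measurable_rVZ; exact: measurable_id.
have p2 x : enorm (p x) ^+ 2 <= P ^+ 2 by rewrite ler_sqr ?nnegrE ?enorm_ge0.
have ip : mu.-integrable setT (EFin \o (fun x => H x (p x) mu)).
  apply: (@hamiltonian_integrable mu p (P ^+ 2)) => // x.
  by apply: le_trans (p2 x) _; rewrite mulrDr mulr1 lerDl mulr_ge0 ?sqr_ge0.
have iq : mu.-integrable setT (EFin \o (fun x => H x (q x) mu)).
  apply: (@hamiltonian_integrable mu q (2 * P ^+ 2 + 2 * (2 * del) ^+ 2)) => // x.
  apply: le_trans (enorm_sqrB_le _ _) _; rewrite enormZ exprMn real_normK ?num_real//.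
  have x0 := sqr_ge0 (enorm x).
  have h1 := mulr_ge0 (sqr_ge0 P) x0; have h2 := sqr_ge0 (2 * del).
  move: (p2 x) h1 h2.
  by move: (P ^+ 2) ((2 * del) ^+ 2) (enorm (p x) ^+ 2) (enorm x ^+ 2) => a b c t; lra.
have KP0 : 0 <= K * (1 + 2 * P) by rewrite mulr_ge0 ?(ltW K0)// addr_ge0// mulr_ge0.
pose a := eta * (K * (1 + 2 * P)).
pose b := eta * (K * (1 + 2 * P) + 4 * K) * del.
have pw x : H x (q x) mu - H x (p x) mu <= a + b * enorm x ^+ 2.
  apply: le_trans (ler_norm _) _; apply: le_trans (hK _ _ _ _ _ _) _.
  have qp : q x - p x = - ((2 * del) *: x) by rewrite /q addrAC subrr add0r.
  rewrite qp subrr enorm0 addr0 enormN enormZ (ger0_norm (mulr_ge0 (ler0n _ 2) del0)) /q.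
  have h1 : enorm (p x - (2 * del) *: x) <= P + 2 * del * enorm x.
    apply: le_trans (ler_enormB _ _) _; rewrite enormZ.
    by rewrite (ger0_norm (mulr_ge0 (ler0n _ 2) del0)) lerD2r.
  have e0 := enorm_ge0 x.
  have dx0 : 0 <= 2 * del * enorm x by rewrite !mulr_ge0.
  have h2 : K * (1 + enorm (p x - (2 * del) *: x) + enorm (p x)) <=
      K * (1 + 2 * P + 2 * del * enorm x).
    by rewrite ler_wpM2l ?(ltW K0)//; have := pP x; lra.
  have h2' : 0 <= K * (1 + enorm (p x - (2 * del) *: x) + enorm (p x)).
    by rewrite mulr_ge0 ?(ltW K0)// !addr_ge0// enorm_ge0.
  have W0 := W2_refl_le0 mu.
  apply: (@le_trans _ _ (K * (1 + 2 * P + 2 * del * enorm x) * (2 * del * enorm x))).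
    apply: (@le_trans _ _ (K * (1 + enorm (p x - (2 * del) *: x) + enorm (p x)) * (2 * del * enorm x))).
      by rewrite ler_wpM2l// gerDr.
    by rewrite ler_wpM2r.
  (* In this variable [2 del |x| = 2 eta s] and the integral of [s^2] is at most [B]: one factor
     [eta] is left over. The quadratic part carries [eta^2 <= eta]. *)
  pose s := eta * enorm x.
  have s0 : 0 <= s by rewrite mulr_ge0.
  have dxE : 2 * del * enorm x = eta * (2 * s) by rewrite /s /del; ring.
  have s2E : del * enorm x ^+ 2 = s ^+ 2 by rewrite /s /del exprMn.
  have bE : b * enorm x ^+ 2 = eta * (K * (1 + 2 * P) + 4 * K) * s ^+ 2.
    by rewrite -s2E /b; ring.
  rewrite bE dxE /a.
  have h3 : 2 * s <= 1 + s ^+ 2 by have := sqr_ge0 (s - 1); lra.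
  have h4 : eta * (K * (1 + 2 * P)) * (2 * s) <= eta * (K * (1 + 2 * P)) * (1 + s ^+ 2).
    by rewrite ler_wpM2l// mulr_ge0.
  have h5 : eta * eta * (4 * K * s ^+ 2) <= eta * (4 * K * s ^+ 2).
    by rewrite ler_wpM2r ?ler_piMl// !mulr_ge0 ?sqr_ge0// ltW.
  by move: h4 h5; lra.
have iD : mu.-integrable setT (EFin \o (fun x => H x (q x) mu - H x (p x) mu)).
  by have := integrableB measurableT iq ip; exact: eq_integrable.
rewrite -RintegralB//.
apply: (@le_trans _ _ (a + b * M2 mu)).
  by rewrite -Rintegral_quad; apply: le_Rintegral => //; exact: P2_integrable_quad.
have : eta * (K * (1 + 2 * P) + 4 * K) * (del * M2 mu) <=
    eta * (K * (1 + 2 * P) + 4 * K) * B.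
  by rewrite ler_wpM2l// mulr_ge0// addr_ge0// mulr_ge0// ltW.
by rewrite /a /b; move: (M2 mu) => m; lra.
Qed.

(** Forward quotients decide, and [t < T] leaves room for them, at [t = 0] included. *)
Lemma time_derivative_le (t l c : R) mu : 0 <= t < T ->
  (forall s, t < s -> s <= T -> Ueps s mu - Ueps t mu <= l * (s - t) + c * (s - t) ^+ 2) ->
  time_derivative T Ueps t mu <= l.
Proof.
move=> /andP[t0 tT] hl; have tI : 0 <= t <= T by rewrite t0 ltW.
case: Ueps_classical => _ Ut _; apply/ler_addgt0Pr => e e0.
have e2 : 0 < e / 2 by rewrite divr_gt0.
have [del del0 hdel] := time_derivable_quotient e2 (Ut t mu tI).
have c1 : 0 < `|c| + 1 by rewrite ltr_wpDl.
pose h := Num.min (T - t) (Num.min del (e / (2 * (`|c| + 1)))) / 2.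
have m0 : 0 < Num.min (T - t) (Num.min del (e / (2 * (`|c| + 1)))).
  by rewrite !lt_min subr_gt0 tT del0 divr_gt0// mulr_gt0.
have h0 : 0 < h by rewrite divr_gt0.
have : h < Num.min (T - t) (Num.min del (e / (2 * (`|c| + 1)))) by rewrite /h; lra.
rewrite !lt_min => /and3P[hT hd he].
have sT : 0 <= t + h <= T by apply/andP; split; lra.
have := hdel (t + h) sT; rewrite (addrC t) addrK gtr0_norm// gt_eqF ?ltrDr//.
move=> /(_ isT hd); rewrite ltr_norml => /andP[h1 _].
have := hl (t + h); rewrite ltrDl h0 (addrC t) addrK => /(_ isT).
rewrite addrC in sT; have := sT => /andP[_ ->] /(_ isT) h2.
have h3 : (Ueps (h + t) mu - Ueps t mu) / h <= l + c * h.
  by rewrite ler_pdivrMr// mulrDl -mulrA -expr2.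
have h4 : c * h <= e / 2.
  apply: (@le_trans _ _ ((`|c| + 1) * h)); first by rewrite ler_wpM2r ?ltW//; have := ler_norm c; lra.
  have -> : e / 2 = (`|c| + 1) * (e / (2 * (`|c| + 1))) by field; rewrite gt_eqF.
  by rewrite ler_wpM2l ?ltW.
move: h1 h3 h4; move: (_ / h) (c * h) (time_derivative _ _ _ _) => a b f; lra.
Qed.

Lemma comparison_upper_bound (C : R) :
  (forall (t : R) mu x, 0 <= t <= T -> laplacian (flat_derivative (Ueps t) mu) x <= C) ->
  forall (t : R) mu, 0 <= t <= T -> Ueps t mu - U t mu <= C * (T - t) * eps.
Proof.
move=> hC t1 mu1 t1T; rewrite leNgt; apply/negP => gap.
have [UC2 Ut Usub] := Ueps_classical.
have [L' hL'] := Ueps_lip; pose L := `|L'|.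
have L0 : 0 <= L by exact: normr_ge0.
have UL t mu nu : 0 <= t <= T -> `|Ueps t mu - Ueps t nu| <= L * W1 mu nu.
  move=> tT; apply: le_trans (hL' t mu nu tT) _.
  by rewrite ler_wpM2r ?W1_ge0// ler_norm.
have [B1 hB1] := Ueps_bounded; have [B2 hB2] := U_bounded.
(* Half of the gap spread over the time span: [lam (T - t1)] consumes at most half of it, hence
   [sigma > 0]. *)
pose lam := (Ueps t1 mu1 - U t1 mu1 - C * (T - t1) * eps) / (2 * T).
have lam0 : 0 < lam by rewrite divr_gt0 ?mulr_gt0// subr_gt0.
pose c := C * eps + lam.
pose V t mu := Ueps t mu - c * (T - t).
pose sigma := V t1 mu1 - U t1 mu1.
have sigma0 : 0 < sigma.
  have : lam * (T - t1) <= lam * T by rewrite ler_wpM2l ?(ltW lam0)//; case/andP: t1T; lra.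
  have lE : 2 * (lam * T) = Ueps t1 mu1 - U t1 mu1 - C * (T - t1) * eps.
    by rewrite /lam; field; rewrite gt_eqF.
  have : 0 < lam * T by rewrite mulr_gt0.
  by move: lE; rewrite /sigma /V /c; lra.
pose B := B1 + B2 + `|c| * T.
have VUB t s mu : 0 <= t <= T -> 0 <= s <= T -> V t mu - U s mu <= B.
  move=> tT sT; have := hB1 t mu tT; have := hB2 s mu sT.
  rewrite !ler_norml => /andP[h1 h2] /andP[h3 h4].
  have : - (c * (T - t)) <= `|c| * T.
    apply: le_trans (ler_norm _) _; rewrite normrN normrM ler_wpM2l//.
    by case/andP: tT => ? ?; rewrite ger0_norm; lra.
  by rewrite /V /B; lra.
have B0 : 0 < B by apply: lt_le_trans sigma0 _; exact: VUB.
have Vcont : weakly_continuous T V.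
  move=> t_ mu_ t mu tT_ tT tcvg mucvg; apply: cvgB.
    by apply: (weakly_continuous_classical L0 UC2 Ut UL).
  by apply: cvgM; [exact: cvg_cst|apply: cvgB; [exact: cvg_cst|exact: tcvg]].
have [K K0 hK] := penalty_error.
pose P := d%:R * L.
have P0 : 0 <= P by rewrite mulr_ge0.
pose E := K * (1 + 2 * P) * (1 + B) + 4 * K * B.
have E0 : 0 < E.
  by rewrite addr_gt0// !mulr_gt0// ltr_pwDl// ?mulr_ge0// ltW.
(* Respectively: [eta^2 <= eta]; an error [eta E] at most [lam / 2]; a penalty at [mu1] of at most
   [sigma / 2], so that the starting value stays positive. *)
pose eta := Num.min 1 (Num.min (lam / (2 * E)) (sigma / (2 * (1 + M2 mu1)))).
have M10 : 0 < 1 + M2 mu1 by rewrite ltr_pwDl// M2_ge0.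
have lamE0 : 0 < lam / (2 * E) by rewrite divr_gt0// mulr_gt0.
have sigM0 : 0 < sigma / (2 * (1 + M2 mu1)) by rewrite divr_gt0// mulr_gt0.
have eta0 : 0 < eta by rewrite !lt_min ltr01 lamE0.
have eta1 : eta <= 1 by rewrite ge_min lexx.
have etaE : eta * E < lam.
  apply: (@le_lt_trans _ _ (lam / (2 * E) * E)).
    by rewrite ler_wpM2r ?(ltW E0)// !ge_min lexx orbT.
  have -> : lam / (2 * E) * E = lam / 2 by field; rewrite gt_eqF.
  by lra.
have etaM : eta ^+ 2 * M2 mu1 <= sigma / 2.
  apply: (@le_trans _ _ (eta * (1 + M2 mu1))).
    apply: ler_pM; rewrite ?sqr_ge0 ?M2_ge0//; last lra.
    by rewrite expr2 ler_piMl// ltW.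
  apply: (@le_trans _ _ (sigma / (2 * (1 + M2 mu1)) * (1 + M2 mu1))).
    by rewrite ler_wpM2r ?(ltW M10)// !ge_min lexx !orbT.
  by have -> : sigma / (2 * (1 + M2 mu1)) * (1 + M2 mu1) = sigma / 2 by field; rewrite gt_eqF.
have del0 : 0 < eta ^+ 2 by rewrite exprn_gt0.
have s20 : 0 < sigma / 2 by rewrite divr_gt0.
have start : sigma / 2 <= V t1 mu1 - U t1 mu1 - eta ^+ 2 * M2 mu1.
  by rewrite -/sigma; lra.
have VT mu : V T mu = U T mu by rewrite /V subrr mulr0 subr0 terminal.
have [kappa [t0 [s0 [mu0 [kappa0 t0T s0T M0B hmax]]]]] :=
  interior_maximizer_exists (ltW T_gt0) del0 Vcont U_cont VUB s20 t1T start VT.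
have t0I : 0 <= t0 <= T by case/andP: t0T => -> /ltW.
have s0I : 0 <= s0 <= T by case/andP: s0T => -> /ltW.
have FC2 := UC2 t0 t0I.
have FL nu rho := UL t0 nu rho t0I.
set F := Ueps t0 in FC2 FL.
pose q := penalized_velocity F (eta ^+ 2) mu0.
have mq : measurable_fun setT q := measurable_penalized_velocity FC2 _ _.
have mgq : measurable_fun setT (fun x : Rd => (x, q x)) by exact: measurable_fun_pair.
have [gamma hg] := image_exists mgq mu0.
have touch : subdiff T (fun s nu => (U s nu)%:E) s0 mu0 (2 * kappa * (t0 - s0)) gamma.
  apply: (touching_subdiff L0 FC2 FL (ltW del0) kappa0 _ hg) => s nu sT.
  have := hmax t0 s nu t0I sT; rewrite /doubled /V -/F.
  by move: (M2 _) (M2 _) (F _) (F _) (U _ _) (U _ _) => m1 m2 f1 f2 u1 u2; lra.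
have super := U_super s0T touch.
have [Cq hCq] := penalized_velocity_growth L0 FC2 FL (eta ^+ 2) mu0.
have iHq := hamiltonian_integrable mu0 mq hCq.
have gH : \int[gamma]_z H z.1 z.2 mu0 = \int[mu0]_x H x (q x) mu0.
  have [Hc _ _ _ _] := HG_data.
  apply: (Rintegral_image mgq hg (g := fun z => H z.1 z.2 mu0)) => //.
  apply: (@measurable_continuous2 R _ (Rd * Rd)%type d d fst snd (fun z => H z.1 z.2 mu0)).
  - exact: measurable_fst.
  - exact: measurable_snd.
  - exact: (@W2_continuous_slice (fun z nu => H z.1 z.2 nu) mu0 Hc).
(* The first-order condition in the first time variable; the shift adds [c] to the slope of [V]. *)
have dt : time_derivative T Ueps t0 mu0 <= 2 * kappa * (t0 - s0) - c.
  apply: (@time_derivative_le t0 _ kappa) => // s ts sT.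
  have sI : 0 <= s <= T by case/andP: t0T => ? _; apply/andP; split; lra.
  have := hmax s s0 mu0 sI s0I; rewrite /doubled /V.
  by move: (M2 _) (Ueps _ _) (Ueps _ _) (U _ _) => m1 f1 f2 u1; lra.
have sub := Usub t0 mu0 t0T.
have lap := @laplacian_integral_le F mu0 C FC2 (fun x => hC t0 mu0 x t0I).
have lap2 : eps * \int[mu0]_x (\tr ('J (dmu F mu0) x)) <= eps * C.
  by rewrite ler_wpM2l// ltW.
have err := hK mu0 (dmu F mu0) P eta B P0 (measurable_dmu FC2 mu0)
  (dmu_bounded L0 FC2 FL mu0).
have {}err : \int[mu0]_x H x (q x) mu0 - \int[mu0]_x H x (dmu F mu0 x) mu0 <= eta * E.
  by apply: err => //; rewrite (ltW eta0).
rewrite gH in super; rewrite -/F in sub.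
(* With [r = 2 kappa (t0 - s0)], the supersolution gives [r <= int H(q)], the subsolution
   [int H(dmu) <= r - c + C eps = r - lam], and the two integrals differ by at most [eta E < lam]: a
   contradiction. *)
move: super sub dt lap2 err etaE; rewrite /c.
move: (\int[mu0]_x H x (q x) mu0) (\int[mu0]_x H x (dmu F mu0 x) mu0).
move: (time_derivative _ _ _ _) (eps * \int[mu0]_x _) (eta * E) (2 * kappa * _).
by move=> a b e r h1 h2; lra.
Qed.

End comparison.

(** * Geodesic concavity *)

Section geodesic_concavity.
Context {R : realType} {d : nat}.
Local Notation Rd := 'rV[R]_d.
Implicit Types (mu nu : P2 R d) (x y v : Rd).

Lemma measurable_enorm_ball (x : Rd) (r : R) :
  measurable [set y : Rd | enorm (y - x) < r].
Proof.
apply: open_measurable_rV.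
rewrite (_ : [set y | _] = (fun y => enorm (y - x)) @^-1` [set s | s < r])//.
apply: open_comp; last exact: open_lt.
move=> y _; apply: (@continuous_lipschitz _ _ (fun y => enorm (y - x)) 1) => a b.
by rewrite mul1r (le_trans (ler_enorm_dist _ _))// opprB addrA subrK.
Qed.

Lemma measurable_rV_set1 (x : Rd) : measurable [set x].
Proof.
have -> : [set x] = (fun y => enorm (y - x)) @^-1` [set 0].
  apply/seteqP; split => [y ->|y /= /eqP] /=; first by rewrite subrr enorm0.
  by rewrite enorm_eq0 subr_eq0 => /eqP.
rewrite -[X in measurable X]setTI.
have : measurable_fun setT (fun y : Rd => enorm (y - x)).
  by apply: measurable_enorm; exact: measurable_rVB.
by apply => //; exact: measurable_set1.
Qed.

(* Only the atom at [a] moves: the rest of the mass stays at distance at least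
   [|a - b|] from it, so every plan pays at least [|a - b|] for that atom. *)
Lemma W2_moving_atom mu (x a b : Rd) (r m : R) (da db mua mub : P2 R d) :
  mu [set y | enorm (y - x) < r] = 0%E -> 0 <= m <= 1 ->
  enorm (a - x) + enorm (a - b) <= r ->
  P2prob da = (\d_a : probability Rd R) -> P2prob db = (\d_b : probability Rd R) ->
  is_mixture m mu da mua -> is_mixture m mu db mub ->
  W2 mua mub = Num.sqrt m * enorm (a - b).
Proof.
move=> mu0 m01 abr daE dbE hmua hmub; have /andP[m0 m1] := m01.
have mcost : measurable_fun setT (fun z : Rd * Rd => (enorm (z.1 - z.2) ^+ 2)%:E).
  by apply/measurable_EFinP; apply: measurable_funX; exact: measurable_cost.
have c0 (z : Rd * Rd) : (0 <= (enorm (z.1 - z.2) ^+ 2)%:E)%E by rewrite lee_fin sqr_ge0.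
have sE : (Num.sqrt m * enorm (a - b)) ^+ 2 = m * enorm (a - b) ^+ 2.
  by rewrite exprMn sqr_sqrtr.
have s0 : 0 <= Num.sqrt m * enorm (a - b) by rewrite mulr_ge0 ?sqrtr_ge0 ?enorm_ge0.
pose S := [set (\int[pi]_z (enorm (z.1 - z.2) ^+ 2)%:E)%E
    | pi in [set pi : probability (Rd * Rd)%type R | coupling mua mub pi]].
have upper : (ereal_inf S <= (m * enorm (a - b) ^+ 2)%:E)%E.
  have [pi1 [cpi1 pi1E]] := diagonal_coupling mu.
  have [pi hpi] := mixture_exists pi1 (\d_(a, b) : probability _ R) m01.
  have cab : coupling da db (\d_(a, b) : probability (Rd * Rd)%type R).
    by rewrite /coupling daE dbE; split=> A mA.
  apply: ereal_inf_lbound; exists pi.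
    exact: (mixture_coupling cpi1 cab hmua hmub hpi).
  have pi10 : (\int[pi1]_z (enorm (z.1 - z.2) ^+ 2)%:E = 0)%E.
    by rewrite pi1E//; apply: integral0_eq => z _ /=; rewrite subrr enorm0 expr0n.
  rewrite (integral_mixture_ge0 m01 hpi mcost c0) pi10 mule0 add0e.
  by rewrite integral_dirac// diracT mul1e -EFinM.
have lower : ((m * enorm (a - b) ^+ 2)%:E <= ereal_inf S)%E.
  apply: le_ereal_inf_tmp => _ [pi [hpi1 hpi2] <-].
  (* [mub] does not charge [N], as its only mass near [x] is the atom at [b]. Hence almost all mass
     leaving [a] ends at [b] or outside the ball. *)
  pose N := [set y : Rd | enorm (y - x) < r] `&` ~` [set b].
  have mN : measurable N.
    apply: measurableI; first exact: measurable_enorm_ball.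
    by apply: measurableC; exact: measurable_rV_set1.
  pose A := (fst @^-1` [set a] : set (Rd * Rd)).
  pose A2 := (snd @^-1` N : set (Rd * Rd)).
  have mA : measurable A.
    rewrite -[X in measurable X]setTI; apply: measurable_fst => //.
    exact: measurable_rV_set1.
  have mA2 : measurable A2.
    by rewrite -[X in measurable X]setTI; exact: measurable_snd.
  have piA : (m%:E <= pi A)%E.
    rewrite -[pi A](hpi1 _ (measurable_rV_set1 a)) (hmua _ (measurable_rV_set1 a)).
    rewrite daE [X in (_ <= _ + _ * X)%E]diracE mem_set// mule1.
    by apply: leeDr; rewrite mule_ge0// lee_fin subr_ge0.
  have piA2 : pi A2 = 0%E.
    rewrite -[pi A2](hpi2 _ mN) (hmub _ mN) dbE [X in (_ + _ * X)%E]diracE.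
    rewrite memNset; last by case=> _; apply.
    rewrite mule0 adde0 (_ : mu N = 0%E) ?mule0//.
    apply/eqP; rewrite eq_le measure_ge0 andbT -mu0 le_measure// ?inE//.
      exact: measurable_enorm_ball.
    exact: subIsetl.
  have piD : (m%:E <= pi (A `\` A2))%E.
    apply: le_trans piA _.
    have -> : pi (A `\` A2) = (pi (A `\` A2) + pi A2)%E by rewrite piA2 adde0.
    apply: le_trans (measureU2 _ (measurableD mA mA2) mA2).
    rewrite le_measure// ?inE//.
      by apply: measurableU => //; exact: measurableD.
    by move=> z Az; have [z2|z2] := pselect (A2 z); [right|left].
  apply: (@le_trans _ _ ((enorm (a - b) ^+ 2)%:E * pi (A `\` A2))%E).
    by rewrite mulrC EFinM lee_wpmul2l// lee_fin sqr_ge0.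
  rewrite -integral_cst; last exact: measurableD.
  apply: (@le_trans _ _ (\int[pi]_(z in A `\` A2) (enorm (z.1 - z.2) ^+ 2)%:E)%E).
    apply: ge0_le_integral => //.
    - exact: measurableD.
    - by move=> z _; rewrite lee_fin sqr_ge0.
    - exact: measurable_funTS.
    - move=> z [Az nz]; rewrite lee_fin ler_sqr ?nnegrE ?enorm_ge0//.
      have za : z.1 = a := Az; rewrite za.
      have [->//|zb] := eqVneq z.2 b.
      have : r <= enorm (z.2 - x).
        rewrite leNgt; apply/negP => h; apply: nz; split=> //=.
        by apply/eqP.
      have := ler_enormD (z.2 - a) (a - x); rewrite addrA subrK (enormB z.2 a).
      by move: abr; lra.
  by apply: ge0_subset_integral => //; exact: measurableD.
have inf : ereal_inf S = (m * enorm (a - b) ^+ 2)%:E.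
  by apply/eqP; rewrite eq_le upper lower.
by rewrite /W2 -/S inf /= -sE sqrtr_sqr ger0_norm.
Qed.

(** The squared distance [m (2 s)^2] of the endpoints is linear in [m], like the increments of [F],
    which makes the division meaningful. At the midpoint the term [Lam / 8 * (2 s)^2], doubled, is
    [Lam s^2]. *)
Lemma second_difference_le (F : P2 R d -> R) (Lam : R) mu (D : Rd -> R) (x v : Rd)
    (r s : R) : geodesically_concave Lam F -> is_flat_derivative F mu D ->
  mu [set y | enorm (y - x) < r] = 0%E -> enorm v = 1 -> 0 < s -> 3 * s <= r ->
  D (x + s *: v) + D (x - s *: v) - 2 * D x <= Lam * s ^+ 2.
Proof.
move=> Fconc [mD _ Dq D0] mu0 v1 s0 sr.
pose y (t : R) : Rd := x + ((2 * t - 1) * s) *: v.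
have /choice[dl dlE] : forall t : R, exists rho : P2 R d,
    P2prob rho = (\d_(y t) : probability Rd R) by move=> t; exact: P2_dirac_exists.
have Idl t : \int[dl t]_z D z = D (y t).
  rewrite dlE /Rintegral integral_dirac//; last exact/measurable_EFinP.
  by rewrite diracT mul1e.
have y0 : y 0 = x - s *: v by rewrite /y mulr0 sub0r mulN1r scaleNr.
have y1 : y 1 = x + s *: v by rewrite /y (_ : (2 * 1 - 1) * s = s)//; ring.
have yh : y (1 / 2) = x by rewrite /y (_ : (2 * (1 / 2) - 1) * s = 0) ?scale0r ?addr0//; field.
have ydist t u : enorm (y t - y u) = 2 * s * `|t - u|.
  rewrite /y opprD addrACA subrr add0r -scalerBl enormZ v1 mulr1.
  rewrite (_ : _ - _ = 2 * s * (t - u)); last ring.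
  by rewrite normrM ger0_norm// mulr_ge0// ltW.
have yx t : 0 <= t <= 1 -> enorm (y t - x) <= s.
  move=> /andP[t0 t1]; rewrite -yh ydist.
  have : `|t - 1 / 2| <= 1 / 2 by rewrite ler_norml; apply/andP; split; lra.
  move=> /(ler_wpM2l (ltW s0)); move: (`|_|) => z; lra.
apply/ler_addgt0Pr => e e0.
(* The middle quotient enters twice, so the errors add up to [4 (e / 4)]. *)
have e4 : 0 < e / 4 by rewrite divr_gt0.
have [d0 d00 h0] := Dq (dl 0) _ e4; have [d1 d10 h1] := Dq (dl 1) _ e4.
have [dh dh0 hh] := Dq (dl (1 / 2)) _ e4.
pose m := Num.min 1 (Num.min d0 (Num.min d1 dh)) / 2.
have m00 : 0 < Num.min 1 (Num.min d0 (Num.min d1 dh)) by rewrite !lt_min ltr01 d00 d10.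
have m0 : 0 < m by rewrite divr_gt0.
have : m < Num.min 1 (Num.min d0 (Num.min d1 dh)) by rewrite /m; lra.
rewrite !lt_min => /and4P[m1 md0 md1 mdh].
have m01 : 0 <= m <= 1 by rewrite !ltW.
have /choice[p pE] : forall t : R, exists rho : P2 R d, is_mixture m mu (dl t) rho.
  by move=> t; exact: P2_mixture_exists.
have W2p t u : 0 <= t <= 1 -> 0 <= u <= 1 ->
    W2 (p t) (p u) = Num.sqrt m * (2 * s * `|t - u|).
  move=> t01 u01; rewrite -ydist.
  apply: (W2_moving_atom mu0 m01 _ (dlE t) (dlE u) (pE t) (pE u)).
  (* The atom stays within [s] of [x] and moves by at most [2 s]: this is the source of
     [3 * s <= r]. *)
  apply: le_trans (lerD (yx t t01) (_ : _ <= 2 * s)) _; last lra.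
  rewrite ydist ler_piMr ?mulr_ge0 ?(ltW s0)//.
  by move: t01 u01 => /andP[? ?] /andP[? ?]; rewrite ler_norml; apply/andP; split; lra.
have I0 : 0 <= (0 : R) <= 1 by rewrite lexx ler01.
have I1 : 0 <= (1 : R) <= 1 by rewrite lexx ler01.
have W01 : W2 (p 0) (p 1) = Num.sqrt m * (2 * s).
  by rewrite W2p// sub0r normrN normr1 mulr1.
have geo : is_geodesic p.
  move=> t u t01 u01; rewrite W2p// W01 distrC; ring.
have Ih : 0 <= (1 / 2 : R) <= 1 by apply/andP; split; lra.
have := Fconc p geo (1 / 2) Ih; rewrite W01 exprMn sqr_sqrtr ?(ltW m0)// => conc.
have := h0 m (p 0) m0 (ltW m1) md0 (pE 0).
have := h1 m (p 1) m0 (ltW m1) md1 (pE 1).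
have := hh m (p (1 / 2)) m0 (ltW m1) mdh (pE (1 / 2)).
rewrite !Idl y0 y1 yh D0 !subr0 !ltr_norml => /andP[_ qh] /andP[q1 _] /andP[q0 _].
have key : (F (p 0) - F mu) / m + (F (p 1) - F mu) / m - 2 * ((F (p (1 / 2)) - F mu) / m)
    <= Lam * s ^+ 2.
  have -> : (F (p 0) - F mu) / m + (F (p 1) - F mu) / m - 2 * ((F (p (1 / 2)) - F mu) / m)
     = (F (p 0) + F (p 1) - 2 * F (p (1 / 2))) / m by field; rewrite gt_eqF.
  rewrite ler_pdivrMr//; move: conc; move: (F _) (F _) (F _) => f0 f1 f2; lra.
move: key qh q1 q0.
move: ((F (p 0) - F mu) / m) ((F (p 1) - F mu) / m) ((F (p (1 / 2)) - F mu) / m).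
by move: (D _) (D _) (D _) => u0 u1 uh q0 q1 qh; lra.
Qed.

(** All the mass of the open ball is sent to one point [z] of its boundary, which moves it by less
    than [2 r]. The index [i] supplies a unit vector. *)
Lemma push_away mu (x : Rd) (i : 'I_d) (r : R) : 0 < r -> exists nu,
  nu [set y | enorm (y - x) < r] = 0%E /\ W2 mu nu <= 2 * r.
Proof.
move=> r0; pose z := x + r *: delta_mx 0 i.
pose f y := if enorm (y - x) < r then z else y.
have mb : measurable_fun setT (fun y : Rd => enorm (y - x) < r).
  apply: measurable_fun_ltr => //.
  by apply: measurable_enorm; exact: measurable_rVB.
have mf : measurable_fun setT f by apply: measurable_fun_ifT.
have fdist y : enorm (y - f y) <= 2 * r.
  rewrite /f; case: ifP => [h|_]; last by rewrite subrr enorm0 mulr_ge0// ltW.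
  have := ler_enormB (y - x) (r *: delta_mx 0 i).
  rewrite enormZ enorm_delta mulr1 gtr0_norm// /z opprD addrA; lra.
have [Q hQ] := image_exists mf mu.
have mQ : (\int[Q]_x (enorm x ^+ 2)%:E < +oo)%E.
  rewrite (integral_image_ge0 mf hQ) /=; first last.
  - by move=> y; rewrite lee_fin sqr_ge0.
  - by apply/measurable_EFinP; exact: measurable_enorm2.
  have : mu.-integrable setT (EFin \o (fun y => enorm (f y) ^+ 2)).
    apply: (@P2_integrable _ _ mu _ (2 * (2 * r) ^+ 2) 2).
      exact: measurable_enorm2.
    move=> y; rewrite ger0_norm ?sqr_ge0//.
    have -> : f y = y - (y - f y) by rewrite opprB addrC subrK.
    apply: le_trans (enorm_sqrB_le _ _) _.
    have : enorm (y - f y) ^+ 2 <= (2 * r) ^+ 2.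
      by rewrite ler_sqr ?nnegrE ?enorm_ge0 ?mulr_ge0 ?(ltW r0).
    by lra.
  move=> /integrableP[_]; apply: le_lt_trans; rewrite le_eqVlt; apply/orP; left.
  by apply/eqP/eq_integral => y _ /=; rewrite ger0_norm// sqr_ge0.
exists (MkP2 mQ); split.
  rewrite /= (hQ _ (measurable_enorm_ball x r)) /pushforward.
  rewrite (_ : _ @^-1` _ = set0) ?measure0//; apply/seteqP; split=> // y /=.
  rewrite /f; case: ifP => [_|->//].
  by rewrite /z addrAC subrr add0r enormZ enorm_delta mulr1 gtr0_norm// ltxx.
have mg : measurable_fun setT (fun y : Rd => (y, f y)) by exact: measurable_fun_pair.
have [pi hpi] := image_exists mg mu.
have cpi : coupling mu (MkP2 mQ) pi.
  split=> A mA.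
    have mfA : measurable (fst @^-1` A : set (Rd * Rd)).
      by rewrite -[X in measurable X]setTI; exact: measurable_fst.
    by rewrite /pushforward (hpi _ mfA).
  have msA : measurable (snd @^-1` A : set (Rd * Rd)).
    by rewrite -[X in measurable X]setTI; exact: measurable_snd.
  by rewrite /= (hQ A mA) /pushforward (hpi _ msA).
have r2 : 0 <= 2 * r by rewrite mulr_ge0// ltW.
apply: (W2_le_coupling r2 cpi).
rewrite (integral_image_ge0 mg hpi) /=; first last.
- by move=> w; rewrite lee_fin sqr_ge0.
- by apply/measurable_EFinP; apply: measurable_funX; exact: measurable_cost.
apply: (@le_trans _ _ (\int[mu]_y ((2 * r) ^+ 2)%:E)%E); last first.
  by rewrite integral_cst// -[leRHS]mule1 lee_wpmul2l ?lee_fin ?sqr_ge0// probability_le1.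
apply: ge0_le_integral => //.
- by move=> y _; rewrite lee_fin sqr_ge0.
- by apply/measurable_EFinP; apply: measurable_enorm2; exact: measurable_rVB.
- by move=> y _; rewrite lee_fin ler_sqr ?nnegrE ?enorm_ge0.
Qed.

(** The trace involves diagonal entries only, so second differences along coordinate directions
    suffice. The bound holds at measures without mass near [x] and passes to [mu] by [W2]-continuity
    of the Hessian. *)
Lemma geodesically_concave_laplacian_le (F : P2 R d -> R) (Lam : R) mu (x : Rd) :
  partially_C2 F -> geodesically_concave Lam F ->
  laplacian (flat_derivative F mu) x <= d%:R * Lam.
Proof.
move=> FC2 Fconc.
have diag i : hessian (flat_derivative F mu) x i i <= Lam.
  apply/ler_addgt0Pr => e e0.
  have [_ _ hc _] := FC2; have [del del0 hdel] := hc x mu e e0.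
  (* Clearing a ball of radius [del / 4] moves [mu] by at most [del / 2 < del]. *)
  have r0 : 0 < del / 4 by rewrite divr_gt0.
  have [nu [nu0 Wnu]] := push_away mu x i r0.
  have hW : W2 mu nu < del by apply: le_lt_trans Wnu _; lra.
  have x0 : `|x - x| < del by rewrite subrr normr0.
  have h := hdel x nu x0 hW.
  have hnu : hessian (flat_derivative F nu) x i i <= Lam.
    apply: hessian_diag_le.
    - exact: partially_C2_differentiable FC2 nu.
    - exact: partially_C2_dmu_differentiable FC2 nu.
    (* A third of the cleared radius, as required by [3 * s <= r]. *)
    exists (del / 12); first by rewrite divr_gt0.
    move=> s /andP[s0 sd].
    apply: (second_difference_le Fconc (partially_C2_flat FC2 nu) nu0) => //.
      exact: enorm_delta.
    by move: sd; lra.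
  have sub (A B : 'M[R]_d) : `|A i i - B i i| <= `|A - B|.
    by have := mx_entry_le_norm (A - B) i i; rewrite !mxE.
  have arith (a b : R) : a <= Lam -> `|a - b| < e -> b <= Lam + e.
    by move=> aL; rewrite ltr_norml => /andP[+ _]; lra.
  exact: arith hnu (le_lt_trans (sub _ _) h).
rewrite /laplacian /mxtrace; apply: (@le_trans _ _ (\sum_(i < d) Lam)).
  by apply: ler_sum => i _; exact: diag.
by rewrite sumr_const card_ord mulr_natl.
Qed.

End geodesic_concavity.

Theorem proposition5p5 (R : realType) (d : nat) (T eps : R)
    (H : 'rV[R]_d -> 'rV[R]_d -> P2 R d -> R) (G : P2 R d -> R)
    (Ueps U : R -> P2 R d -> R)
    (d_ge1 : (1 <= d)%N) (T_gt0 : 0 < T) (eps_gt0 : 0 < eps)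
    (HG_data : data_assumptions H G)
    (Ueps_bounded : bounded_on T Ueps) (Ueps_sol : HJeps_solution T eps H Ueps)
    (U_bounded : bounded_on T U) (U_sol : HJ0_solution T H U)
    (Ueps_T : forall mu, Ueps T mu = G mu) (U_T : forall mu, U T mu = G mu)
    (Ueps_lip : unif_lipschitz T W1 Ueps) (U_lip : unif_lipschitz T W2 U)
    (U_cont : weakly_continuous T U)
    (Ueps_classical : HJeps_classical_subsolution T eps H Ueps) :
  (forall C : R,
     (forall (t : R) mu x, 0 <= t <= T ->
        laplacian (flat_derivative (Ueps t) mu) x <= C) ->
     forall (t : R) mu, 0 <= t <= T -> Ueps t mu - U t mu <= C * (T - t) * eps) /\
  ((2 <= d)%N -> forall Lam : R,
     (forall t : R, 0 <= t <= T -> geodesically_concave Lam (Ueps t)) ->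
     forall (t : R) mu, 0 <= t <= T ->
       Ueps t mu - U t mu <= (d%:R * Lam) * (T - t) * eps).
Proof.
have terminal mu : Ueps T mu = U T mu by rewrite Ueps_T U_T.
have [_ U_super] := U_sol.
have compare := comparison_upper_bound T_gt0 eps_gt0 HG_data Ueps_bounded U_bounded
  U_super terminal Ueps_lip U_cont Ueps_classical.
split=> [//|_ Lam conc]; apply: compare => t mu x tT.
apply: geodesically_concave_laplacian_le; last exact: conc.
by have [UC2 _ _] := Ueps_classical; exact: UC2.
Qed.
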